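(* Consider the broken sample detection problem with joint distribution $\mathsf P_{X,Y}$ that does not depend on $n$ and with $m=\alpha n$ for some constant $\alpha\in(0,1]$. Strong detection is possible if and only if - $I_{\chi^2}(X;Y)=\infty$ or $\rho(X;Y)=1$, in the case $\alpha=1$; - $I_{\chi^2}(X;Y)=\infty$, in the case $\alpha<1$.
   Context: Broken sample detection problem. $\mathsf P_{X,Y}$ is a known joint distribution on a product space $\mathcal X\times\mathcal Y$ with marginals $\mathsf P_X,\mathsf P_Y$. One observes $\mathbf X=(X_1,\dots,X_n)\in\mathcal X^n$ and $\mathbf Y=(Y_1,\dots,Y_m)\in\mathcal Y^m$, $m\le n$. Under $\mathcal H_0$: $(\mathbf X,\mathbf Y)\sim \mathsf P_X^{\otimes n}\otimes\mathsf P_Y^{\otimes m}$. Under $\mathcal H_1$: $\pi$ is drawn uniformly from the set $S_{m,n}$ of injections $[m]\to[n]$, and conditionally on $\pi$ the pairs $(X_{\pi(i)},Y_i)$, $i\in[m]$, are i.i.d. from $\mathsf P_{X,Y}$ and, independently, the $X_j$, $j\in[n]\setminus\pi([m])$, are i.i.d. from $\mathsf P_X$. Only $(\mathbf X,\mathbf Y)$ is observed. Strong detection is possible if there is a sequence of tests (based on $(\mathbf X,\mathbf Y)$) whose Type-I and Type-II error probabilities both tend to $0$ as $n\to\infty$. Here $m=\alpha n$ is read as $m=\lfloor\alpha n\rfloor$ when $\alpha n$ is not an integer. The $\chi^2$-information is $I_{\chi^2}(X;Y)=\chi^2(\mathsf P_{X,Y}\|\mathsf P_X\otimes\mathsf P_Y)$,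 where $\chi^2(P\|Q)=\int(\frac{dP}{dQ}-1)^2dQ$ if $P\ll Q$ and $\infty$ otherwise. The maximal correlation is $\rho(X;Y)=\sup_{g,h}\{\mathbb E_{\mathsf P_{X,Y}}[g(X)h(Y)]:\mathbb E[g(X)]=\mathbb E[h(Y)]=0,\ \mathbb E[g^2(X)]=\mathbb E[h^2(Y)]=1\}$ (supremum of the empty set taken as $0$). *)

(* Defs.v *)
From HB Require Import structures.
From mathcomp Require Import all_boot all_order all_algebra.
From mathcomp Require Import all_classical all_reals all_analysis.
Import Order.TTheory GRing.Theory Num.Theory.
Import numFieldNormedType.Exports.

Set Implicit Arguments.
Unset Strict Implicit.
Unset Printing Implicit Defensive.

Local Open Scope classical_set_scope.
Local Open Scope ring_scope.
Local Open Scope ereal_scope.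

Section marginals.
Context d1 d2 (T1 : measurableType d1) (T2 : measurableType d2) (R : realType).

HB.instance Definition _ :=
  isMeasurableFun.Build _ _ (T1 * T2)%type T1 (@fst T1 T2) measurable_fst.
HB.instance Definition _ :=
  isMeasurableFun.Build _ _ (T1 * T2)%type T2 (@snd T1 T2) measurable_snd.

Variable P : probability (T1 * T2)%type R.

Definition marginal1 : probability T1 R := distribution P (@fst T1 T2).
Definition marginal2 : probability T2 R := distribution P (@snd T1 T2).

End marginals.

Definition chi2_divergence d (T : measurableType d) (R : realType)
    (P Q : probability T R) : \bar R :=
  if `[< P `<< Q >]
  then \int[Q]_x (Radon_Nikodym (charge_of_finite_measure P) Q x - 1) ^+ 2
  else +oo.

Definition chi2_information d1 d2 (T1 : measurableType d1)
    (T2 : measurableType d2) (R : realType)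
    (P : probability (T1 * T2)%type R) : \bar R :=
  chi2_divergence P (marginal1 P \x marginal2 P).

Definition standardized d (T : measurableType d) (R : realType)
    (P : probability T R) (g : T -> R) : Prop :=
  'E_P[g] = 0 /\ 'E_P[fun x => (g x ^+ 2)%R] = 1.

Definition correlations d1 d2 (T1 : measurableType d1)
    (T2 : measurableType d2) (R : realType)
    (P : probability (T1 * T2)%type R) : set (\bar R) :=
  [set c | exists (g : {mfun T1 >-> R}) (h : {mfun T2 >-> R}),
    [/\ standardized (marginal1 P) g, standardized (marginal2 P) h &
        c = 'E_P[fun z => (g z.1 * h z.2)%R]]].

(* [ereal_sup set0] is -oo, hence the separate case. *)
Definition maximal_correlation d1 d2 (T1 : measurableType d1)
    (T2 : measurableType d2) (R : realType)
    (P : probability (T1 * T2)%type R) : \bar R :=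
  if correlations P == set0 then 0 else ereal_sup (correlations P).

Section iid.
Context d (T : measurableType d) (R : realType).

Definition tuple_cons n (z : T * n.-tuple T) : n.+1.-tuple T :=
  [tuple of z.1 :: z.2].

Lemma measurable_tuple_cons n : measurable_fun [set: _] (@tuple_cons n).
Proof. exact: measurable_cons. Qed.

HB.instance Definition _ n :=
  isMeasurableFun.Build _ _ _ _ (@tuple_cons n) (@measurable_tuple_cons n).

Fixpoint iid (P : probability T R) (n : nat) : probability (n.-tuple T) R :=
  match n with
  | 0 => dirac [tuple]
  | n'.+1 => distribution (P \x iid P n') (@tuple_cons n')
  end.

Lemma measurable_tuple_box n (A : 'I_n -> set T) :
  (forall i, measurable (A i)) ->
  measurable [set t : n.-tuple T | forall i, A i (tnth t i)].
Proof.
move=> mA; rewrite [X in measurable X](_ : _ =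
    \bigcap_(i in [set: 'I_n]) ((@tnth _ T ^~ i) @^-1` A i)).
  apply: fin_bigcap_measurable => // i _.
  by rewrite -[X in measurable X]setTI; exact: measurable_tnth measurableT _ (mA i).
by apply/seteqP; split => t /= h i => [_|]; exact: h.
Qed.

Lemma iid_box (P : probability T R) n (A : 'I_n -> set T) :
  (forall i, measurable (A i)) ->
  iid P n [set t | forall i, A i (tnth t i)] = \prod_(i < n) P (A i).
Proof.
elim: n A => [|n IHn] A mA.
  rewrite big_ord0 /= diracE mem_set //=; by case.
rewrite big_ord_recl -IHn //.
have mB : measurable [set t : n.-tuple T | forall i, A (lift ord0 i) (tnth t i)].
  by apply: (@measurable_tuple_box _ (fun i => A (lift ord0 i))) => i; exact: mA.
rewrite -(product_measure1E _ (iid P n) (mA ord0) mB) /=.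
rewrite /distribution /pushforward; congr (_ _).
apply/seteqP; split => -[x t] /=.
  move=> h; split=> [|i]; first exact: (h ord0).
  by have := h (lift ord0 i); rewrite tnthS.
move=> [hx ht] i; case: (unliftP ord0 i) => [j ->|->]; last exact: hx.
by rewrite tnthS.
Qed.

End iid.

Section broken_sample.
Context d1 d2 (T1 : measurableType d1) (T2 : measurableType d2) (R : realType).
Implicit Type P : probability (T1 * T2)%type R.

Definition null_law P n m : probability (n.-tuple T1 * m.-tuple T2)%type R :=
  iid (marginal1 P) n \x iid (marginal2 P) m.

Definition injections m n : {set {ffun 'I_m -> 'I_n}} :=
  [set pi : {ffun 'I_m -> 'I_n} | injectiveb pi]%SET.

(* From m pairs z.1 and n spare points z.2, builds the sample in which
   (X_(pi i), Y_i) is the i-th pair, and X_j is the j-th spare point when j is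
   not in the image of pi; the remaining spare points are discarded. *)
Definition assemble m n (pi : {ffun 'I_m -> 'I_n})
    (z : m.-tuple (T1 * T2) * n.-tuple T1) : n.-tuple T1 * m.-tuple T2 :=
  ([tuple if [pick i | pi i == j] is Some i
          then (tnth z.1 i).1 else tnth z.2 j | j < n],
   [tuple (tnth z.1 i).2 | i < m]).

Lemma measurable_assemble m n (pi : {ffun 'I_m -> 'I_n}) :
  measurable_fun [set: _] (assemble pi).
Proof.
apply/measurable_fun_pairP; split; apply/measurable_fun_tnthP => j.
  rewrite [X in measurable_fun _ X](_ : _ = fun z =>
      if [pick i | pi i == j] is Some i then (tnth z.1 i).1 else tnth z.2 j).
    case: pickP => [i _|_].
      apply: (measurableT_comp measurable_fst).
      exact: (measurableT_comp (measurable_tnth i) measurable_fst).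
    exact: (measurableT_comp (measurable_tnth j) measurable_snd).
  by apply/funext => z /=; rewrite tnth_mktuple.
rewrite [X in measurable_fun _ X](_ : _ = fun z => (tnth z.1 j).2).
  apply: (measurableT_comp measurable_snd).
  exact: (measurableT_comp (measurable_tnth j) measurable_fst).
by apply/funext => z /=; rewrite tnth_mktuple.
Qed.

HB.instance Definition _ m n (pi : {ffun 'I_m -> 'I_n}) :=
  isMeasurableFun.Build _ _ _ _ (assemble pi) (measurable_assemble pi).

Definition planted_law P m n (pi : {ffun 'I_m -> 'I_n}) :
    probability (n.-tuple T1 * m.-tuple T2)%type R :=
  distribution (iid P m \x iid (marginal1 P) n) (assemble pi).

Lemma planted_law_box P m n (pi : {ffun 'I_m -> 'I_n})
    (A : 'I_n -> set T1) (B : 'I_m -> set T2) :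
  injective pi ->
  (forall j, measurable (A j)) -> (forall i, measurable (B i)) ->
  planted_law P pi [set z | (forall j, A j (tnth z.1 j)) /\
                            (forall i, B i (tnth z.2 i))] =
  \prod_(i < m) P (A (pi i) `*` B i) *
  \prod_(j < n | j \notin codom pi) marginal1 P (A j).
Proof.
move=> injpi mA mB.
pose A' j := if j \in codom pi then [set: T1] else A j.
have mA' j : measurable (A' j) by rewrite /A'; case: ifP.
rewrite [X in _ * X]big_mkcond /= [X in _ * X](_ : _ =
    \prod_(j < n) marginal1 P (A' j)); last first.
  apply: eq_bigr => j _; rewrite /A'; case: (j \in codom pi) => //=.
  by rewrite probability_setT.
pose C i := A (pi i) `*` B i.
have mC i : measurable (C i) by exact: measurableX.
rewrite -(iid_box P mC) -(iid_box _ mA').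
rewrite -(product_measure1E (iid P m) (iid (marginal1 P) n)
  (measurable_tuple_box mC) (measurable_tuple_box mA')).
rewrite /planted_law /distribution /pushforward; congr (_ _).
apply/seteqP; split => -[t u] /=.
  move=> [hA hB]; split=> [i|j].
    split; last by have := hB i; rewrite tnth_mktuple.
    have := hA (pi i); rewrite tnth_mktuple.
    by case: pickP => [k /eqP/injpi <-|/(_ i)] //; rewrite eqxx.
  rewrite /A'; case: ifPn => // /codomP jpi.
  have := hA j; rewrite tnth_mktuple; case: pickP => // i /eqP ij.
  by case: jpi; exists i.
move=> [hAB hA]; split=> [j|i]; rewrite tnth_mktuple; last by have [] := hAB i.
case: pickP => [i /eqP <-|jpi]; first by have [] := hAB i.
have := hA j; rewrite /A' ifN //.
by apply/codomP => -[i ji]; have := jpi i; rewrite ji eqxx.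
Qed.

(* The law of (X, Y) when pi is uniform on the injections (requires m <= n). *)
Definition alt_law P n m (A : set (n.-tuple T1 * m.-tuple T2)) : \bar R :=
  ((#|injections m n|%:R : R)^-1)%:E *
  \sum_(pi in injections m n) planted_law P pi A.

Lemma alt_law_setT P n m : (m <= n)%N -> alt_law P [set: n.-tuple T1 * m.-tuple T2] = 1.
Proof.
move=> mn; rewrite /alt_law.
under eq_bigr do rewrite probability_setT.
rewrite sumEFin sumr_const -EFinM mulVf // pnatr_eq0 card_inj_ffuns.
by rewrite !card_ord -lt0n ffact_gt0.
Qed.

(* A test returns true when it rejects the null hypothesis; m n is the size of
   the Y-sample when the X-sample has size n. *)
Definition strong_detection P (m : nat -> nat) : Prop :=
  exists test : forall n, n.-tuple T1 * (m n).-tuple T2 -> bool,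
    [/\ forall n, measurable_fun [set: _] (test n),
        null_law P n (m n) (test n @^-1` [set true]) @[n --> \oo] --> 0 &
        alt_law P (test n @^-1` [set false]) @[n --> \oo] --> 0].

End broken_sample.

(* Main.v *)
Require Import Defs.
From HB Require Import structures.
From mathcomp Require Import all_boot all_order all_fingroup all_algebra.
From mathcomp Require Import zify ring lra finmap complex.
From mathcomp Require Import all_classical all_reals all_analysis.
From mathcomp Require Import measurable_realfun.
Import Order.TTheory GRing.Theory Num.Theory.
Import numFieldNormedType.Exports.

(** Quantizing each observation into finitely many cells turns the two
    hypotheses into finite product weights. These are governed by the centred
    density [M] of the quantized pair law: its density with respect to the
    product of its marginals, minus one. Nothing is lost by quantizing: the
    chi-square information is finite as soon as the finite chi-square sums are
    uniformly bounded, and conversely ([chi2_information_lty],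
    [finite_chi2_bounded]), and every measurable event is approximated, under
    all the laws involved at once, by an event that depends on quantized
    observations only ([generated_approximable]).

    Impossibility. The likelihood ratio of the mixture is the average over
    injections [pi] of [\prod_i (1 + M (x (pi i)) (y i))]. Expanding the product
    and sorting the terms by the set [T] of indices where [M] is chosen and by
    its image [S] gives components [perm_sum S T], pairwise orthogonal because [M]
    is centred in each variable. Their norms are bounded level by level in
    [#|T|]: expand along one index of [T]; in the square, the diagonal terms cost
    the chi-square [t], and the cross terms cost [rho ^+ 2], where the
    maximal correlation [rho] bounds the norm of [M] as an operator
    ([perm_sum_sqr_le]). Summing over [S] and [T], the second moment of the
    likelihood ratio is at most
    [\sum_k \prod_(i < k) (alpha * (t + i * rho ^+ 2) / (i + 1))]. The ratio of
    consecutive terms tends to [alpha * rho ^+ 2], so that the sum is bounded in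
    [n] when [alpha < 1] or [rho < 1] ([level_weight_summable]). By the
    Cauchy-Schwarz inequality the probability of an event under the alternative
    is then at most a constant times the square root of its probability under
    the null hypothesis ([alt_prob_sqr_le]), which excludes strong detection.

    Detection when the chi-square information is infinite. Choose a quantization
    with a large finite chi-square [t]. The sum of all [M (x j) (y i)] has mean
    [0] and variance [n * m * t] under the null hypothesis; under the alternative
    its mean is [m * t] and its variance is of the order of [n * m * t] at most.
    Chebyshev's inequality separates the two when [t] is large
    ([detectable_chi2]).

    Detection when [rho = 1] and [alpha = 1]. There are step functions [u] and
    [v] such that [u] has variance at least [1 / 4] and [u X - v Y] has a tiny
    variance under the joint law. The statistic
    [\sum_j u (x j) - \sum_i v (y i)] does not depend on the order of the sample:
    under the alternative it is concentrated at a small multiple of [sqrt n],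
    while under the null hypothesis it is spread at the scale [sqrt n]
    ([sum_anticoncentration]), since the characteristic function of the first
    sum is small away from the origin ([detectable_correlation]). *)

Set Implicit Arguments.
Unset Strict Implicit.
Unset Printing Implicit Defensive.

Local Open Scope ring_scope.

(** * Product laws on finite alphabets *)

Definition upd (K : finType) (I : Type) (x : {ffun K -> I}) (k : K) (a : I) :
  {ffun K -> I} := [ffun l => if l == k then a else x l].

Lemma upd_same (K : finType) (I : Type) (x : {ffun K -> I}) k a :
  upd x k a k = a.
Proof. by rewrite ffunE eqxx. Qed.

Lemma upd_other (K : finType) (I : Type) (x : {ffun K -> I}) k a l :
  l != k -> upd x k a l = x l.
Proof. by move=> lk; rewrite ffunE (negbTE lk). Qed.

Definition expect (R : realFieldType) (K I : finType) (w : I -> R)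
    (F : {ffun K -> I} -> R) : R :=
  \sum_(x : {ffun K -> I}) (\prod_k w (x k)) * F x.

Section expectation.
Context (R : realFieldType) (K I : finType) (w : I -> R).
Implicit Types F G : {ffun K -> I} -> R.

Lemma eq_expect F G : F =1 G -> expect w F = expect w G.
Proof. by move=> FG; apply: eq_bigr => x _; rewrite FG. Qed.

Lemma expectD F G : expect w (fun x => F x + G x) = expect w F + expect w G.
Proof. by rewrite -big_split; apply: eq_bigr => x _; rewrite mulrDr. Qed.

Lemma expectZ c F : expect w (fun x => c * F x) = c * expect w F.
Proof. by rewrite mulr_sumr; apply: eq_bigr => x _; rewrite mulrCA. Qed.

Lemma expect_sum (L : Type) (s : seq L) (Q : pred L)
    (F : L -> {ffun K -> I} -> R) :
  expect w (fun x => \sum_(l <- s | Q l) F l x) = \sum_(l <- s | Q l) expect w (F l).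
Proof.
by rewrite exchange_big; apply: eq_bigr => x _; rewrite mulr_sumr.
Qed.

Hypothesis w1 : \sum_a w a = 1.

Lemma expect_cst c : expect w (fun _ : {ffun K -> I} => c) = c.
Proof.
rewrite /expect -mulr_suml -(bigA_distr_bigA (fun _ => w)).
by rewrite big1 ?mul1r// => k _; rewrite w1.
Qed.

(** The product weight of a point, times the weight of a fresh letter, is
    invariant when that letter is exchanged with coordinate [k]. *)
Lemma expect_resample k F :
  expect w F = expect w (fun x => \sum_a w a * F (upd x k a)).
Proof.
pose W (x : {ffun K -> I}) := \prod_k w (x k).
have swapW (x : {ffun K -> I}) a : W x * w a = W (upd x k a) * w (x k).
  rewrite /W (bigD1 k)//= [in RHS](bigD1 k)//= upd_same.
  rewrite [X in _ = _ * X * _](eq_bigr (fun l => w (x l))); first by ring.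
  by move=> l lk; rewrite upd_other.
pose h (z : {ffun K -> I} * I) := (upd z.1 k z.2, z.1 k).
have hK : involutive h.
  move=> [x a]; rewrite /h /= upd_same; congr (_, _).
  by apply/ffunP => l; rewrite !ffunE; case: eqP => [->|].
transitivity (\sum_z W z.1 * w z.2 * F z.1).
  rewrite -(pair_bigA _ (fun x a => W x * w a * F x)) /=.
  apply: eq_bigr => x _; rewrite -mulr_suml -mulr_sumr w1 mulr1//.
rewrite (reindex h); last by exists h => z _; exact: hK.
rewrite -(pair_bigA _ (fun x a => W (upd x k a) * w (x k) * F (upd x k a))) /=.
apply: eq_bigr => x _; rewrite mulr_sumr; apply: eq_bigr => a _.
by rewrite -swapW mulrA.
Qed.

Hypothesis w0 : forall a, 0 <= w a.

Lemma expect_le F G : (forall x, F x <= G x) -> expect w F <= expect w G.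
Proof.
by move=> FG; apply: ler_sum => x _; rewrite ler_wpM2l// prodr_ge0.
Qed.

End expectation.

Definition expect2 (R : realFieldType) (K L I J : finType) (p : I -> R) (q : J -> R)
  (F : {ffun K -> I} -> {ffun L -> J} -> R) : R :=
  expect p (fun x => expect q (F x)).

Section expect2_theory.
Context (R : realFieldType) (K L I J : finType) (p : I -> R) (q : J -> R).
Hypotheses (p1 : \sum_a p a = 1) (q1 : \sum_b q b = 1).
Hypotheses (p0 : forall a, 0 <= p a) (q0 : forall b, 0 <= q b).
Implicit Types F G : {ffun K -> I} -> {ffun L -> J} -> R.
Local Notation E := (expect2 p q).

Lemma eq_expect2 F G : F =2 G -> E F = E G.
Proof. by move=> FG; apply: eq_expect => x; apply: eq_expect => y. Qed.

Lemma expect2D F G : E (fun x y => F x y + G x y) = E F + E G.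
Proof. by rewrite /expect2 -expectD; apply: eq_expect => x; rewrite expectD. Qed.

Lemma expect2Z c F : E (fun x y => c * F x y) = c * E F.
Proof. by rewrite /expect2 -expectZ; apply: eq_expect => x; rewrite expectZ. Qed.

Lemma expect2_sum (A : Type) (s : seq A) (Q : pred A)
    (F : A -> {ffun K -> I} -> {ffun L -> J} -> R) :
  E (fun x y => \sum_(l <- s | Q l) F l x y) = \sum_(l <- s | Q l) E (F l).
Proof.
by rewrite /expect2 -expect_sum; apply: eq_expect => x; rewrite expect_sum.
Qed.

Lemma expect2_cst c : E (fun (_ : {ffun K -> I}) (_ : {ffun L -> J}) => c) = c.
Proof. by rewrite /expect2 expect_cst// expect_cst. Qed.

Lemma expect2_le F G : (forall x y, F x y <= G x y) -> E F <= E G.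
Proof. by move=> FG; apply: expect_le => // x; apply: expect_le. Qed.

Lemma expect2_resample_l k F :
  E F = E (fun x y => \sum_a p a * F (upd x k a) y).
Proof.
rewrite /expect2 (expect_resample p1 k); apply: eq_expect => x.
by rewrite expect_sum; apply: eq_bigr => a _; rewrite expectZ.
Qed.

Lemma expect2_resample_r l F :
  E F = E (fun x y => \sum_b q b * F x (upd y l b)).
Proof.
by rewrite /expect2; apply: eq_expect => x; rewrite (expect_resample q1 l).
Qed.

End expect2_theory.

(** * Orthogonal components of the likelihood ratio *)

Definition placements (L K : finType) (S : {set K}) (T : {set L}) :
    {set {ffun L -> K}} :=
  [set pi : {ffun L -> K} | injectiveb pi & pi @: T == S].

Lemma in_placements (L K : finType) (S : {set K}) (T : {set L}) pi :
  (pi \in placements S T) = injectiveb pi && (pi @: T == S).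
Proof. by rewrite inE. Qed.

Section permanents.
Context (R : realFieldType) (K L I J : finType) (p : I -> R) (q : J -> R).
Context (M : I -> J -> R).
Hypotheses (p1 : \sum_a p a = 1) (q1 : \sum_b q b = 1).
Hypotheses (p0 : forall a, 0 <= p a) (q0 : forall b, 0 <= q b).
Hypotheses (Mx : forall b, \sum_a p a * M a b = 0).
Hypotheses (My : forall a, \sum_b q b * M a b = 0).
Implicit Types (x : {ffun K -> I}) (y : {ffun L -> J}) (S : {set K}) (T : {set L}).
Local Notation E := (expect2 p q).

(** Up to the number of extensions of an injection of [T] to the whole index set,
    this is the permanent of the submatrix of [M (x j) (y i)] with rows in [S] and
    columns in [T]. *)
Definition perm_sum S T x y : R :=
  \sum_(pi in placements S T) \prod_(i in T) M (x (pi i)) (y i).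
Local Notation W := perm_sum.

Lemma perm_sum_upd_l S T x y j a : j \notin S -> W S T (upd x j a) y = W S T x y.
Proof.
move=> jS; apply: eq_bigr => pi; rewrite inE => /andP[_ /eqP piT].
apply: eq_bigr => i iT; rewrite upd_other//; apply: contraNneq jS => <-.
by rewrite -piT imset_f.
Qed.

Lemma perm_sum_upd_r S T x y i b : i \notin T -> W S T x (upd y i b) = W S T x y.
Proof.
move=> iT; apply: eq_bigr => pi _; apply: eq_bigr => i' i'T.
by rewrite upd_other//; apply: contraNneq iT => <-.
Qed.

(** Every term has exactly one factor that involves [x j]. *)
Lemma perm_sum_mean_l S T x y j : j \in S -> \sum_a p a * W S T (upd x j a) y = 0.
Proof.
move=> jS; under eq_bigr do rewrite mulr_sumr.
rewrite exchange_big big1//= => pi; rewrite inE => /andP[/injectiveP inj /eqP piT].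
have /imsetP[i0 i0T jE] : j \in pi @: T by rewrite piT.
transitivity (\sum_a p a * M a (y i0) *
    \prod_(i in T | i != i0) M (x (pi i)) (y i)); last first.
  by rewrite -mulr_suml Mx mul0r.
apply: eq_bigr => a _; rewrite -mulrA; congr (_ * _).
rewrite (bigD1 i0)//= jE upd_same; congr (_ * _).
apply: eq_bigr => i /andP[_ ii0]; rewrite upd_other//.
by apply: contraNneq ii0 => /inj ->.
Qed.

Lemma perm_sum_mean_r S T x y i : i \in T -> \sum_b q b * W S T x (upd y i b) = 0.
Proof.
move=> iT; under eq_bigr do rewrite mulr_sumr.
rewrite exchange_big big1//= => pi _.
transitivity (\sum_b q b * M (x (pi i)) b *
    \prod_(i' in T | i' != i) M (x (pi i')) (y i')); last first.
  by rewrite -mulr_suml My mul0r.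
apply: eq_bigr => b _; rewrite -mulrA; congr (_ * _).
rewrite (bigD1 i)//= upd_same; congr (_ * _).
by apply: eq_bigr => i' /andP[_ ii']; rewrite upd_other.
Qed.

(** An index that belongs to only one of the two components can be integrated
    out, and this annihilates the component to which it belongs. *)
Lemma perm_sum_orthogonal S T S' T' : (S, T) != (S', T') ->
  E (fun x y => W S T x y * W S' T' x y) = 0.
Proof.
have orth_l S1 T1 S2 T2 j : j \in S1 -> j \notin S2 ->
    E (fun x y => W S1 T1 x y * W S2 T2 x y) = 0.
  move=> jS1 jS2; rewrite (expect2_resample_l q p1 j) -[RHS](expect2_cst K L p1 q1 0).
  apply: eq_expect2 => x y.
  under eq_bigr do rewrite (@perm_sum_upd_l S2)// mulrA.
  by rewrite -mulr_suml perm_sum_mean_l// mul0r.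
have orth_r S1 T1 S2 T2 i : i \in T1 -> i \notin T2 ->
    E (fun x y => W S1 T1 x y * W S2 T2 x y) = 0.
  move=> iT1 iT2; rewrite (expect2_resample_r p q1 i) -[RHS](expect2_cst K L p1 q1 0).
  apply: eq_expect2 => x y.
  under eq_bigr do rewrite (@perm_sum_upd_r S2)// mulrA.
  by rewrite -mulr_suml perm_sum_mean_r// mul0r.
have EC S1 T1 S2 T2 : E (fun x y => W S1 T1 x y * W S2 T2 x y) =
    E (fun x y => W S2 T2 x y * W S1 T1 x y).
  by apply: eq_expect2 => x y; rewrite mulrC.
rewrite xpair_eqE negb_and => /orP[]; rewrite finset.eqEsubset negb_and.
  case/orP => /fintype.subsetPn[j j1 j2]; first exact: orth_l j1 j2.
  by rewrite EC; exact: orth_l j1 j2.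
case/orP => /fintype.subsetPn[j j1 j2]; first exact: orth_r j1 j2.
by rewrite EC; exact: orth_r j1 j2.
Qed.

(** Expansion along column [t]. Given where [T :\ t] goes, the image of [t] is
    equally likely to be any remaining index: a transposition exchanges any two
    of them. *)
Lemma perm_sum_rec S T x y t : t \in T -> #|S| = #|T| ->
  W S T x y = (#|K| - #|T :\ t|)%:R^-1 *
    \sum_(j in S) M (x j) (y t) * W (S :\ j) (T :\ t) x y.
Proof.
move=> tT ST.
pose f (pi : {ffun L -> K}) := \prod_(i in T :\ t) M (x (pi i)) (y i).
pose In j S' := \sum_(pi in placements S' (T :\ t) | pi t == j) f pi.
have In_eq S' j j' : j \notin S' -> j' \notin S' -> In j S' = In j' S'.
  move=> jS jS'.
  pose h (pi : {ffun L -> K}) : {ffun L -> K} := [ffun i => tperm j j' (pi i)].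
  have hK : involutive h by move=> pi; apply/ffunP => i; rewrite !ffunE tpermK.
  rewrite /In (reindex h); last by exists h => ? _; exact: hK.
  have fixS' k : k \in S' -> tperm j j' k = k.
    by move=> kS; rewrite tpermD//; [move: jS|move: jS']; apply: contraNneq => ->.
  have same (pi : {ffun L -> K}) : pi @: (T :\ t) = S' ->
      {in T :\ t, h pi =1 pi}.
    by move=> piT i iT; rewrite ffunE fixS'// -piT imset_f.
  have h_in pi : pi \in placements S' (T :\ t) -> h pi \in placements S' (T :\ t).
    rewrite !inE => /andP[/injectiveP inj /eqP piT]; apply/andP; split.
      by apply/injectiveP => i i'; rewrite !ffunE => /perm_inj/inj.
    rewrite -piT; apply/eqP; apply: eq_in_imset; exact: same.
  apply: eq_big => [pi|pi /andP[]].
    rewrite (_ : (h pi \in _) = (pi \in placements S' (T :\ t))).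
      by rewrite ffunE -(inj_eq (@perm_inj _ (tperm j j'))) tpermK tpermL.
    by apply/idP/idP => /h_in//; rewrite hK.
  move=> /h_in; rewrite hK inE => /andP[_ /eqP piT] _.
  by apply: eq_bigr => i iT; rewrite same.
have WIn j : j \in S ->
    W (S :\ j) (T :\ t) x y = (#|K| - #|T :\ t|)%:R * In j (S :\ j).
  move=> jS.
  rewrite /W (partition_big (fun pi : {ffun L -> K} => pi t) [pred k | k \notin S :\ j]).
    rewrite (eq_bigr (fun=> In j (S :\ j))) => [|k].
      rewrite sumr_const mulr_natl; congr (_ *+ _).
      transitivity #|[predC S :\ j]|; first by apply: eq_card => k.
      have := cardC (S :\ j); have := cardsD1 t T; have := cardsD1 j S.
      by rewrite tT jS; lia.
    by move=> /= kS; apply: In_eq; rewrite // !inE eqxx.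
  move=> pi; rewrite /= !inE => /andP[/injectiveP inj /eqP piT].
  rewrite -in_setD1 -piT; apply/negP => /imsetP[i iT /inj ti].
  by move: iT; rewrite ti !inE eqxx.
have dn0 : (#|K| - #|T :\ t|)%:R != 0 :> R.
  rewrite pnatr_eq0 -lt0n subn_gt0.
  by apply: leq_trans (max_card (mem S)); rewrite ST (cardsD1 t T) tT.
rewrite mulr_sumr [LHS]/perm_sum.
rewrite (partition_big (fun pi : {ffun L -> K} => pi t) [pred j | j \in S]); last first.
  by move=> pi; rewrite in_placements => /andP[_ /eqP <-]; exact: imset_f.
apply: eq_bigr => j jS; rewrite WIn// mulrCA (mulrA _^-1) mulVf// mul1r mulr_sumr.
apply: eq_big => [pi|pi /andP[_ /eqP <-]]; last by rewrite (big_setD1 t).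
rewrite !in_placements; case: (pi t =P j) jS => [<-|_] jS; rewrite ?andbF// !andbT.
apply: andb_id2l => /injectiveP inj.
rewrite -[in LHS](finset.setD1K tT) imsetU1; apply/eqP/eqP => [<-|->].
  rewrite finset.setU1K//; apply/negP => /imsetP[i iT /inj ti].
  by move: iT; rewrite ti !inE eqxx.
by rewrite finset.setD1K.
Qed.

Context (t r : R).
Hypothesis Mt : \sum_a \sum_b p a * q b * M a b ^+ 2 <= t.
Hypothesis Mr : forall f : I -> R,
  \sum_b q b * (\sum_a p a * M a b * f a) ^+ 2 <= r * \sum_a p a * f a ^+ 2.

Lemma perm_sum_sqr_diag S T i j : j \notin S -> i \notin T ->
  E (fun x y => (M (x j) (y i) * W S T x y) ^+ 2) <=
  t * E (fun x y => W S T x y ^+ 2).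
Proof.
move=> jS iT; rewrite -expect2Z (expect2_resample_l q p1 j) (expect2_resample_r p q1 i).
apply: expect2_le => // x y.
rewrite (_ : \sum_b _ = (\sum_a \sum_b p a * q b * M a b ^+ 2) * W S T x y ^+ 2).
  by rewrite ler_wpM2r// sqr_ge0.
rewrite exchange_big /= mulr_suml; apply: eq_bigr => b _.
rewrite mulr_sumr mulr_suml; apply: eq_bigr => a _.
by rewrite perm_sum_upd_l// perm_sum_upd_r// !upd_same; ring.
Qed.

(** Integrating out the three coordinates [x j], [x l] and [y i] turns the cross
    term into a scalar product of two images under the centred conditional
    expectation operator, hence into at most half the sum of their squared
    norms, which [Mr] bounds. *)
Lemma perm_sum_sqr_cross S T i j l : j \in S -> l \in S -> j != l -> i \notin T ->
  E (fun x y => (M (x j) (y i) * W (S :\ j) T x y) *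
                (M (x l) (y i) * W (S :\ l) T x y)) <=
  r / 2 * (E (fun x y => W (S :\ j) T x y ^+ 2) +
           E (fun x y => W (S :\ l) T x y ^+ 2)).
Proof.
move=> jS lS jl iT.
rewrite (expect2_resample_l q p1 j) (expect2_resample_l q p1 l).
rewrite (expect2_resample_r p q1 i).
rewrite (expect2_resample_l q p1 l (fun x y => W (S :\ j) T x y ^+ 2)).
rewrite (expect2_resample_l q p1 j (fun x y => W (S :\ l) T x y ^+ 2)).
rewrite -expect2D -expect2Z; apply: expect2_le => // x y.
pose U b := \sum_a p a * M a b * W (S :\ l) T (upd x j a) y.
pose V b := \sum_a p a * M a b * W (S :\ j) T (upd x l a) y.
have MU := Mr (fun a => W (S :\ l) T (upd x j a) y).
have MV := Mr (fun a => W (S :\ j) T (upd x l a) y).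
apply: (@le_trans _ _ (\sum_b q b * ((U b ^+ 2 + V b ^+ 2) / 2))).
  apply: ler_sum => b _; rewrite ler_wpM2l//.
  apply: (@le_trans _ _ (U b * V b)); last first.
    by have := sqr_ge0 (U b - V b); nra.
  rewrite mulrC /U /V mulr_suml le_eqVlt; apply/orP; left; apply/eqP.
  apply: eq_bigr => a _; rewrite 2!mulr_sumr; apply: eq_bigr => a' _.
  rewrite !perm_sum_upd_r//.
  rewrite upd_same (upd_other _ _ (_ : l != j)) 1?eq_sym// !upd_same.
  (* [W (S :\ j)] does not depend on [x j], nor [W (S :\ l)] on [x l] *)
  rewrite (@perm_sum_upd_l (S :\ j) _ (upd x l a)) ?inE ?eqxx//.
  have -> : upd (upd x l a) j a' = upd (upd x j a') l a.
    apply/ffunP => k; rewrite !ffunE; case: (k =P j) => // ->.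
    by rewrite (negbTE jl).
  rewrite (@perm_sum_upd_l (S :\ l) _ (upd x j a')) ?inE ?eqxx//.
  ring.
rewrite [X in X <= _](_ : _ = ((\sum_b q b * U b ^+ 2) + \sum_b q b * V b ^+ 2) / 2).
  by rewrite /U /V; lra.
rewrite -big_split mulr_suml; apply: eq_bigr => b _ /=; ring.
Qed.

(** Factor [i] is the price of passing from level [i] to level [i.+1]: [i.+1]
    diagonal terms at cost [t] each and [i.+1 * i] cross terms at cost [r] each,
    divided by the square of the normalisation of [perm_sum_rec]. *)
Definition level_bound n k : R :=
  \prod_(i < k) (i.+1%:R * (t + i%:R * r) / (n - i)%:R ^+ 2).

(** By induction on [#|T|]: expand along an element of [T] and separate the
    diagonal terms of the square from the cross terms. *)
Lemma perm_sum_sqr_le S T : 0 <= t -> 0 <= r -> #|S| = #|T| ->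
  E (fun x y => W S T x y ^+ 2) <=
  #|[set pi : {ffun L -> K} | injectiveb pi]|%:R ^+ 2 * level_bound #|K| #|T|.
Proof.
move=> t0 r0; move Tk : #|T| => k Sk; elim: k S T Tk Sk => [|k IH] S T.
  move=> /eqP; rewrite cards_eq0 => /eqP -> /eqP; rewrite cards_eq0 => /eqP ->.
  rewrite /level_bound big_ord0 mulr1 -[leRHS](expect2_cst K L p1 q1).
  rewrite le_eqVlt; apply/orP; left; apply/eqP; apply: eq_expect2 => x y.
  rewrite /W (eq_bigr (fun=> 1)) => [|pi _]; last by rewrite big_set0.
  rewrite sumr_const; congr (_%:R ^+ 2); apply: eq_card => pi.
  by rewrite !inE imset0 eqxx andbT.
move=> Tk Sk.
have [i iT] : exists i, i \in T by apply/card_gt0P; rewrite Tk.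
have Tik : #|T :\ i| = k by have := cardsD1 i T; rewrite iT Tk => -[].
pose d : R := (#|K| - k)%:R.
pose A j x y := M (x j) (y i) * W (S :\ j) (T :\ i) x y.
have -> : E (fun x y => W S T x y ^+ 2) =
    d^-1 ^+ 2 * \sum_(j in S) \sum_(l in S) E (fun x y => A j x y * A l x y).
  under eq_bigr do rewrite -expect2_sum.
  rewrite -expect2_sum -expect2Z; apply: eq_expect2 => x y.
  rewrite (@perm_sum_rec _ _ _ _ i)// ?Tk// Tik exprMn; congr (_ * _).
  rewrite expr2 mulr_suml; apply: eq_bigr => j _.
  by rewrite mulr_sumr.
set N := _%:R ^+ 2 in IH *.
rewrite /level_bound big_ord_recr/= -/(level_bound #|K| k) -/d.
rewrite [leRHS](_ : _ =
  d^-1 ^+ 2 * (k.+1%:R * (t + k%:R * r) * (N * level_bound #|K| k))); last first.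
  by rewrite exprVn; ring.
rewrite ler_wpM2l ?sqr_ge0//.
set B := N * _.
have SjT j : j \in S -> #|S :\ j| = k by move=> jS; have := cardsD1 j S; rewrite jS Sk => -[].
have bnd j : j \in S -> E (fun x y => W (S :\ j) (T :\ i) x y ^+ 2) <= B.
  by move=> jS; apply: IH => //; rewrite SjT.
have iTi : i \notin T :\ i by rewrite !inE eqxx.
have -> : k.+1%:R * (t + k%:R * r) * B = \sum_(j in S) (t + k%:R * r) * B.
  by rewrite sumr_const Sk -[RHS]mulr_natl mulrA.
apply: ler_sum => j jS; rewrite (big_setD1 j)//= mulrDl; apply: lerD.
  apply: le_trans (_ : t * E (fun x y => W (S :\ j) (T :\ i) x y ^+ 2) <= _).
    rewrite (eq_expect2 _ _ (fun x y => esym (expr2 (A j x y)))).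
    by apply: perm_sum_sqr_diag; rewrite // !inE eqxx.
  by rewrite ler_wpM2l// bnd.
have -> : k%:R * r * B = \sum_(l in S :\ j) r * B.
  by rewrite sumr_const SjT// -[RHS]mulr_natl mulrA.
apply: ler_sum => l; rewrite !inE => /andP[lj lS].
apply: le_trans (perm_sum_sqr_cross _ _ _ _) _; rewrite // 1?eq_sym//.
have := bnd _ jS; have := bnd _ lS; nra.
Qed.

(** Expanding each product over the set [T] of indices where [M] is chosen, and
    sorting the injections by the image of [T], shows that the sum of the products
    is the sum of all the orthogonal components [perm_sum S T]. *)
Lemma likelihood_ratio_sqr :
  E (fun x y => (\sum_(pi : {ffun L -> K} | injectiveb pi)
     \prod_i (1 + M (x (pi i)) (y i))) ^+ 2) =
  \sum_S \sum_T E (fun x y => W S T x y ^+ 2).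
Proof.
have WE x y : \sum_(pi : {ffun L -> K} | injectiveb pi)
     \prod_i (1 + M (x (pi i)) (y i)) = \sum_(z : {set K} * {set L}) W z.1 z.2 x y.
  rewrite -(pair_bigA _ (fun S T => W S T x y)) exchange_big /=.
  under eq_bigr do under eq_bigr do rewrite addrC.
  under eq_bigr do rewrite bigA_distr.
  rewrite exchange_big /=; apply: eq_bigr => T _.
  rewrite (partition_big (fun pi : {ffun L -> K} => pi @: T) xpredT)//=.
  apply: eq_bigr => S _; apply: eq_big => [pi|pi _]; first by rewrite inE.
  by rewrite [RHS]big_mkcond.
under eq_expect2 do rewrite WE expr2 mulr_suml.
rewrite expect2_sum (pair_bigA _ (fun S T => E (fun x y => W S T x y ^+ 2))) /=.
apply: eq_bigr => z _.
under eq_expect2 do rewrite mulr_sumr.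
rewrite expect2_sum (bigD1 z)//= [X in _ + X]big1 ?addr0 => [|z' zz'].
  by apply: eq_expect2 => x y; rewrite expr2.
by apply: perm_sum_orthogonal; rewrite -!surjective_pairing eq_sym.
Qed.

End permanents.

(** * Finite joint laws and the centred density *)

(** Lagrange's identity: the difference of the two sides is half the weighted sum
    of the squares of the two-by-two minors of [f] and [g]. *)
Lemma weighted_cauchy_schwarz (R : realFieldType) (A : finType) (Q : pred A)
    (w f g : A -> R) : (forall z, 0 <= w z) ->
  (\sum_(z | Q z) w z * (f z * g z)) ^+ 2 <=
  (\sum_(z | Q z) w z * f z ^+ 2) * (\sum_(z | Q z) w z * g z ^+ 2).
Proof.
move=> w0; rewrite -subr_ge0.
have -> : (\sum_(z | Q z) w z * f z ^+ 2) * (\sum_(z | Q z) w z * g z ^+ 2) -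
    (\sum_(z | Q z) w z * (f z * g z)) ^+ 2 =
    2^-1 * \sum_(z | Q z) \sum_(z' | Q z')
      w z * w z' * (f z * g z' - f z' * g z) ^+ 2.
  pose S (h : A -> A -> R) := \sum_(z | Q z) \sum_(z' | Q z') h z z'.
  have SE (u v : A -> R) : (\sum_(z | Q z) u z) * (\sum_(z | Q z) v z) = S (fun z z' => u z * v z').
    by rewrite mulr_suml; apply: eq_bigr => z _; rewrite mulr_sumr.
  have SC (u v : A -> R) : S (fun z z' => u z * v z') = S (fun z z' => v z * u z').
    by rewrite -!SE mulrC.
  have SD u v : S (fun z z' => u z z' + v z z') = S u + S v.
    by rewrite /S -big_split; apply: eq_bigr => z _; rewrite -big_split.
  have SZ c u : S (fun z z' => c * u z z') = c * S u.
    by rewrite /S mulr_sumr; apply: eq_bigr => z _; rewrite mulr_sumr.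
  rewrite -/(S _) expr2 !SE.
  rewrite [X in _ * X](_ : _ = S (fun z z' => (w z * f z ^+ 2) * (w z' * g z' ^+ 2)) +
      S (fun z z' => (w z * g z ^+ 2) * (w z' * f z' ^+ 2)) +
      S (fun z z' => - 2 * ((w z * (f z * g z)) * (w z' * (f z' * g z'))))).
    by rewrite SZ -[X in _ + X + _]SC; field.
  rewrite -!SD; apply: eq_bigr => z _; apply: eq_bigr => z' _; ring.
rewrite mulr_ge0// ?invr_ge0//; apply: sumr_ge0 => z _; apply: sumr_ge0 => z' _.
by rewrite mulr_ge0 ?sqr_ge0 ?(mulr_ge0 (w0 _) (w0 _)).
Qed.

Section finite_joint_law.
Context (R : realFieldType) (I J : finType) (P : I -> J -> R).

Definition row_law a : R := \sum_b P a b.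
Definition col_law b : R := \sum_a P a b.

(** The value on cells of product mass zero keeps every row and every column
    centred. *)
Definition centred_density a b : R :=
  if row_law a * col_law b == 0 then 0 else P a b / (row_law a * col_law b) - 1.

Definition finite_chi2 : R :=
  \sum_a \sum_b row_law a * col_law b * centred_density a b ^+ 2.

Local Notation p := row_law.
Local Notation q := col_law.
Local Notation M := centred_density.

Hypothesis P0 : forall a b, 0 <= P a b.
Hypothesis P1 : \sum_a \sum_b P a b = 1.

Lemma row_law_ge0 a : 0 <= p a. Proof. exact: sumr_ge0. Qed.
Lemma col_law_ge0 b : 0 <= q b. Proof. exact: sumr_ge0. Qed.
Lemma row_law_sum : \sum_a p a = 1. Proof. exact: P1. Qed.
Lemma col_law_sum : \sum_b q b = 1. Proof. by rewrite exchange_big. Qed.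

Lemma joint_le_row a b : P a b <= p a.
Proof. by rewrite /row_law (bigD1 b)//= lerDl sumr_ge0. Qed.

Lemma joint_le_col a b : P a b <= q b.
Proof. by rewrite /col_law (bigD1 a)//= lerDl sumr_ge0. Qed.

(** [P] vanishes on the cells whose product mass vanishes. *)
Lemma centred_densityE a b : p a * q b * M a b = P a b - p a * q b.
Proof.
rewrite /centred_density; case: ifPn => [/eqP pq0|pq0].
  rewrite mulr0 pq0 subr0; apply/esym/eqP; rewrite eq_le P0 andbT.
  move/eqP : pq0; rewrite mulf_eq0 => /orP[] /eqP <-.
    exact: joint_le_row.
  exact: joint_le_col.
by rewrite mulrBr mulr1 mulrC divfK.
Qed.

Lemma density_mul a b : p a * q b * (1 + M a b) = P a b.
Proof. by rewrite mulrDr centred_densityE; ring. Qed.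

Lemma centred_density_row b : \sum_a p a * M a b = 0.
Proof.
have [qb0|qb0] := eqVneq (q b) 0.
  by rewrite big1// => a _; rewrite /centred_density qb0 mulr0 eqxx mulr0.
apply: (mulfI qb0); rewrite mulr0 mulr_sumr.
transitivity (\sum_a (P a b - p a * q b)).
  by apply: eq_bigr => a _; rewrite -centred_densityE; ring.
by rewrite sumrB -/(q b) -mulr_suml row_law_sum; ring.
Qed.

Lemma centred_density_col a : \sum_b q b * M a b = 0.
Proof.
have [pa0|pa0] := eqVneq (p a) 0.
  by rewrite big1// => b _; rewrite /centred_density pa0 mul0r eqxx mulr0.
apply: (mulfI pa0); rewrite mulr0 mulr_sumr.
transitivity (\sum_b (P a b - p a * q b)).
  by apply: eq_bigr => b _; rewrite -centred_densityE; ring.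
by rewrite sumrB -/(p a) -mulr_sumr col_law_sum; ring.
Qed.

Lemma finite_chi2_ge0 : 0 <= finite_chi2.
Proof.
apply: sumr_ge0 => a _; apply: sumr_ge0 => b _.
by rewrite mulr_ge0 ?sqr_ge0// mulr_ge0 ?row_law_ge0 ?col_law_ge0.
Qed.

Definition correlation_bound (r : R) := forall u v,
  \sum_a p a * u a = 0 -> \sum_b q b * v b = 0 ->
  (\sum_a \sum_b P a b * (u a * v b)) ^+ 2 <=
  r * (\sum_a p a * u a ^+ 2) * (\sum_b q b * v b ^+ 2).

Lemma correlation_bound1 : correlation_bound 1.
Proof.
move=> u v _ _; rewrite mul1r.
have := @weighted_cauchy_schwarz _ (I * J)%type xpredT (fun z => P z.1 z.2)
  (fun z => u z.1) (fun z => v z.2) (fun z => P0 z.1 z.2).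
rewrite -(pair_bigA _ (fun a b => P a b * (u a * v b))) /=.
rewrite -(pair_bigA _ (fun a b => P a b * u a ^+ 2)) /=.
rewrite -(pair_bigA _ (fun a b => P a b * v b ^+ 2)) /=.
rewrite [X in _ <= _ * X]exchange_big /=.
by under [X in _ <= X * _]eq_bigr do rewrite -mulr_suml;
   under [X in _ <= _ * X]eq_bigr do rewrite -mulr_suml.
Qed.

(** The centred kernel acts on functions of the row as the conditional
    expectation given the column, followed by centring; apply the correlation
    bound to the centred [f] and to its own image. *)
Lemma centred_density_norm r : correlation_bound r -> 0 <= r -> forall f,
  \sum_b q b * (\sum_a p a * M a b * f a) ^+ 2 <= r * \sum_a p a * f a ^+ 2.
Proof.
move=> Hr r0 f.
pose v b := \sum_a p a * M a b * f a.
pose e := \sum_a p a * f a.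
pose u a := f a - e.
(* centring [f] does not change its image, the kernel being centred *)
have pu : \sum_a p a * u a = 0.
  under eq_bigr do rewrite mulrBr.
  by rewrite sumrB -mulr_suml row_law_sum mul1r subrr.
have qv : \sum_b q b * v b = 0.
  under eq_bigr do rewrite mulr_sumr.
  rewrite exchange_big big1// => a _.
  transitivity ((\sum_b q b * M a b) * (p a * f a)).
    by rewrite mulr_suml; apply: eq_bigr => b _; ring.
  by rewrite centred_density_col mul0r.
have vE b : v b = \sum_a p a * M a b * u a.
  rewrite /u; under eq_bigr do rewrite mulrBr.
  by rewrite sumrB -mulr_suml centred_density_row mul0r subr0.
have nv : \sum_b q b * v b ^+ 2 = \sum_a \sum_b P a b * (u a * v b).
  transitivity (\sum_a \sum_b (p a * q b * M a b) * (u a * v b)).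
    rewrite exchange_big; apply: eq_bigr => b _ /=.
    rewrite expr2 {1}vE mulr_suml mulr_sumr; apply: eq_bigr => a _; ring.
  under eq_bigr do under eq_bigr do rewrite centred_densityE mulrBl.
  under eq_bigr do rewrite sumrB.
  rewrite sumrB -[RHS]subr0; congr (_ - _).
  under eq_bigr do under eq_bigr do rewrite mulrACA.
  under eq_bigr do rewrite -mulr_sumr qv mulr0.
  by rewrite big1.
have nu : \sum_a p a * u a ^+ 2 <= \sum_a p a * f a ^+ 2.
  rewrite (_ : \sum_a p a * u a ^+ 2 = \sum_a p a * f a ^+ 2 - e ^+ 2).
    by rewrite lerBlDr lerDl sqr_ge0.
  transitivity (\sum_a (p a * f a ^+ 2 - 2 * e * (p a * f a) + e ^+ 2 * p a)).
    by apply: eq_bigr => a _; rewrite /u; ring.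
  by rewrite big_split sumrB -!mulr_sumr row_law_sum -/e /=; ring.
have := Hr u v pu qv; rewrite -nv -/v.
set V := \sum_b q b * v b ^+ 2; set U := \sum_a p a * u a ^+ 2 in nu *.
have V0 : 0 <= V by apply: sumr_ge0 => b _; rewrite mulr_ge0 ?sqr_ge0 ?col_law_ge0.
move=> VV; apply: (@le_trans _ _ (r * U)); last by rewrite ler_wpM2l.
have [->|Vn0] := eqVneq V 0.
  rewrite mulr_ge0//; apply: sumr_ge0 => a _.
  by rewrite mulr_ge0 ?sqr_ge0 ?row_law_ge0.
by rewrite -(ler_pM2r (_ : 0 < V)) 1?lt_neqAle 1?eq_sym ?Vn0// -expr2.
Qed.

End finite_joint_law.

Section planted_weights.
Context (R : realFieldType) (I J K L : finType) (P : I -> J -> R).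
Hypothesis P0 : forall a b, 0 <= P a b.
Hypothesis P1 : \sum_a \sum_b P a b = 1.
Local Notation p := (row_law P).
Local Notation q := (col_law P).
Local Notation M := (centred_density P).
Implicit Types (x : {ffun K -> I}) (y : {ffun L -> J}).

Definition null_weight x y : R := (\prod_j p (x j)) * \prod_i q (y i).

Definition planted_weight (pi : {ffun L -> K}) x y : R :=
  (\prod_i P (x (pi i)) (y i)) * \prod_(j | j \notin codom pi) p (x j).

Definition alt_weight x y : R :=
  #|[set pi : {ffun L -> K} | injectiveb pi]|%:R^-1 *
  \sum_(pi : {ffun L -> K} | injectiveb pi) planted_weight pi x y.

Lemma null_weight_ge0 x y : 0 <= null_weight x y.
Proof. by rewrite mulr_ge0// prodr_ge0// => ? _; [exact: row_law_ge0|exact: col_law_ge0]. Qed.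

Lemma planted_weight_ge0 (pi : {ffun L -> K}) x y : 0 <= planted_weight pi x y.
Proof.
rewrite mulr_ge0//; first by apply: prodr_ge0 => i _; exact: P0.
by apply: prodr_ge0 => j _; exact: row_law_ge0.
Qed.

Lemma prod_codom (pi : {ffun L -> K}) (f : K -> R) : injective pi ->
  \prod_j f j = (\prod_i f (pi i)) * \prod_(j | j \notin codom pi) f j.
Proof.
move=> inj; rewrite (bigID (mem (codom pi)))/=; congr (_ * _).
transitivity (\prod_(j <- codom pi) f j); last by rewrite big_image.
by rewrite [RHS]big_uniq// map_inj_uniq ?enum_uniq.
Qed.

Lemma planted_weightE (pi : {ffun L -> K}) x y : injective pi ->
  planted_weight pi x y =
  null_weight x y * \prod_i (1 + M (x (pi i)) (y i)).
Proof.
move=> inj; rewrite /null_weight (prod_codom _ inj) /planted_weight.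
rewrite [X in X * _ = _](eq_bigr (fun i => p (x (pi i)) * q (y i) * (1 + M (x (pi i)) (y i)))).
  by rewrite !big_split /=; ring.
by move=> i _; rewrite density_mul.
Qed.

End planted_weights.

(** * Bounded second moment *)

Definition level_weight (R : realFieldType) (alpha t r : R) (k : nat) : R :=
  \prod_(i < k) (alpha * (t + i%:R * r) / i.+1%:R).

(** The ratio of consecutive terms tends to [alpha * r]. *)
Lemma level_weight_summable (R : archiRealFieldType) (alpha t r : R) :
  0 <= alpha -> 0 <= t -> 0 <= r -> alpha * r < 1 ->
  exists C, forall N, \sum_(k < N) level_weight alpha t r k <= C.
Proof.
move=> a0 t0 r0 ar1; set c := level_weight alpha t r.
pose S N := \sum_(k < N) c k.
have c0 k : 0 <= c k.
  by apply: prodr_ge0 => i _; rewrite divr_ge0 ?mulr_ge0 ?addr_ge0 ?mulr_ge0.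
pose s := (1 + alpha * r) / 2.
have s1 : s < 1 by rewrite /s; lra.
have s0 : 0 <= s by rewrite /s divr_ge0 ?addr_ge0 ?mulr_ge0.
have gap : 0 < s - alpha * r by rewrite /s; lra.
pose K0 := Num.bound (alpha * t / (s - alpha * r)).
have cS k : (K0 <= k)%N -> c k.+1 <= s * c k.
  move=> Kk; rewrite /c /level_weight big_ord_recr /= mulrC ler_wpM2r ?c0//.
  rewrite ler_pdivrMr ?ltr0Sn//.
  have : alpha * t / (s - alpha * r) < k%:R.
    apply: lt_le_trans (archi_boundP _) _; last by rewrite ler_nat.
    by rewrite divr_ge0 ?mulr_ge0// ltW.
  by rewrite ltr_pdivrMr// -natr1; nra.
have SS N : S N.+1 = S N + c N by rewrite /S big_ord_recr.
(* past [K0] the terms decay at least like a geometric series of ratio [s], so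
   that the partial sum plus the tail of that series is nonincreasing *)
have tail N : S (K0 + N)%N + c (K0 + N)%N / (1 - s) <= S K0 + c K0 / (1 - s).
  elim: N => [|N IH]; first by rewrite addn0.
  apply: le_trans IH; rewrite addnS SS.
  have := cS _ (leq_addr N K0); set x := c _.+1; set y := c (K0 + N)%N => xy.
  have : x / (1 - s) <= s * y / (1 - s) by rewrite ler_pM2r// invr_gt0; lra.
  have -> : s * y / (1 - s) = y / (1 - s) - y by field; lra.
  lra.
exists (S K0 + c K0 / (1 - s)) => N; rewrite -/(S N).
have c'0 k : 0 <= c k / (1 - s) by rewrite divr_ge0//; lra.
have [NK|KN] := leqP N K0.
  apply: (@le_trans _ _ (S K0)); last by rewrite lerDl.
  rewrite -(subnKC NK); elim: (K0 - N)%N => [|k IH]; first by rewrite addn0.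
  by rewrite addnS SS (le_trans IH)// lerDl.
rewrite -(subnKC (ltnW KN)); apply: le_trans (tail (N - K0)%N); by rewrite lerDl c'0.
Qed.

(** There are ['C(n, k) * 'C(m, k)] pairs [S], [T] of size [k]; this number turns
    the squared denominators into factors [(m - i) / (n - i)], each at most
    [alpha]. *)
Lemma level_bound_weight (R : realFieldType) (alpha t r : R) (n m k : nat) :
  0 <= t -> 0 <= r -> alpha <= 1 -> m%:R <= alpha * n%:R -> (m <= n)%N ->
  (k <= m)%N ->
  'C(n, k)%:R * 'C(m, k)%:R * level_bound t r n k <= level_weight alpha t r k.
Proof.
move=> t0 r0 a1 man mn; elim: k => [|k IH] km.
  by rewrite !bin0 /level_bound /level_weight !big_ord0 !mul1r.
rewrite /level_bound /level_weight !big_ord_recr /=.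
rewrite -/(level_bound t r n k) -/(level_weight alpha t r k).
have binS N : (k < N)%N -> 'C(N, k.+1)%:R = 'C(N, k)%:R * (N%:R - k%:R) / k.+1%:R :> R.
  move=> kN; apply: (mulIf (_ : k.+1%:R != 0)); first by rewrite pnatr_eq0.
  rewrite divfK ?pnatr_eq0// -natrB ?(ltnW kN)// -!natrM mulnC.
  by rewrite mul_bin_left mulnC.
rewrite !binS//; last exact: leq_trans mn.
have kn : (k < n)%N by exact: leq_trans mn.
have nk : 0 < n%:R - k%:R :> R by rewrite subr_gt0 ltr_nat.
have mk : 0 < m%:R - k%:R :> R by rewrite subr_gt0 ltr_nat.
rewrite (natrB _ (ltnW kn)).
set L := level_bound t r n k in IH *.
set X := 'C(n, k)%:R in IH *; set Y := 'C(m, k)%:R in IH *.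
have k1 : k.+1%:R != 0 :> R by rewrite pnatr_eq0.
rewrite [leLHS](_ : _ = (X * Y * L) *
  ((m%:R - k%:R) / (n%:R - k%:R) * ((t + k%:R * r) / k.+1%:R))); last first.
  by field; rewrite (gt_eqF nk) nat1r k1.
have tk0 : 0 <= (t + k%:R * r) / k.+1%:R by rewrite divr_ge0 ?addr_ge0 ?mulr_ge0.
apply: ler_pM; last 1 first.
- rewrite -(mulrA alpha) ler_wpM2r// ler_pdivrMr//.
  suff : k%:R * alpha <= k%:R by lra.
  by rewrite ler_piMr.
- rewrite !mulr_ge0//; apply: prodr_ge0 => i _.
  by rewrite mulr_ge0 ?mulr_ge0 ?addr_ge0 ?mulr_ge0 ?invr_ge0 ?sqr_ge0.
- by rewrite mulr_ge0// divr_ge0// ltW.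
- by apply: IH; exact: ltnW.
Qed.

Section second_moment.
Context (R : realFieldType) (I J K L : finType) (P : I -> J -> R).
Hypothesis P0 : forall a b, 0 <= P a b.
Hypothesis P1 : \sum_a \sum_b P a b = 1.
Context (t r alpha C : R).
Hypothesis chi2_le : finite_chi2 P <= t.
Hypothesis corr_le : correlation_bound P r.
Hypotheses (t0 : 0 <= t) (r0 : 0 <= r) (alpha_le1 : alpha <= 1).
Hypothesis LK : (#|L| <= #|K|)%N.
Hypothesis LaK : #|L|%:R <= alpha * #|K|%:R.
Hypothesis C_bound : forall N, \sum_(k < N) level_weight alpha t r k <= C.
Local Notation p := (row_law P).
Local Notation q := (col_law P).
Local Notation M := (centred_density P).
Implicit Types (x : {ffun K -> I}) (y : {ffun L -> J}).

Let N : R := #|[set pi : {ffun L -> K} | injectiveb pi]|%:R.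

Definition mixture_ratio x y : R :=
  N^-1 * \sum_(pi : {ffun L -> K} | injectiveb pi) \prod_i (1 + M (x (pi i)) (y i)).

Let N_gt0 : 0 < N.
Proof. by rewrite ltr0n card_inj_ffuns ffact_gt0. Qed.

(** By orthogonality only the pairs [S], [T] of equal size contribute, and those
    of size [k] are counted by two binomial coefficients. *)
Lemma mixture_ratio_sqr_le :
  expect2 p q (fun x y => mixture_ratio x y ^+ 2) <= C.
Proof.
under eq_expect2 do rewrite exprMn.
rewrite expect2Z likelihood_ratio_sqr; first last.
- exact: centred_density_col.
- exact: centred_density_row.
- exact: col_law_sum.
- exact: row_law_sum.
apply: (@le_trans _ _ (\sum_(T : {set L}) \sum_(S : {set K} | #|S| == #|T|)
    level_bound t r #|K| #|T|)).
  rewrite exchange_big mulr_sumr; apply: ler_sum => T _.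
  rewrite mulr_sumr [leRHS]big_mkcond; apply: ler_sum => S _; case: eqP => ST.
    rewrite exprVn ler_pdivrMl ?exprn_gt0//.
    apply: perm_sum_sqr_le; first [done | exact: row_law_sum
      | exact: col_law_sum | exact: row_law_ge0 | exact: col_law_ge0
      | exact: centred_density_row | exact: centred_density_col
      | exact: centred_density_norm].
  rewrite [X in _ * X](_ : _ = 0) ?mulr0//.
  rewrite -[RHS](expect2_cst K L (row_law_sum P1) (col_law_sum P1) 0).
  apply: eq_expect2 => x y; rewrite /perm_sum big1 ?expr0n// => pi.
  rewrite in_placements => /andP[/injectiveP inj /eqP piT].
  by case: ST; rewrite -piT card_imset.
apply: le_trans (C_bound #|L|.+1).
rewrite (partition_big (fun T : {set L} => inord #|T| : 'I_#|L|.+1) xpredT)//=.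
apply: ler_sum => k _.
apply: le_trans (level_bound_weight t0 r0 alpha_le1 LaK LK (_ : (k <= _)%N)); last first.
  by rewrite -ltnS.
rewrite (eq_bigl (fun T : {set L} => #|T| == k)) => [|T]; last first.
  have TL : (#|T| < #|L|.+1)%N by rewrite ltnS max_card.
  by apply/eqP/eqP => [<-|Tk]; [rewrite inordK|apply: val_inj; rewrite /= inordK].
under eq_bigr => T /eqP -> do rewrite sumr_const.
have cnt (A : finType) : #|(fun S : {set A} => #|S| == k)| = 'C(#|A|, k).
  by rewrite -card_draws; apply: eq_card => T; rewrite inE.
rewrite sumr_const !cnt -mulrnA -[leLHS]mulr_natl natrM.
by rewrite lexx.
Qed.

Lemma alt_weightE x y : alt_weight P x y = null_weight P x y * mixture_ratio x y.
Proof.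
rewrite /alt_weight /mixture_ratio [RHS]mulrCA; congr (_ * _).
rewrite mulr_sumr.
by apply: eq_bigr => pi /injectiveP inj; rewrite planted_weightE.
Qed.

(** The alternative mass of an event is the null expectation of the likelihood
    ratio over it: apply the Cauchy-Schwarz inequality. *)
Lemma alt_weight_sqr_le (Q : pred ({ffun K -> I} * {ffun L -> J})) :
  (\sum_(z | Q z) alt_weight P z.1 z.2) ^+ 2 <=
  C * \sum_(z | Q z) null_weight P z.1 z.2.
Proof.
rewrite (eq_bigr (fun z => null_weight P z.1 z.2 * (mixture_ratio z.1 z.2 * 1))); last first.
  by move=> z _; rewrite mulr1 alt_weightE.
apply: le_trans (weighted_cauchy_schwarz _ _ _ _) _.
  by move=> z; exact: null_weight_ge0.
under [X in _ * X]eq_bigr do rewrite expr1n mulr1.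
rewrite ler_wpM2r//; first by apply: sumr_ge0 => z _; exact: null_weight_ge0.
apply: le_trans mixture_ratio_sqr_le.
rewrite /expect2 /expect; under [leRHS]eq_bigr do rewrite mulr_sumr.
rewrite pair_bigA /= big_mkcond; apply: ler_sum => z _.
rewrite mulrA -/(null_weight P z.1 z.2); case: ifP => // _.
by rewrite mulr_ge0 ?sqr_ge0// null_weight_ge0.
Qed.

End second_moment.

(** * The centred kernel statistic *)

Section planted_pairs.
Context (R : realFieldType) (I J K L : finType) (P : I -> J -> R).

Definition pair_law (k : I * J) : R := P k.1 k.2.

Definition project_pairs (pi : {ffun L -> K}) (z : {ffun K -> I * J}) :
    {ffun K -> I} * {ffun L -> J} :=
  ([ffun j => (z j).1], [ffun i => (z (pi i)).2]).

(** The planted law is the law of the observed coordinates of independent pairs,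
    one for each index of the first sample: a spare point is a pair whose second
    coordinate is not observed. *)
Lemma planted_expectation (pi : {ffun L -> K})
    (F : {ffun K -> I} * {ffun L -> J} -> R) : injective pi ->
  \sum_xy planted_weight P pi xy.1 xy.2 * F xy =
  expect pair_law (fun z => F (project_pairs pi z)).
Proof.
move=> inj; rewrite /expect (partition_big (project_pairs pi) xpredT)//=.
apply: eq_bigr => -[x y] _ /=.
rewrite (eq_bigr (fun z : {ffun K -> I * J} =>
  (\prod_k pair_law (z k)) * F (x, y))) => [|z /eqP ->//].
rewrite -mulr_suml; congr (_ * _).
pose ok k (ab : I * J) := (ab.1 == x k) && [forall i, (pi i == k) ==> (ab.2 == y i)].
rewrite big_mkcond /=.
transitivity (\sum_(z : {ffun K -> I * J}) \prod_k (pair_law (z k) * (ok k (z k))%:R)).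
  rewrite -(bigA_distr_bigA (fun k ab => pair_law ab * (ok k ab)%:R)).
  rewrite [RHS](prod_codom _ inj) /planted_weight; congr (_ * _).
    apply: eq_bigr => i _; rewrite (bigD1 (x (pi i), y i))//= big1 ?addr0 => [|[a b] ab].
      rewrite /pair_law /ok /= eqxx /= (_ : [forall _, _]) ?mulr1//.
      by apply/forallP => i'; apply/implyP => /eqP/inj ->.
    rewrite (_ : ok _ _ = false) ?mulr0//; apply: contra_neqF ab.
    by move=> /andP[/eqP/= -> /forallP/(_ i)]; rewrite eqxx => /eqP ->.
  apply: eq_bigr => k kpi.
  rewrite -(pair_bigA _ (fun a b => pair_law (a, b) * (ok k (a, b))%:R)) /=.
  rewrite (bigD1 (x k))//= [X in _ + X]big1 ?addr0 => [|a ax]; last first.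
    by apply: big1 => b _; rewrite /ok /= (negbTE ax) mulr0.
  apply: eq_bigr => b _; rewrite /pair_law /ok /= eqxx (_ : [forall _, _]) ?mulr1//.
  apply/forallP => i; apply/implyP => /eqP ik.
  by move: kpi; rewrite -ik codom_f.
apply: eq_bigr => z _; rewrite big_split /=.
case: ifPn => [/eqP zE|zE].
  rewrite [X in _ * X]big1 ?mulr1// => k _.
  rewrite /ok; case: zE => <- <-; rewrite ffunE eqxx (_ : [forall _, _])//.
  by apply/forallP => i; apply/implyP => /eqP <-; rewrite ffunE.
suff [k zk] : exists k, ~~ ok k (z k) by rewrite [X in _ * X](bigD1 k)//= (negbTE zk) mul0r mulr0.
apply/existsP; rewrite -negb_forall; apply: contra zE => /forallP zok.
apply/eqP; congr (_, _); apply/ffunP => k; rewrite ffunE.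
  by have /andP[/eqP] := zok k.
by have /andP[_ /forallP/(_ k)] := zok (pi k); rewrite eqxx => /eqP.
Qed.

Lemma chebyshev_sum (A : finType) (w f : A -> R) (Q : pred A) (th v : R) :
  (forall a, 0 <= w a) -> 0 < th -> \sum_a w a * f a ^+ 2 <= v ->
  (forall a, Q a -> th ^+ 2 <= f a ^+ 2) ->
  \sum_(a | Q a) w a <= v / th ^+ 2.
Proof.
move=> w0 th0 wf Qf; rewrite ler_pdivlMr ?exprn_gt0// (le_trans _ wf)//.
rewrite mulr_suml big_mkcond; apply: ler_sum => a _; case: ifP => [Qa|_].
  by rewrite ler_wpM2l ?Qf.
by rewrite mulr_ge0 ?sqr_ge0.
Qed.

End planted_pairs.

Section kernel_statistic.
Context (R : realFieldType) (I J K L : finType) (P : I -> J -> R).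
Hypothesis P0 : forall a b, 0 <= P a b.
Hypothesis P1 : \sum_a \sum_b P a b = 1.
Local Notation p := (row_law P).
Local Notation q := (col_law P).
Local Notation M := (centred_density P).
Local Notation t := (finite_chi2 P).

Let p0 := row_law_ge0 P0.
Let q0 := col_law_ge0 P0.
Let p1 := row_law_sum P1.
Let q1 := col_law_sum P1.

Definition kernel_statistic (xy : {ffun K -> I} * {ffun L -> J}) : R :=
  \sum_i \sum_j M (xy.1 j) (xy.2 i).

Lemma null_weight_sum (F : {ffun K -> I} * {ffun L -> J} -> R) :
  \sum_xy null_weight P xy.1 xy.2 * F xy = expect2 p q (fun x y => F (x, y)).
Proof.
rewrite /expect2 /expect; under [RHS]eq_bigr do rewrite mulr_sumr.
by rewrite pair_bigA; apply: eq_bigr => -[x y] _; rewrite mulrA.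
Qed.

(** Two distinct entries are orthogonal, because an index which occurs in only one
    of them can be integrated out. *)
Lemma kernel_statistic_null :
  \sum_xy null_weight P xy.1 xy.2 * kernel_statistic xy ^+ 2 =
  #|K|%:R * #|L|%:R * t.
Proof.
rewrite null_weight_sum.
pose A (k : L * K) (x : {ffun K -> I}) (y : {ffun L -> J}) := M (x k.2) (y k.1).
transitivity (\sum_k \sum_k' expect2 p q (fun x y => A k x y * A k' x y)).
  under eq_bigr do rewrite -expect2_sum.
  rewrite -expect2_sum; apply: eq_expect2 => x y.
  rewrite /kernel_statistic pair_bigA /= expr2 mulr_suml; apply: eq_bigr => k _.
  by rewrite mulr_sumr.
transitivity (\sum_(k : L * K) t).
  apply: eq_bigr => -[i j] _; rewrite (bigD1 (i, j))//= [X in _ + X]big1 ?addr0.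
    rewrite (expect2_resample_l q p1 j) (expect2_resample_r p q1 i).
    rewrite -[RHS](expect2_cst K L p1 q1); apply: eq_expect2 => x y.
    rewrite /finite_chi2 [RHS]exchange_big /=; apply: eq_bigr => b _.
    rewrite mulr_sumr; apply: eq_bigr => a _.
    by rewrite /A /= !upd_same; ring.
  move=> [i' j'] ne; rewrite xpair_eqE negb_and in ne.
  rewrite -[RHS](expect2_cst K L p1 q1 0); case/orP: ne => ne.
    rewrite (expect2_resample_r p q1 i); apply: eq_expect2 => x y.
    transitivity ((\sum_b q b * M (x j) b) * A (i', j') x y).
      rewrite mulr_suml; apply: eq_bigr => b _.
      by rewrite /A /= upd_same upd_other// mulrA.
    by rewrite centred_density_col// mul0r.
  rewrite (expect2_resample_l q p1 j); apply: eq_expect2 => x y.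
  transitivity ((\sum_a p a * M a (y i)) * A (i', j') x y).
    rewrite mulr_suml; apply: eq_bigr => a _.
    by rewrite /A /= upd_same upd_other// mulrA.
  by rewrite centred_density_row// mul0r.
by rewrite sumr_const card_prod -[LHS]mulr_natl natrM [X in X * _]mulrC.
Qed.

Local Notation PP := (pair_law P).

Lemma pair_law_sum (f : I -> J -> R) :
  \sum_k PP k * f k.1 k.2 = \sum_a \sum_b P a b * f a b.
Proof. by rewrite pair_bigA. Qed.

Let PP1 : \sum_k PP k = 1.
Proof. by rewrite -[LHS](pair_bigA _ P). Qed.

Let PP0 k : 0 <= PP k. Proof. exact: P0. Qed.

Lemma pair_law_row (f : I -> R) : \sum_k PP k * f k.1 = \sum_a p a * f a.
Proof.
rewrite (pair_law_sum (fun a _ => f a)); apply: eq_bigr => a _.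
by rewrite -mulr_suml.
Qed.

Lemma pair_law_col (f : J -> R) : \sum_k PP k * f k.2 = \sum_b q b * f b.
Proof.
rewrite (pair_law_sum (fun _ b => f b)) exchange_big; apply: eq_bigr => b _.
by rewrite -mulr_suml.
Qed.

Let cross (l j : K) (z : {ffun K -> I * J}) := M (z j).1 (z l).2.

Lemma cross_upd l j k z ab : k != l -> k != j -> cross l j (upd z k ab) = cross l j z.
Proof. by move=> kl kj; rewrite /cross !upd_other// eq_sym. Qed.

Lemma cross_sqr l j : l != j -> expect PP (fun z => cross l j z ^+ 2) = t.
Proof.
move=> lj; rewrite (expect_resample PP1 j) (expect_resample PP1 l).
rewrite -[RHS](expect_cst K PP1); apply: eq_expect => z.
transitivity (\sum_k PP k * \sum_k' PP k' * M k'.1 k.2 ^+ 2).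
  apply: eq_bigr => k _; congr (_ * _); apply: eq_bigr => k' _.
  by rewrite /cross upd_same upd_other// upd_same.
rewrite (pair_law_col (fun b => \sum_k' PP k' * M k'.1 b ^+ 2)).
rewrite /finite_chi2 exchange_big; apply: eq_bigr => b _ /=.
rewrite (pair_law_row (fun a => M a b ^+ 2)) mulr_sumr.
by apply: eq_bigr => a _; ring.
Qed.

(** If one of the pairs [l], [j] occurs only once, it can be integrated out;
    otherwise the two unordered couples agree, and [2 * a * b <= a ^+ 2 + b ^+ 2]
    applies. *)
Lemma cross_orthogonal l j l' j' : l != j -> l' != j' ->
  expect PP (fun z => cross l j z * cross l' j' z) <=
  t * (((l == l') && (j == j'))%:R + ((l == j') && (j == l'))%:R).
Proof.
move=> lj lj'; have t0 : 0 <= t by exact: finite_chi2_ge0.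
have rhs0 : 0 <= t * (((l == l') && (j == j'))%:R + ((l == j') && (j == l'))%:R).
  by rewrite mulr_ge0// addr_ge0.
have lonely k : k \in [:: l; j] -> k != l' -> k != j' ->
    expect PP (fun z => cross l j z * cross l' j' z) = 0.
  move=> klj kl' kj'; rewrite (expect_resample PP1 k) -[RHS](expect_cst K PP1 0).
  apply: eq_expect => z.
  transitivity ((\sum_ab PP ab * cross l j (upd z k ab)) * cross l' j' z).
    by rewrite mulr_suml; apply: eq_bigr => ab _; rewrite (cross_upd (l := l'))// mulrA.
  rewrite [X in X * _](_ : _ = 0) ?mul0r//.
  move: klj; rewrite !inE => /orP[]/eqP ->.
    transitivity (\sum_ab PP ab * M (z j).1 ab.2).
      by apply: eq_bigr => ab _; rewrite /cross upd_same upd_other// eq_sym.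
    by rewrite (pair_law_col (fun b => M (z j).1 b)) centred_density_col.
  transitivity (\sum_ab PP ab * M ab.1 (z l).2).
    by apply: eq_bigr => ab _; rewrite /cross upd_same upd_other.
  by rewrite (pair_law_row (fun a => M a (z l).2)) centred_density_row.
have [/andP[l1 l2]|l12] := boolP ((l != l') && (l != j')).
  by rewrite (lonely l) ?mem_head.
have [/andP[j1 j2]|j12] := boolP ((j != l') && (j != j')).
  by rewrite (lonely j)// !inE eqxx orbT.
apply: (@le_trans _ _ t); last first.
  rewrite -[leLHS]mulr1 ler_wpM2l//.
  rewrite !negb_and !negbK in l12 j12.
  have : ((l == l') && (j == j')) || ((l == j') && (j == l')).
    case/orP: l12 => /eqP E; case/orP: j12 => /eqP E'; rewrite ?E ?E' ?eqxx ?orbT//;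
      by move: lj; rewrite E E' eqxx.
  by case/orP => ->; rewrite ?lerDl ?lerDr.
apply: (@le_trans _ _ (expect PP (fun z => 2^-1 * cross l j z ^+ 2 + 2^-1 * cross l' j' z ^+ 2))).
  apply: expect_le => // z; have := sqr_ge0 (cross l j z - cross l' j' z); nra.
by rewrite expectD !expectZ !cross_sqr//; lra.
Qed.

(** The matched entries are independent with mean [t]. The other entries have the
    null variance and are nearly orthogonal: each is correlated with at most two
    of them, itself and its transpose. *)
Lemma kernel_statistic_planted (pi : {ffun L -> K}) : injective pi ->
  \sum_xy planted_weight P pi xy.1 xy.2 * (kernel_statistic xy - #|L|%:R * t) ^+ 2 <=
  2 * (#|L|%:R * \sum_a \sum_b P a b * M a b ^+ 2) + 4 * (#|K|%:R * #|L|%:R * t).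
Proof.
move=> inj; rewrite (planted_expectation P
  (fun xy => (kernel_statistic xy - #|L|%:R * t) ^+ 2) inj).
pose T1 (z : {ffun K -> I * J}) := \sum_(i : L) (cross (pi i) (pi i) z - t).
pose T2 (z : {ffun K -> I * J}) := \sum_(i : L) \sum_(j | j != pi i) cross (pi i) j z.
have TE z : kernel_statistic (project_pairs pi z) - #|L|%:R * t = T1 z + T2 z.
  rewrite /T1 sumrB sumr_const -[t *+ _]mulr_natl addrAC; congr (_ - _).
  rewrite /T2 -big_split; apply: eq_bigr => i _ /=.
  rewrite (bigD1 (pi i))//=; congr (_ + _); first by rewrite /cross !ffunE.
  by apply: eq_bigr => j _; rewrite /cross !ffunE.
apply: (@le_trans _ _ (expect PP (fun z => 2 * T1 z ^+ 2 + 2 * T2 z ^+ 2))).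
  by apply: expect_le => // z; rewrite TE; have := sqr_ge0 (T1 z - T2 z); nra.
rewrite expectD !expectZ; apply: lerD.
  rewrite ler_pM2l//.
  have mean : \sum_k PP k * (M k.1 k.2 - t) = 0.
    under eq_bigr do rewrite mulrBr.
    rewrite sumrB -mulr_suml PP1 mul1r (pair_law_sum M) /finite_chi2 -sumrB.
    apply: big1 => a _; rewrite -sumrB.
    transitivity (p a * \sum_b q b * M a b); last by rewrite centred_density_col// mulr0.
    by rewrite mulr_sumr; apply: eq_bigr => b _; rewrite -{1}(density_mul P0); ring.
  have -> : expect PP (fun z => T1 z ^+ 2) =
      \sum_i \sum_i' expect PP (fun z =>
        (cross (pi i) (pi i) z - t) * (cross (pi i') (pi i') z - t)).
    under eq_bigr do rewrite -expect_sum.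
    rewrite -expect_sum; apply: eq_expect => z.
    by rewrite expr2 mulr_suml; apply: eq_bigr => i _; rewrite mulr_sumr.
  rewrite mulr_natl -[leRHS]/(_ *+ #|mem L|) -sumr_const; apply: ler_sum => i _.
  rewrite (bigD1 i)//= [X in _ + X]big1 ?addr0 => [|i' i'i]; last first.
    have pii : pi i' != pi i by apply: contraNneq i'i => /inj ->.
    rewrite (expect_resample PP1 (pi i)) -[RHS](expect_cst K PP1 0).
    apply: eq_expect => z.
    transitivity ((\sum_ab PP ab * (M ab.1 ab.2 - t)) * (cross (pi i') (pi i') z - t)).
      rewrite mulr_suml; apply: eq_bigr => ab _.
      by rewrite (cross_upd (l := pi i')) 1?eq_sym// /cross upd_same mulrA.
    by rewrite mean mul0r.
  rewrite (expect_resample PP1 (pi i)).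
  rewrite -[leRHS](expect_cst K PP1); apply: expect_le => // z.
  rewrite [leLHS](_ : _ = \sum_ab PP ab * (M ab.1 ab.2 - t) ^+ 2); last first.
    by apply: eq_bigr => ab _; rewrite /cross !upd_same expr2.
  rewrite -(pair_law_sum (fun a b => M a b ^+ 2)) -subr_ge0 -sumrB.
  rewrite (eq_bigr (fun k => 2 * t * (PP k * (M k.1 k.2 - t)) +
    t ^+ 2 * PP k)) => [|k _]; last by ring.
  by rewrite big_split -!mulr_sumr /= mean PP1 mulr0 add0r mulr1 sqr_ge0.
have -> : expect PP (fun z => T2 z ^+ 2) =
    \sum_i \sum_(j | j != pi i) \sum_i' \sum_(j' | j' != pi i')
      expect PP (fun z => cross (pi i) j z * cross (pi i') j' z).
  under eq_bigr do under eq_bigr do under eq_bigr do rewrite -expect_sum.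
  under eq_bigr do under eq_bigr do rewrite -expect_sum.
  under eq_bigr do rewrite -expect_sum.
  rewrite -expect_sum; apply: eq_expect => z.
  rewrite expr2 mulr_suml; apply: eq_bigr => i _.
  rewrite mulr_suml; apply: eq_bigr => j _.
  rewrite mulr_sumr; apply: eq_bigr => i' _.
  by rewrite mulr_sumr.
have t0 : 0 <= t by exact: finite_chi2_ge0.
have bnd i j : j != pi i -> \sum_i' \sum_(j' | j' != pi i')
    expect PP (fun z => cross (pi i) j z * cross (pi i') j' z) <= 2 * t.
  move=> ji.
  apply: (@le_trans _ _ (\sum_i' \sum_j' (t *
      (((pi i == pi i') && (j == j'))%:R + ((pi i == j') && (j == pi i'))%:R)))).
    apply: ler_sum => i' _; rewrite big_mkcond; apply: ler_sum => j' _.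
    case: ifPn => [j'i'|_]; last by rewrite mulr_ge0// addr_ge0.
    by apply: cross_orthogonal; rewrite eq_sym.
  rewrite (eq_bigr (fun i' => t * ((pi i == pi i')%:R + (j == pi i')%:R))) => [|i' _]; last first.
    rewrite -mulr_sumr big_split /=; congr (_ * (_ + _)).
      rewrite (bigD1 j)//= eqxx andbT big1 ?addr0// => j' j'j.
      by rewrite eq_sym in j'j; rewrite (negbTE j'j) andbF.
    rewrite (bigD1 (pi i))//= eqxx /= big1 ?addr0// => j' j'j.
    by rewrite eq_sym in j'j; rewrite (negbTE j'j).
  rewrite -mulr_sumr mulrC ler_wpM2r// big_split /=.
  have one k : \sum_(i' : L) (k == pi i')%:R <= 1 :> R.
    have [i0 /eqP ki0|no] := pickP (fun i' => k == pi i'); last first.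
      by rewrite big1// => i' _; rewrite no.
    rewrite (bigD1 i0)//= big1 ?addr0 => [|i' i'i0]; first by case: eqP.
    by rewrite ki0 (inj_eq inj) eq_sym (negbTE i'i0).
  by have := one (pi i); have := one j; lra.
apply: (@le_trans _ _ (2 * \sum_(i : L) \sum_(j : K) 2 * t)).
  rewrite ler_pM2l//; apply: ler_sum => i _; rewrite big_mkcond; apply: ler_sum => j _.
  by case: ifPn => ji; [exact: bnd|rewrite mulr_ge0].
rewrite !sumr_const -mulrnA -[X in 2 * X]mulr_natl natrM.
by rewrite le_eqVlt; apply/orP; left; apply/eqP; ring.
Qed.

End kernel_statistic.

(** * Anticoncentration of sums and the difference statistic *)

Section cosine_bounds.
Context (R : realType).

Lemma cos_ge_cos1 (x : R) : `|x| <= 1 -> cos 1 <= cos x.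
Proof.
move=> x1; rewrite -(cos_norm x); have := pi_ge2 R => pi2.
have [->//|x1'] := eqVneq `|x| 1.
apply/ltW; rewrite ltr_cos ?lt_neqAle ?x1' // in_itv /= ?normr_ge0 ?ler01 //=; lra.
Qed.

(** By the mean value theorem, [cos 1] being a positive lower bound of the cosine
    on [[-1, 1]]. *)
Lemma sin_sqr_ge (x : R) : `|x| <= 1 -> (cos 1 * x) ^+ 2 <= sin x ^+ 2.
Proof.
wlog x0 : x / 0 < x => [H|].
  move=> x1; case: (ltgtP x 0) => x0; last by rewrite x0 mulr0 sin0.
    by have := H (- x); rewrite oppr_gt0 normrN sinN mulrN !sqrrN; apply.
  exact: H.
rewrite gtr0_norm// => x1.
have [y yx sE] : exists2 y, y \in `]0, x[%R & sin x - sin 0 = cos y * (x - 0).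
  apply: (@MVT _ sin cos) => //.
  by apply: continuous_subspaceT => y; exact: continuous_sin.
rewrite sin0 !subr0 in sE; rewrite sE.
move: yx; rewrite in_itv /= => /andP[y0 yx].
have c1 : cos 1 <= cos y by apply: cos_ge_cos1; rewrite gtr0_norm//; lra.
have c0 := cos1_gt0 R.
by rewrite ler_sqr ?nnegrE ?mulr_ge0 ?ler_wpM2r//; lra.
Qed.

(** The double angle formula reduces this to a lower bound of the sine. *)
Lemma cos_le_quadratic (x : R) : `|x| <= 1 -> cos x <= 1 - cos 1 ^+ 2 / 2 * x ^+ 2.
Proof.
move=> x1; have h : `|x / 2| <= 1 by rewrite normrM (ger0_norm (_ : 0 <= 2^-1))//; lra.
have := sin_sqr_ge h; rewrite sin2cos2.
have -> : cos x = cos (x / 2 *+ 2) by congr cos; rewrite -[RHS]mulr_natr divfK.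
by rewrite cos_mulr2n exprMn expr_div_n; lra.
Qed.

End cosine_bounds.

Section characteristic_function.
Context (R : realType).

Definition cis (x : R) : R[i] := Complex (cos x) (sin x).
Definition normsq (z : R[i]) : R := complex.Re z ^+ 2 + complex.Im z ^+ 2.

Lemma cisD x y : cis (x + y) = cis x * cis y.
Proof.
rewrite /cis cosD sinD; apply/eqP; rewrite eq_complex /=.
by rewrite eqxx /=; apply/eqP; ring.
Qed.

Lemma cis0 : cis 0 = 1. Proof. by rewrite /cis cos0 sin0. Qed.

Lemma cis_sum (A : finType) (f : A -> R) : cis (\sum_a f a) = \prod_a cis (f a).
Proof. exact: (big_morph cis cisD cis0). Qed.

Lemma normsqM z w : normsq (z * w) = normsq z * normsq w.
Proof. by case: z w => [a b] [c d]; rewrite /normsq /=; ring. Qed.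

Lemma normsqX z n : normsq (z ^+ n) = normsq z ^+ n.
Proof.
elim: n => [|n IH]; first by rewrite !expr0 /normsq /= expr1n expr0n addr0.
by rewrite !exprS normsqM IH.
Qed.

Lemma normsq_cis x : normsq (cis x) = 1. Proof. exact: cos2Dsin2. Qed.

Lemma Re_sum (A : finType) (f : A -> R[i]) :
  complex.Re (\sum_a f a) = \sum_a complex.Re (f a).
Proof. by apply: (big_morph (@complex.Re R)) => // -[a b] [c d]. Qed.

Lemma Im_sum (A : finType) (f : A -> R[i]) :
  complex.Im (\sum_a f a) = \sum_a complex.Im (f a).
Proof. by apply: (big_morph (@complex.Im R)) => // -[a b] [c d]. Qed.

Context (I : finType) (p u : I -> R).
Hypotheses (p0 : forall a, 0 <= p a) (p1 : \sum_a p a = 1).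

Definition char_fun (s : R) : R[i] := \sum_a (p a)%:C%C * cis (s * u a).

Definition weighted_variance : R := \sum_a p a * u a ^+ 2 - (\sum_a p a * u a) ^+ 2.

Lemma variance_pairs :
  \sum_a \sum_b p a * p b * (u a - u b) ^+ 2 = 2 * weighted_variance.
Proof.
transitivity (\sum_a (p a * u a ^+ 2 * (\sum_b p b) + p a * (\sum_b p b * u b ^+ 2) -
    2 * (p a * u a) * (\sum_b p b * u b))).
  apply: eq_bigr => a _; rewrite !mulr_sumr -big_split -sumrB.
  by apply: eq_bigr => b _ /=; ring.
rewrite p1 sumrB big_split /= -!mulr_suml -mulr_sumr p1 /weighted_variance; ring.
Qed.

(** The mean is the real part of a product of characteristic functions and a
    phase. *)
Lemma expect_cos_sqr_le (K : finType) (s th : R) :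
  expect p (fun x : {ffun K -> I} => cos (s * \sum_k u (x k) + th)) ^+ 2 <=
  normsq (char_fun s) ^+ #|K|.
Proof.
have -> : expect p (fun x : {ffun K -> I} => cos (s * \sum_k u (x k) + th)) =
    complex.Re (char_fun s ^+ #|K| * cis th).
  rewrite /char_fun -prodr_const (bigA_distr_bigA (fun _ a => _)) mulr_suml Re_sum.
  apply: eq_bigr => x _; rewrite big_split /= -cis_sum -mulr_sumr -mulrA -cisD.
  have -> : \prod_k (p (x k))%:C%C = ((\prod_k p (x k))%:C)%C.
    by rewrite (big_morph (fun x => x%:C%C) (@rmorphM _ _ (real_complex R)) (rmorph1 _)).
  by rewrite /cis /=; ring.
rewrite -[leRHS]mulr1 -(normsq_cis th) -normsqX -normsqM /normsq lerDl.
exact: sqr_ge0.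
Qed.

(** The squared modulus is the characteristic function of the difference of two
    independent copies. *)
Lemma normsq_char_fun s : normsq (char_fun s) =
  \sum_a \sum_b p a * p b * cos (s * u a - s * u b).
Proof.
rewrite /normsq /char_fun Re_sum Im_sum !expr2 !mulr_suml -big_split.
apply: eq_bigr => a _ /=; rewrite !mulr_sumr -big_split; apply: eq_bigr => b _ /=.
by rewrite cosB; ring.
Qed.

Lemma normsq_char_fun_le s (B : R) : (forall a b, `|u a - u b| <= B) -> `|s| * B <= 1 ->
  normsq (char_fun s) <= 1 - cos 1 ^+ 2 * s ^+ 2 * weighted_variance.
Proof.
move=> uB sB; rewrite normsq_char_fun.
apply: (@le_trans _ _ (\sum_a \sum_b (p a * p b -
    cos 1 ^+ 2 / 2 * s ^+ 2 * (p a * p b * (u a - u b) ^+ 2)))).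
  apply: ler_sum => a _; apply: ler_sum => b _; rewrite -mulrBr.
  have h : `|s * (u a - u b)| <= 1.
    by rewrite normrM (le_trans _ sB)// ler_wpM2l.
  apply: (@le_trans _ _ (p a * p b * (1 - cos 1 ^+ 2 / 2 * (s * (u a - u b)) ^+ 2))).
    by rewrite ler_wpM2l ?mulr_ge0//; exact: cos_le_quadratic.
  by rewrite le_eqVlt; apply/orP; left; apply/eqP; ring.
under eq_bigr do rewrite sumrB -mulr_sumr p1 mulr1 -mulr_sumr.
rewrite sumrB p1 -mulr_sumr variance_pairs le_eqVlt; apply/orP; left; apply/eqP.
by field.
Qed.

End characteristic_function.

Lemma exp_le_inv (R : realFieldType) (x : R) n : 0 <= x -> x <= 1 ->
  (1 - x) ^+ n * (1 + n%:R * x) <= 1.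
Proof.
move=> x0 x1; elim: n => [|n IH]; first by rewrite expr0; lra.
apply: le_trans IH; rewrite exprSr -mulrA ler_wpM2l ?exprn_ge0 ?subr_ge0//.
rewrite -natr1; have : 0 <= n%:R * x ^+ 2 by rewrite mulr_ge0 ?sqr_ge0.
have := sqr_ge0 x; nra.
Qed.

Section anticoncentration.
Context (R : realType) (I K : finType) (p u : I -> R).
Hypotheses (p0 : forall a, 0 <= p a) (p1 : \sum_a p a = 1).
Local Notation c1 := (cos (1 : R)).

(** The squared modulus of each characteristic function is at most [1 - X], with
    [X] a multiple of the variance, and [(1 - X) ^+ n <= 1 / (1 + n * X)]; the last
    hypothesis and the lower bound on the variance give [1 <= n * X * b ^+ 2]. *)
Lemma expect_cos_le (B b s th : R) :
  4^-1 <= weighted_variance p u -> (forall a a', `|u a - u a'| <= B) -> `|s| * B <= 1 ->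
  0 < b -> 4 <= c1 ^+ 2 * s ^+ 2 * #|K|%:R * b ^+ 2 ->
  expect p (fun x : {ffun K -> I} => cos (s * \sum_k u (x k) + th)) <= b.
Proof.
move=> V uB sB b0 sb.
have := expect_cos_sqr_le p u K s th.
have := normsq_char_fun_le p0 p1 uB sB.
set z := normsq _; set X := c1 ^+ 2 * s ^+ 2 * weighted_variance p u => zX EX.
have z0 : 0 <= z by rewrite addr_ge0// sqr_ge0.
have V0 : 0 <= weighted_variance p u by lra.
have X0 : 0 <= X := mulr_ge0 (mulr_ge0 (sqr_ge0 c1) (sqr_ge0 s)) V0.
have X1 : X <= 1 by lra.
have : (1 - X) ^+ #|K| <= b ^+ 2.
  rewrite -[leLHS]mulr1; have := exp_le_inv #|K| X0 X1.
  have : 1 <= (#|K|%:R * X) * b ^+ 2.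
    have : 0 <= c1 ^+ 2 * s ^+ 2 * #|K|%:R * b ^+ 2 by lra.
    rewrite /X; nra.
  have : 0 <= (1 - X) ^+ #|K| by rewrite exprn_ge0//; lra.
  have : 0 <= b ^+ 2 by exact: sqr_ge0.
  set Y := (1 - X) ^+ _; set n := #|K|%:R; set b2 := b ^+ 2 => h1 h2 h3 h4.
  have : Y * 1 <= Y * (n * X * b2) by rewrite ler_wpM2l.
  have : b2 * (Y * (1 + n * X)) <= b2 * 1 by rewrite ler_wpM2l.
  nra.
move=> Xb; have Eb : expect p (fun x : {ffun K -> I} =>
    cos (s * \sum_k u (x k) + th)) ^+ 2 <= b ^+ 2.
  apply: le_trans EX _; apply: le_trans Xb.
  by rewrite lerXn2r ?nnegrE//; lra.
apply: le_trans (ler_norm _) _.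
by rewrite -ler_sqr ?nnegrE ?normr_ge0 ?(ltW b0)// real_normK ?num_real.
Qed.

(** Fejer's kernel [F] is nonnegative, at least [N ^+ 2 * cos 1] near the origin,
    and a sum of [N ^+ 2] cosines, [N] of which are constant while the others have
    a mean controlled by the characteristic function. *)
Lemma sum_anticoncentration (N : nat) (B b th c : R) :
  4^-1 <= weighted_variance p u -> (forall a a', `|u a - u a'| <= B) ->
  N%:R * `|th| * B <= 1 -> (0 < N)%N ->
  0 < b -> 4 <= c1 ^+ 2 * th ^+ 2 * #|K|%:R * b ^+ 2 ->
  \sum_(x : {ffun K -> I} | N%:R * `|th * (\sum_k u (x k) - c)| <= 1) \prod_k p (x k)
  <= (N%:R^-1 + b) / c1.
Proof.
move=> V uB NB N0 b0 thb; have c10 := cos1_gt0 R.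
have NR : 0 < N%:R :> R by rewrite ltr0n.
have thB : 0 <= B.
  case: (pickP I) => [a _|I0]; first by have := uB a a; rewrite subrr normr0.
  by move: p1; rewrite big1 => [/eqP|a]; [rewrite eq_sym oner_eq0|have := I0 a].
pose tau (x : {ffun K -> I}) := th * (\sum_k u (x k) - c).
pose F x := \sum_(k < N) \sum_(l < N) cos ((k%:R - l%:R) * tau x).
have F0 x : 0 <= F x.
  (* [F] is the squared modulus of the sum of the first [N] harmonics *)
  rewrite /F (_ : \sum_k _ = (\sum_(k < N) cos (k%:R * tau x)) ^+ 2 +
      (\sum_(k < N) sin (k%:R * tau x)) ^+ 2); first by rewrite addr_ge0 ?sqr_ge0.
  rewrite !expr2 !mulr_suml -big_split; apply: eq_bigr => k _ /=.
  rewrite !mulr_sumr -big_split; apply: eq_bigr => l _ /=.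
  by rewrite mulrBl cosB.
have Fc x : N%:R * `|tau x| <= 1 -> N%:R ^+ 2 * c1 <= F x.
  move=> xN; rewrite (_ : N%:R ^+ 2 * c1 = \sum_(k < N) \sum_(l < N) c1); last first.
    by rewrite !sumr_const !card_ord -mulrnA -[RHS]mulr_natl natrM expr2.
  apply: ler_sum => k _; apply: ler_sum => l _; apply: cos_ge_cos1.
  rewrite normrM (le_trans _ xN)// ler_wpM2r// ler_norml.
  have := ltn_ord k; have := ltn_ord l; rewrite -!(ltr_nat R) => lN kN.
  by have : 0 <= k%:R :> R by []; have : 0 <= l%:R :> R by []; lra.
have EF : expect p F <= N%:R + N%:R ^+ 2 * b.
  rewrite /F expect_sum (_ : N%:R + _ = \sum_(k < N) (1 + N%:R * b)); last first.
    by rewrite sumr_const card_ord -[RHS]mulr_natl mulrDr mulr1 mulrA expr2.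
  apply: ler_sum => k _; rewrite expect_sum (bigD1 k)//=; apply: lerD.
    rewrite -[leRHS](expect_cst K p1); apply: expect_le => // x; exact: cos_le1.
  apply: (@le_trans _ _ (\sum_(l < N | l != k) b)); last first.
    rewrite [leRHS](_ : _ = \sum_(l < N) b); last first.
      by rewrite sumr_const card_ord -[RHS]mulr_natl.
    by rewrite [leLHS]big_mkcond; apply: ler_sum => l _; case: ifP => // _; exact: ltW.
  apply: ler_sum => l lk.
  rewrite (@eq_expect _ _ _ _ _ (fun x => cos (((k%:R - l%:R) * th) * \sum_k0 u (x k0) +
      - ((k%:R - l%:R) * th * c)))) => [|x]; last by congr cos; rewrite /tau; ring.
  have kl1 : 1 <= `|k%:R - l%:R : R| <= N%:R.
    have := ltn_ord k; have := ltn_ord l; rewrite -!(ltr_nat R) => lN kN.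
    have k0 : 0 <= k%:R :> R by []; have l0 : 0 <= l%:R :> R by [].
    have [kl|kl|kl] := ltngtP k l; last by move: lk; rewrite -val_eqE /= kl eqxx.
      have : k%:R + 1 <= l%:R :> R by rewrite natr1 ler_nat.
      by move=> ?; rewrite ler0_norm; lra.
    have : l%:R + 1 <= k%:R :> R by rewrite natr1 ler_nat.
    by move=> ?; rewrite ger0_norm; lra.
  move: kl1 => /andP[kl1 klN].
  apply: (@expect_cos_le B b) => //.
    by rewrite normrM (le_trans _ NB)// ler_wpM2r// ler_wpM2r.
  apply: le_trans thb _; rewrite ler_wpM2r ?sqr_ge0// ler_wpM2r// ler_wpM2l ?sqr_ge0//.
  rewrite exprMn -[leLHS]mul1r ler_wpM2r ?sqr_ge0//.
  by rewrite -[X in _ <= X]real_normK ?num_real// expr_ge1.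
rewrite ler_pdivlMr// -(ler_pM2l (_ : 0 < N%:R ^+ 2)) ?exprn_gt0//.
apply: (@le_trans _ _ (expect p F)).
  rewrite mulrCA mulr_suml big_mkcond; apply: ler_sum => x _.
  have w0 : 0 <= \prod_k p (x k) by exact: prodr_ge0.
  by case: ifP => [xN|_]; [rewrite ler_wpM2l// Fc|rewrite mulr_ge0].
apply: le_trans EF _; rewrite mulrDr le_eqVlt; apply/orP; left; apply/eqP.
by field; rewrite gt_eqF.
Qed.

End anticoncentration.

Section difference_statistic.
Context (R : realFieldType) (I J K L : finType) (P : I -> J -> R) (u : I -> R) (v : J -> R).
Hypothesis P0 : forall a b, 0 <= P a b.
Hypothesis P1 : \sum_a \sum_b P a b = 1.

Definition difference_statistic (xy : {ffun K -> I} * {ffun L -> J}) : R :=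
  \sum_j u (xy.1 j) - \sum_i v (xy.2 i).

(** As [pi] is bijective, the statistic is a sum of independent increments
    [u k.1 - v k.2] over the pairs. *)
Lemma difference_statistic_planted (pi : {ffun L -> K}) : bijective pi ->
  \sum_xy planted_weight P pi xy.1 xy.2 *
    (difference_statistic xy - #|K|%:R * \sum_a \sum_b P a b * (u a - v b)) ^+ 2 <=
  #|K|%:R * \sum_a \sum_b P a b * (u a - v b) ^+ 2.
Proof.
move=> bij; have inj := bij_inj bij; set c := \sum_a \sum_b P a b * (u a - v b).
rewrite (planted_expectation P (fun xy => (difference_statistic xy - #|K|%:R * c) ^+ 2) inj).
have PP1 : \sum_k pair_law P k = 1 by rewrite -[LHS](pair_bigA _ P).
have PP0 k : 0 <= pair_law P k by exact: P0.
pose w (k : I * J) := u k.1 - v k.2 - c.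
have mean : \sum_k pair_law P k * w k = 0.
  rewrite /w; under eq_bigr do rewrite mulrBr.
  rewrite sumrB -mulr_suml PP1 mul1r.
  by rewrite (pair_law_sum P (fun a b => u a - v b)) subrr.
rewrite (@eq_expect _ _ _ _ _
  (fun z : {ffun K -> I * J} => \sum_j \sum_j' w (z j) * w (z j'))) => [|z]; last first.
  have -> : difference_statistic (project_pairs pi z) - #|K|%:R * c = \sum_j w (z j).
    rewrite /w /difference_statistic sumrB sumr_const mulr_natl sumrB; congr (_ - _ - _).
      by apply: eq_bigr => j _; rewrite ffunE.
    rewrite [RHS](reindex pi)/=; last by case: bij => g *; exists g => ? _.
    by apply: eq_bigr => i _; rewrite ffunE.
  by rewrite expr2 mulr_suml; apply: eq_bigr => j _; rewrite mulr_sumr.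
rewrite expect_sum mulr_natl -[leRHS]/(_ *+ #|mem K|) -sumr_const.
apply: ler_sum => j _; rewrite expect_sum (bigD1 j)//= [X in _ + X]big1 ?addr0; last first.
  move=> j' j'j; rewrite (expect_resample PP1 j) -[RHS](expect_cst K PP1 0).
  apply: eq_expect => z.
  transitivity ((\sum_k pair_law P k * w k) * w (z j')); last by rewrite mean mul0r.
  by rewrite mulr_suml; apply: eq_bigr => k _; rewrite upd_same upd_other// mulrA.
rewrite (expect_resample PP1 j) -[leRHS](expect_cst K PP1); apply: expect_le => // z.
rewrite [leLHS](_ : _ = \sum_k pair_law P k * w k ^+ 2); last first.
  by apply: eq_bigr => k _; rewrite upd_same expr2.
rewrite -(pair_law_sum P (fun a b => (u a - v b) ^+ 2)) -subr_ge0 -sumrB.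
rewrite (eq_bigr (fun k => 2 * c * (pair_law P k * w k) +
    c ^+ 2 * pair_law P k)) => [|k _]; last first.
  by rewrite /w; ring.
by rewrite big_split -!mulr_sumr /= mean PP1 mulr0 add0r mulr1 sqr_ge0.
Qed.

End difference_statistic.

(** * Quantized samples *)

Local Open Scope classical_set_scope.

Lemma measure_finite_preimage d (T : measurableType d) (R : realType)
    (mu : {measure set T -> \bar R}) (I : finType) (c : T -> I) (Q : pred I) :
  (forall a, measurable (c @^-1` [set a])) ->
  mu [set x | Q (c x)] = (\sum_(a | Q a) mu (c @^-1` [set a]))%E.
Proof.
move=> mc.
rewrite bigfs ?index_enum_uniq//; last by move=> i; rewrite mem_index_enum.
rewrite -measure_fin_bigcup//.
- congr (mu _); apply/seteqP; split => x /=.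
    by move=> Qx; exists (c x).
  by move=> [a /= Qa ->].
- by move=> a b _ _ [x [/= -> ->]].
Qed.

Definition quantizer d (T : measurableType d) (I : finType) (c : T -> I) : Prop :=
  forall a, measurable (c @^-1` [set a]).

Section quantized.
Context d1 d2 (T1 : measurableType d1) (T2 : measurableType d2) (R : realType).
Context (P : probability (T1 * T2)%type R).
Context (I J : finType) (c : T1 -> I) (d : T2 -> J).
Hypotheses (mc : quantizer c) (md : quantizer d).

Definition quantized_law (a : I) (b : J) : R :=
  fine (P ((c @^-1` [set a]) `*` (d @^-1` [set b]))).

Definition quantize n m (z : n.-tuple T1 * m.-tuple T2) :
    {ffun 'I_n -> I} * {ffun 'I_m -> J} :=
  ([ffun j => c (tnth z.1 j)], [ffun i => d (tnth z.2 i)]).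

Lemma quantized_lawE a b :
  P ((c @^-1` [set a]) `*` (d @^-1` [set b])) = (quantized_law a b)%:E.
Proof. by rewrite fineK// fin_num_measure//; exact: measurableX. Qed.

Lemma quantized_law_ge0 a b : 0 <= quantized_law a b.
Proof. by rewrite fine_ge0. Qed.

Lemma marginal1_cell a :
  marginal1 P (c @^-1` [set a]) = (row_law quantized_law a)%:E.
Proof.
rewrite /row_law -sumEFin; under eq_bigr do rewrite -quantized_lawE.
pose Pa : {measure set _ -> \bar R} := mrestr P (measurableX (mc a) (@measurableT _ T2)).
have md2 b : measurable ((d \o @snd T1 T2) @^-1` [set b]).
  rewrite -[X in measurable X]setTI; exact: (measurable_snd measurableT _ (md b)).
have := measure_finite_preimage Pa xpredT md2.
rewrite /Pa /= /mrestr => E.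
transitivity (P ([set x | true] `&` (c @^-1` [set a] `*` setT))).
  rewrite /marginal1 /distribution/= /pushforward; congr (P _).
  by apply/seteqP; split => -[x y] //= [_ []].
rewrite E; apply: eq_bigr => b _; congr (P _).
by apply/seteqP; split => -[x y] //=; tauto.
Qed.

Lemma marginal2_cell b :
  marginal2 P (d @^-1` [set b]) = (col_law quantized_law b)%:E.
Proof.
rewrite /col_law -sumEFin; under eq_bigr do rewrite -quantized_lawE.
pose Pb : {measure set _ -> \bar R} := mrestr P (measurableX (@measurableT _ T1) (md b)).
have mc1 a : measurable ((c \o @fst T1 T2) @^-1` [set a]).
  rewrite -[X in measurable X]setTI; exact: (measurable_fst measurableT _ (mc a)).
have := measure_finite_preimage Pb xpredT mc1.
rewrite /Pb /= /mrestr => E.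
transitivity (P ([set x | true] `&` (setT `*` d @^-1` [set b]))).
  rewrite /marginal2 /distribution/= /pushforward; congr (P _).
  by apply/seteqP; split => -[x y] //= [_ []].
rewrite E; apply: eq_bigr => a _; congr (P _).
by apply/seteqP; split => -[x y] //=; tauto.
Qed.

Lemma quantized_law_sum : \sum_a \sum_b quantized_law a b = 1.
Proof.
apply: EFin_inj; rewrite -sumEFin.
under eq_bigr do rewrite -/(row_law quantized_law _) -marginal1_cell.
rewrite -(measure_finite_preimage (marginal1 P) xpredT mc) -(probability_setT (marginal1 P)).
by congr (_ _); apply/seteqP.
Qed.

Lemma quantize_cell n m (x : {ffun 'I_n -> I}) (y : {ffun 'I_m -> J}) :
  @quantize n m @^-1` [set (x, y)] =
  [set z | (forall j, (c @^-1` [set x j]) (tnth z.1 j)) /\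
           (forall i, (d @^-1` [set y i]) (tnth z.2 i))].
Proof.
apply/seteqP; split => z /=.
  by case=> <- <-; split=> k; rewrite ffunE.
by case=> zx zy; congr (_, _); apply/ffunP => k; rewrite ffunE.
Qed.

Lemma quantize_cellX n m (x : {ffun 'I_n -> I}) (y : {ffun 'I_m -> J}) :
  @quantize n m @^-1` [set (x, y)] =
  [set t | forall j, (c @^-1` [set x j]) (tnth t j)] `*`
  [set t | forall i, (d @^-1` [set y i]) (tnth t i)].
Proof. by rewrite quantize_cell. Qed.

Lemma quantizer_quantize n m : quantizer (@quantize n m).
Proof.
move=> [x y]; rewrite quantize_cellX.
apply: measurableX.
  exact: measurable_tuple_box (fun j => mc (x j)).
exact: measurable_tuple_box (fun i => md (y i)).
Qed.

(** A cell of the quantized sample is a box, and the laws of boxes are products. *)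
Lemma null_law_quantized n m (Q : pred ({ffun 'I_n -> I} * {ffun 'I_m -> J})) :
  null_law P n m [set z | Q (quantize z)] =
  (\sum_(z | Q z) null_weight quantized_law z.1 z.2)%:E.
Proof.
rewrite (measure_finite_preimage _ _ (@quantizer_quantize n m)) -sumEFin.
apply: eq_bigr => -[x y] _ /=; rewrite quantize_cellX.
rewrite /null_law [LHS]product_measure1E; first last.
- exact: measurable_tuple_box (fun i => md (y i)).
- exact: measurable_tuple_box (fun j => mc (x j)).
transitivity ((\prod_j marginal1 P (c @^-1` [set x j])) *
              \prod_i marginal2 P (d @^-1` [set y i]))%E.
  by congr (_ * _)%E; [exact: (iid_box _ (fun j => mc (x j)))
                      |exact: (iid_box _ (fun i => md (y i)))].
under eq_bigr do rewrite marginal1_cell.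
under [X in (_ * X)%E]eq_bigr do rewrite marginal2_cell.
by rewrite !prodEFin.
Qed.

Lemma planted_law_quantized n m (pi : {ffun 'I_m -> 'I_n})
    (Q : pred ({ffun 'I_n -> I} * {ffun 'I_m -> J})) : injective pi ->
  planted_law P pi [set z | Q (quantize z)] =
  (\sum_(z | Q z) planted_weight quantized_law pi z.1 z.2)%:E.
Proof.
move=> inj.
rewrite (measure_finite_preimage _ _ (@quantizer_quantize n m)) -sumEFin.
apply: eq_bigr => -[x y] _ /=; rewrite quantize_cell.
transitivity ((\prod_i P (c @^-1` [set x (pi i)] `*` d @^-1` [set y i])) *
    \prod_(j | j \notin codom pi) marginal1 P (c @^-1` [set x j]))%E.
  exact: (planted_law_box P inj (fun j => mc (x j)) (fun i => md (y i))).
under eq_bigr do rewrite quantized_lawE.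
under [X in (_ * X)%E]eq_bigr do rewrite marginal1_cell.
by rewrite !prodEFin.
Qed.

Lemma alt_law_quantized n m (Q : pred ({ffun 'I_n -> I} * {ffun 'I_m -> J})) :
  alt_law P [set z | Q (quantize z)] =
  (\sum_(z | Q z) alt_weight quantized_law z.1 z.2)%:E.
Proof.
rewrite /alt_law /alt_weight -mulr_sumr EFinM; congr (_ * _)%E.
rewrite exchange_big -sumEFin; apply: eq_big => [pi|pi]; first by rewrite inE.
by rewrite inE => /injectiveP inj; rewrite planted_law_quantized.
Qed.

End quantized.

(** * Approximation of measurable sets *)

Section approximation.
Context d (T : measurableType d) (R : realType) (K : finType).
Context (mu : K -> {finite_measure set T -> \bar R}) (A : set (set T)).
Hypothesis A0 : A set0.
Hypothesis AC : forall B, A B -> A (~` B).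
Hypothesis AU : forall B C, A B -> A C -> A (B `|` C).
Hypothesis Am : forall B, A B -> measurable B.

(** Approximation is required for the whole finite family of measures at once. *)
Definition approximable (B : set T) : Prop := measurable B /\
  forall e : R, 0 < e -> exists2 C, A C &
    forall k, (mu k ((B `\` C) `|` (C `\` B)) < e%:E)%E.

Lemma approximableC B : approximable B -> approximable (~` B).
Proof.
move=> [mB aB]; split=> [|e e0]; first exact: measurableC.
have [C AC' muC] := aB e e0; exists (~` C); first exact: AC.
move=> k; rewrite (_ : _ `|` _ = (B `\` C) `|` (C `\` B))//.
by apply/seteqP; split => x /=; have [|] := pselect (B x); have [|] := pselect (C x); tauto.
Qed.

Lemma measurable_sdiff (B C : set T) : measurable B -> measurable C ->
  measurable ((B `\` C) `|` (C `\` B)).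
Proof. by move=> mB mC; apply: measurableU; exact: measurableD. Qed.

Lemma approximableU B C : approximable B -> approximable C ->
  approximable (B `|` C).
Proof.
move=> [mB aB] [mC aC]; split=> [|e e0]; first exact: measurableU.
have e20 : 0 < e / 2 by rewrite divr_gt0.
have [B' AB muB] := aB _ e20; have [C' AC' muC] := aC _ e20.
exists (B' `|` C'); first exact: AU.
move=> k; have mB' := Am AB; have mC' := Am AC'.
apply: (@le_lt_trans _ _ (mu k (((B `\` B') `|` (B' `\` B)) `|` ((C `\` C') `|` (C' `\` C))))).
  apply: le_measure; rewrite ?inE.
  - by apply: measurable_sdiff; exact: measurableU.
  - by apply: measurableU; exact: measurable_sdiff.
  - move=> x /=; have [|] := pselect (B x); have [|] := pselect (C x);
    have [|] := pselect (B' x); have [|] := pselect (C' x); tauto.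
apply: le_lt_trans (measureU2 _ _ _) _; [exact: measurable_sdiff..|].
by rewrite (splitr e) EFinD lteD ?muB ?muC ?HN.
Qed.

(** The union is stopped at a finite stage, which is good for all the measures
    because there are finitely many of them. *)
Lemma approximable_bigcup (F : nat -> set T) : (forall i, approximable (F i)) ->
  approximable (\bigcup_i F i).
Proof.
move=> aF; have mF i := (aF i).1.
split=> [|e e0]; first exact: bigcup_measurable.
have e20 : 0 < e / 2 by rewrite divr_gt0.
pose U := \bigcup_i F i; pose G n := \big[setU/set0]_(i < n) F i.
have aG n : approximable (G n).
  rewrite /G; elim: n => [|n IH].
    rewrite big_ord0; split=> // e' e'0; exists set0 => // k.
    by rewrite setDv setU0 measure0 lte_fin.
  by rewrite big_ord_recr; exact: approximableU.
have mU : measurable U by exact: bigcup_measurable.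
have mD n : measurable (U `\` G n) by apply: measurableD => //; exact: (aG n).1.
have small k : \forall n \near \oo, (mu k (U `\` G n) < (e / 2)%:E)%E.
  have cv : mu k \o (fun n => U `\` G n) @ \oo --> mu k (\bigcap_n (U `\` G n)).
    apply: nonincreasing_cvg_mu => //.
    - by rewrite ltey_eq fin_num_measure.
    - exact: bigcap_measurable.
    - move=> i j ij; apply/subsetPset; apply: setDS.
      exact: subset_bigsetU.
  rewrite (_ : \bigcap_n _ = set0) ?measure0 in cv; last first.
    apply/seteqP; split => x //= h; have [[i _ Fi] _] := h 0%N I.
    have [_] := h i.+1 I; apply; rewrite /G big_ord_recr /=; by right.
  by apply: (cv (fun u => (u < (e / 2)%:E)%E)); apply: open_ereal_lt'; rewrite lte_fin.
have [N _ HN] := @filter_forall _ _ (fun k n => (mu k (U `\` G n) < (e / 2)%:E)%E) \oo _ small.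
have {}HN := HN N (leqnn N).
have [C AC' muC] := (aG N).2 _ e20.
exists C => // k; have mC := Am AC'.
apply: (@le_lt_trans _ _ (mu k ((U `\` G N) `|` ((G N `\` C) `|` (C `\` G N))))).
  apply: le_measure; rewrite ?inE.
  - exact: measurable_sdiff.
  - by apply: measurableU => //; apply: measurable_sdiff => //; exact: (aG N).1.
  - have GU : G N `<=` U by exact: bigsetU_bigcup.
    rewrite -/U => x /=; have := GU x; have [|] := pselect (U x); have [|] := pselect (C x);
    have [|] := pselect (G N x); tauto.
apply: le_lt_trans (measureU2 _ _ _) _ => //.
  by apply: measurable_sdiff => //; exact: (aG N).1.
by rewrite (splitr e) EFinD lteD ?muB ?muC ?HN.
Qed.

Lemma generated_approximable : <<s A >> `<=` approximable.
Proof.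
apply: smallest_sub; last first.
  move=> B AB; split; first exact: Am.
  move=> e e0; exists B => // k.
  by rewrite setDv setU0 measure0 lte_fin.
split.
- split=> // e e0; exists set0 => // k.
  by rewrite setDv setU0 measure0 lte_fin.
- by move=> B; rewrite setTD; exact: approximableC.
- exact: approximable_bigcup.
Qed.

End approximation.

Lemma quantizer_cst d (T : measurableType d) : quantizer (fun _ : T => tt).
Proof. by move=> []; rewrite (_ : _ @^-1` _ = setT)//; apply/seteqP; split. Qed.

Section quantized_sets.
Context d1 d2 (T1 : measurableType d1) (T2 : measurableType d2) (n m : nat).

Definition quantized_sets : set (set (n.-tuple T1 * m.-tuple T2)) :=
  [set A | exists (I J : finType) (c : T1 -> I) (d : T2 -> J)
     (Q : pred ({ffun 'I_n -> I} * {ffun 'I_m -> J})),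
     [/\ quantizer c, quantizer d & A = [set z | Q (quantize c d z)]]].

Lemma quantized_sets0 : quantized_sets set0.
Proof.
exists unit, unit, (fun=> tt), (fun=> tt), pred0.
by split; [exact: quantizer_cst..|apply/seteqP; split].
Qed.

Lemma quantized_setsC A : quantized_sets A -> quantized_sets (~` A).
Proof.
move=> [I [J [c [d [Q [mc md ->]]]]]]; exists I, J, c, d, (predC Q); split => //.
by apply/seteqP; split => z /= /negP.
Qed.

Lemma quantizer_pair d (T : measurableType d) (I I' : finType) (c : T -> I)
  (c' : T -> I') : quantizer c -> quantizer c' ->
  quantizer (fun x => (c x, c' x)).
Proof.
move=> mc mc' [a a'].
rewrite (_ : _ @^-1` _ = (c @^-1` [set a]) `&` (c' @^-1` [set a'])).
  exact: measurableI.
by apply/seteqP; split => x /= [-> ->].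
Qed.

Lemma quantized_setsU A B : quantized_sets A -> quantized_sets B ->
  quantized_sets (A `|` B).
Proof.
move=> [I [J [c [d [Q [mc md ->]]]]]] [I' [J' [c' [d' [Q' [mc' md' ->]]]]]].
pose Q'' (z : {ffun 'I_n -> I * I'} * {ffun 'I_m -> J * J'}) :=
  Q ([ffun j => (z.1 j).1], [ffun i => (z.2 i).1]) ||
  Q' ([ffun j => (z.1 j).2], [ffun i => (z.2 i).2]).
exists (I * I')%type, (J * J')%type, (fun x => (c x, c' x)), (fun y => (d y, d' y)), Q''.
split; [exact: quantizer_pair..|].
apply/funext => z; apply/propext; rewrite /Q'' /quantize /=.
rewrite (_ : [ffun j => ([ffun _ => _] j).1] = [ffun j => c (tnth z.1 j)]); last first.
  by apply/ffunP => k; rewrite !ffunE.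
rewrite (_ : [ffun i => ([ffun _ => _] i).1] = [ffun i => d (tnth z.2 i)]); last first.
  by apply/ffunP => k; rewrite !ffunE.
rewrite (_ : [ffun j => ([ffun _ => _] j).2] = [ffun j => c' (tnth z.1 j)]); last first.
  by apply/ffunP => k; rewrite !ffunE.
rewrite (_ : [ffun i => ([ffun _ => _] i).2] = [ffun i => d' (tnth z.2 i)]); last first.
  by apply/ffunP => k; rewrite !ffunE.
exact: (rwP orP).
Qed.

Lemma quantized_sets_measurable A : quantized_sets A -> measurable A.
Proof.
move=> [I [J [c [d [Q [mc md ->]]]]]].
rewrite (_ : [set z | _] = \bigcup_(k in [set k | Q k])
      (@quantize _ _ _ _ _ _ c d n m @^-1` [set k])).
  by apply: fin_bigcup_measurable => // k _; exact: quantizer_quantize.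
by apply/seteqP; split => z /= => [Qz|[k Qk zk]]; [exists (quantize c d z)|rewrite zk].
Qed.

Lemma quantizer_indicator d (T : measurableType d) (B : set T) : measurable B ->
  quantizer (fun x => x \in B).
Proof.
move=> mB [].
  by rewrite (_ : _ @^-1` _ = B)//; apply/seteqP; split => x /= => [/set_mem|/mem_set].
rewrite (_ : _ @^-1` _ = ~` B); first exact: measurableC.
by apply/seteqP; split => x /=; [move=> xB Bx; rewrite mem_set in xB|move=> xB; rewrite memNset].
Qed.

(** The identity is measurable for the generated sigma-algebra, because each
    coordinate is. *)
Lemma measurable_generated A : measurable A -> <<s quantized_sets >> A.
Proof.
move=> mA; pose S := g_sigma_algebraType quantized_sets.
have : measurable_fun [set: S] (id : S -> n.-tuple T1 * m.-tuple T2).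
  apply/measurable_fun_pairP; split; apply/measurable_fun_tnthP => k _ B mB;
    rewrite setTI; apply: sub_gen_smallest.
  - exists bool, unit, (fun x => x \in B), (fun=> tt),
      (fun z : {ffun 'I_n -> bool} * {ffun 'I_m -> unit} => z.1 k).
    split; [exact: quantizer_indicator|exact: quantizer_cst|].
    by apply/seteqP; split => z /=; [rewrite ffunE => /mem_set|rewrite ffunE => /set_mem].
  - exists unit, bool, (fun=> tt), (fun y => y \in B),
      (fun z : {ffun 'I_n -> unit} * {ffun 'I_m -> bool} => z.2 k).
    split; [exact: quantizer_cst|exact: quantizer_indicator|].
    by apply/seteqP; split => z /=; [rewrite ffunE => /mem_set|rewrite ffunE => /set_mem].
by move=> /(_ measurableT _ mA); rewrite setTI.
Qed.

End quantized_sets.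

(** * Impossibility of detection *)

Lemma fine_measure_sdiff d (T : measurableType d) (R : realType)
    (mu : {finite_measure set T -> \bar R}) (B C : set T) (e : R) :
  measurable B -> measurable C ->
  (mu ((B `\` C) `|` (C `\` B)) < e%:E)%E -> fine (mu B) <= fine (mu C) + e.
Proof.
move=> mB mC BCe; rewrite -lee_fin EFinD !fineK ?fin_num_measure//.
apply: (@le_trans _ _ (mu (C `|` ((B `\` C) `|` (C `\` B))))).
  apply: le_measure; rewrite ?inE//.
    by apply: measurableU => //; exact: measurable_sdiff.
  by move=> x /=; have [|] := pselect (C x); tauto.
apply: le_trans (measureU2 _ _ _) _ => //; first exact: measurable_sdiff.
by rewrite leeD2l// ltW.
Qed.

Section detection_measure.
Context d1 d2 (T1 : measurableType d1) (T2 : measurableType d2) (R : realType).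
Context (P : probability (T1 * T2)%type R).

(** The mixture as a real number, which unlike [alt_law] supports subtraction. *)
Definition alt_prob n m (A : set (n.-tuple T1 * m.-tuple T2)) : R :=
  #|injections m n|%:R^-1 * \sum_(pi in injections m n) fine (planted_law P pi A).

Lemma injections_gt0 n m : (m <= n)%N -> 0 < #|injections m n|%:R :> R.
Proof. by move=> mn; rewrite ltr0n card_inj_ffuns !card_ord ffact_gt0. Qed.

Lemma alt_lawE n m A : measurable A -> @alt_law _ _ _ _ _ P n m A = (alt_prob A)%:E.
Proof.
move=> mA; rewrite /alt_law /alt_prob EFinM -sumEFin; congr (_ * _)%E.
by apply: eq_bigr => pi _; rewrite fineK// fin_num_measure.
Qed.

Lemma average_le n m (f g : {ffun 'I_m -> 'I_n} -> R) : (m <= n)%N ->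
  (forall pi, f pi <= g pi) ->
  #|injections m n|%:R^-1 * \sum_(pi in injections m n) f pi <=
  #|injections m n|%:R^-1 * \sum_(pi in injections m n) g pi.
Proof.
move=> mn fg; rewrite ler_pM2l ?invr_gt0 ?injections_gt0//.
by apply: ler_sum.
Qed.

Lemma average_cst n m (e : R) : (m <= n)%N ->
  #|injections m n|%:R^-1 * \sum_(pi in injections m n) e = e.
Proof.
move=> mn; rewrite sumr_const -[X in _ * X]mulr_natl mulrA mulVf ?mul1r//.
by rewrite gt_eqF// injections_gt0.
Qed.

Lemma alt_prob_sdiff n m (B C : set (n.-tuple T1 * m.-tuple T2)) (e : R) :
  (m <= n)%N -> measurable B -> measurable C ->
  (forall pi : {ffun 'I_m -> 'I_n},
    (planted_law P pi ((B `\` C) `|` (C `\` B)) < e%:E)%E) ->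
  alt_prob B <= alt_prob C + e.
Proof.
move=> mn mB mC small; rewrite -[X in _ + X](average_cst e mn) -mulrDr -big_split /=.
by apply: average_le => // pi; exact: fine_measure_sdiff (small pi).
Qed.

Lemma alt_prob_ge0 n m (A : set (n.-tuple T1 * m.-tuple T2)) : 0 <= alt_prob A.
Proof. by rewrite mulr_ge0// sumr_ge0// => pi _; rewrite fine_ge0. Qed.

Lemma alt_prob_le1 n m (A : set (n.-tuple T1 * m.-tuple T2)) : (m <= n)%N ->
  measurable A -> alt_prob A <= 1.
Proof.
move=> mn mA; rewrite -[leRHS](average_cst 1 mn); apply: average_le => // pi.
by rewrite -lee_fin fineK ?fin_num_measure// probability_le1.
Qed.

Lemma alt_probC n m (A : set (n.-tuple T1 * m.-tuple T2)) : (m <= n)%N ->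
  measurable A -> alt_prob (~` A) = 1 - alt_prob A.
Proof.
move=> mn mA; rewrite -[X in X - _](average_cst 1 mn) -mulrBr -sumrB.
congr (_ * _); apply: eq_bigr => pi _; apply: EFin_inj.
rewrite fineK ?fin_num_measure//; last exact: measurableC.
by rewrite probability_setC// EFinB fineK// fin_num_measure.
Qed.

Context (t r alpha C : R).
Hypothesis chi2_le : forall (I J : finType) (c : T1 -> I) (d : T2 -> J),
  quantizer c -> quantizer d -> finite_chi2 (quantized_law P c d) <= t.
Hypothesis corr_le : forall (I J : finType) (c : T1 -> I) (d : T2 -> J),
  quantizer c -> quantizer d -> correlation_bound (quantized_law P c d) r.
Hypotheses (t0 : 0 <= t) (r0 : 0 <= r) (alpha_le1 : alpha <= 1).
Hypothesis C_bound : forall N, \sum_(k < N) level_weight alpha t r k <= C.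

Lemma second_moment_const_ge0 : 0 <= C.
Proof. by have := C_bound 0; rewrite big_ord0. Qed.

(** The inequality holds on quantized sets by the finite second moment bound, and
    both sides are continuous along approximations by such sets. *)
Lemma alt_prob_sqr_le n m (A : set (n.-tuple T1 * m.-tuple T2)) : (m <= n)%N ->
  m%:R <= alpha * n%:R -> measurable A ->
  alt_prob A ^+ 2 <= C * fine (null_law P n m A).
Proof.
move=> mn man mA; have C0 := second_moment_const_ge0.
apply/ler_addgt0Pr => e e0.
(* [(b + e') ^+ 2 <= b ^+ 2 + 3 * e'] when [b] and [e'] are at most [1], and the
   right-hand side changes by at most [C * e'] *)
pose D := C + 3; have D0 : 0 < D by rewrite /D; lra.
pose e' := Num.min 1 (e / D).
have e'0 : 0 < e' by rewrite lt_min ltr01 divr_gt0.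
have e'1 : e' <= 1 by rewrite ge_min lexx.
have e'e : e' * D <= e by rewrite -ler_pdivlMr// ge_min lexx orbT.
pose mu (k : option {ffun 'I_m -> 'I_n}) :
    {finite_measure set (n.-tuple T1 * m.-tuple T2)%type -> \bar R} :=
  if k is Some pi then planted_law P pi else null_law P n m.
have [_ /(_ _ e'0)[B qB muB]] := generated_approximable mu
  (@quantized_sets0 _ _ T1 T2 n m) (@quantized_setsC _ _ T1 T2 n m)
  (@quantized_setsU _ _ T1 T2 n m) (@quantized_sets_measurable _ _ T1 T2 n m)
  (measurable_generated mA).
have mB := quantized_sets_measurable qB.
have altAB : alt_prob A <= alt_prob B + e'.
  by apply: alt_prob_sdiff => // pi; exact: (muB (Some pi)).
have nullBA : fine (null_law P n m B) <= fine (null_law P n m A) + e'.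
  by apply: fine_measure_sdiff => //; rewrite setUC; exact: (muB None).
have BB : alt_prob B ^+ 2 <= C * fine (null_law P n m B).
  have [I [J [c [d [Q [mc md BE]]]]]] := qB.
  have nullE := null_law_quantized P mc md Q.
  have altE := alt_law_quantized P mc md Q.
  rewrite -BE in nullE altE; rewrite alt_lawE// in altE.
  rewrite (EFin_inj altE) nullE /=.
  apply: (@alt_weight_sqr_le _ _ _ _ _ _ _ _ t r alpha C);
    rewrite ?card_ord //.
  - exact: quantized_law_ge0.
  - exact: quantized_law_sum.
  - exact: chi2_le.
  - exact: corr_le.
have B0 := alt_prob_ge0 B; have A0 := alt_prob_ge0 A.
have B1 := alt_prob_le1 mn mB.
set a := alt_prob A in altAB A0 *; set b := alt_prob B in altAB BB B0 B1.
set x := fine _ in nullBA BB; set y := fine _ in nullBA *.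
have : C * x <= C * (y + e') by rewrite ler_wpM2l.
rewrite /D in e'e; nra.
Qed.

Lemma no_strong_detection (m : nat -> nat) : (forall n, (m n <= n)%N) ->
  (forall n, (m n)%:R <= alpha * n%:R) -> ~ strong_detection P m.
Proof.
move=> mn man [test [mtest null0 alt0]]; have C0 := second_moment_const_ge0.
have e0 : 0 < (4 * (C + 1))^-1 by rewrite invr_gt0; lra.
have h0 : (0 < (2^-1 : R)) by [].
have [n [nulln altn]] : exists n,
    (null_law P n (m n) (test n @^-1` [set true]) < ((4 * (C + 1))^-1)%:E)%E /\
    (alt_law P (test n @^-1` [set false]) < (2^-1)%:E)%E.
  have N1 : \forall n \near \oo,
      (null_law P n (m n) (test n @^-1` [set true]) < ((4 * (C + 1))^-1)%:E)%E.
    by apply: (null0 (fun u => (u < _)%E)); apply: open_ereal_lt'; rewrite lte_fin.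
  have N2 : \forall n \near \oo,
      (alt_law P (test n @^-1` [set false]) < (2^-1)%:E)%E.
    by apply: (alt0 (fun u => (u < _)%E)); apply: open_ereal_lt'; rewrite lte_fin.
  by have [n _ H] := filterI N1 N2; exists n; exact: (H n (leqnn n)).
have mt : measurable (test n @^-1` [set true]).
  by rewrite -[X in measurable X]setTI; exact: mtest.
have fE : test n @^-1` [set false] = ~` (test n @^-1` [set true]).
  by apply/seteqP; split => z /=; case: (test n z).
have := alt_prob_sqr_le (mn n) (man n) mt.
rewrite fE alt_lawE ?alt_probC// in altn; last exact: measurableC.
rewrite lte_fin in altn.
have {nulln} : fine (null_law P n (m n) (test n @^-1` [set true])) < (4 * (C + 1))^-1.
  by rewrite -lte_fin fineK// fin_num_measure.
set a := alt_prob _ in altn *; set x := fine _ => xC.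
have x0 : 0 <= x by rewrite fine_ge0.
have : x * (4 * (C + 1)) < 1 by rewrite -ltr_pdivlMr ?mul1r//; lra.
nra.
Qed.

End detection_measure.

(** * Chi-square divergence and finite partitions *)

Section fibers.
Context d (T : measurableType d) (R : realType) (I : finType) (c : T -> I).
Hypothesis mc : quantizer c.

Lemma quantizer_measurable (v : I -> R) : measurable_fun [set: T] (fun x => v (c x)).
Proof.
move=> _ Y mY; rewrite setTI.
rewrite (_ : _ @^-1` Y = \bigcup_(k in [set k | v k \in Y]) (c @^-1` [set k])).
  by apply: fin_bigcup_measurable => // k _; exact: mc.
apply/seteqP; split => x /= => [Yx|[k /set_mem Yk -> //]].
by exists (c x) => //=; exact: mem_set.
Qed.

Lemma integral_fibers (mu : {measure set T -> \bar R}) (f : T -> R) :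
  measurable_fun [set: T] f ->
  (\int[mu]_x (f x)%:E = \sum_k \int[mu]_(x in c @^-1` [set k]) (f x)%:E)%E.
Proof.
move=> mf.
have UT : \big[setU/set0]_(k <- index_enum I) (c @^-1` [set k]) = [set: T].
  rewrite -bigcup_seq; apply/seteqP; split => // x _.
  by exists (c x) => //=; rewrite mem_index_enum.
rewrite -[in LHS]UT integral_bigsetU_EFin ?index_enum_uniq//.
  by move=> a b _ _ [x [/= -> ->]].
by rewrite UT; exact/measurable_EFinP.
Qed.

Lemma integral_quantized (mu : {measure set T -> \bar R}) (v : I -> R) :
  (\int[mu]_x (v (c x))%:E = \sum_k (v k)%:E * mu (c @^-1` [set k]))%E.
Proof.
rewrite (integral_fibers _ (quantizer_measurable v)); apply: eq_bigr => k _.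
rewrite (eq_integral (fun=> (v k)%:E)); first by rewrite integral_cst//; exact: mc.
by move=> x; rewrite inE /= => ->.
Qed.

End fibers.

Lemma simple_function_quantizer d (T : measurableType d) (R : realType)
    (f : T -> R) : measurable_fun [set: T] f -> finite_set (range f) ->
  exists (I : finType) (c : T -> I) (v : I -> R),
    [/\ quantizer c, forall x, f x = v (c x) & forall k, exists x, v k = f x].
Proof.
move=> mf ff; have inE' x : f x \in fset_set (range f).
  by rewrite in_fset_set; [exact/mem_set/imageT|].
exists (fset_set (range f)), (fun x => [` inE' x]%fset), val; split => //.
  move=> k; rewrite (_ : _ @^-1` _ = f @^-1` [set val k]).
    by rewrite -[X in measurable X]setTI; exact: mf.
  by apply/seteqP; split => x /= => [<-//|E]; exact: val_inj.
move=> k; have := valP k; rewrite in_fset_set// => /set_mem [x _ <-]; by exists x.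
Qed.

Section chi2_divergence.
Context d (T : measurableType d) (R : realType) (P Q : probability T R).

(** On a cell of [Q]-mass [w] and centred density [l], integrate the pointwise
    bound [2 * l * u - l ^+ 2 <= u ^+ 2] with [u] the centred derivative. *)
Lemma quantized_chi2_le : (chi2_divergence P Q < +oo)%E ->
  exists2 t : R, 0 <= t & forall (I : finType) (c : T -> I) (w l : I -> R),
    quantizer c -> (forall k, Q (c @^-1` [set k]) = (w k)%:E) ->
    (forall k, P (c @^-1` [set k]) = (w k * (1 + l k))%:E) ->
    \sum_k w k * l k ^+ 2 <= t.
Proof.
rewrite /chi2_divergence; case: asboolP => // PQ.
set L := Radon_Nikodym _ _.
have Lfin z : L z \is a fin_num by exact: Radon_Nikodym_fin_num.
have iL : Q.-integrable setT L by exact: Radon_Nikodym_integrable.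
pose u z := fine (L z) - 1.
have LE z : (L z = (fine (L z))%:E)%E by rewrite fineK.
have mL : measurable_fun setT (fun z => fine (L z)).
  apply/measurable_EFinP; rewrite (_ : _ \o _ = L); first exact: measurable_int iL.
  by apply/funext => z; rewrite /= -LE.
have mu : measurable_fun setT u by exact: measurable_funB.
have mu2 : measurable_fun setT (fun z => u z ^+ 2) by exact: measurable_funX.
rewrite (eq_integral (fun z => (u z ^+ 2)%:E)); last first.
  by move=> z _; rewrite {1}LE -EFinB -EFin_expe.
set X := (\int[_]_x _)%E => Xoo.
have X0 : (0 <= X)%E by apply: integral_ge0 => z _; rewrite lee_fin sqr_ge0.
have Xfin : X \is a fin_num by rewrite ge0_fin_numE.
exists (fine X); first exact: fine_ge0.
move=> I c w l mc Qw Pw.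
rewrite -lee_fin fineK// /X (integral_fibers mc _ mu2) -sumEFin.
apply: lee_sum => k _; set A := c @^-1` [set k].
have mA : measurable A by exact: mc.
have iLA : Q.-integrable A (fun z => (fine (L z))%:E).
  rewrite (_ : (fun z => _) = L); first exact: integrableS iL.
  by apply/funext => z; rewrite -LE.
have icst (x : R) : Q.-integrable A (cst x%:E).
  exact: finite_measure_integrable_cst.
have iu : Q.-integrable A (fun z => ((2 * l k) * fine (L z))%:E).
  rewrite (_ : (fun z => _) = (fun z => (2 * l k)%:E * (fine (L z))%:E)%E)//.
  exact: integrableZl.
have ilin : Q.-integrable A
    (fun z => ((2 * l k) * fine (L z))%:E - (2 * l k + l k ^+ 2)%:E)%E.
  by apply: integrableB => //; exact: icst.
have linE : (\int[Q]_(z in A) (((2 * l k) * fine (L z))%:E -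
    (2 * l k + l k ^+ 2)%:E) = (w k * l k ^+ 2)%:E)%E.
  rewrite integralB//; last exact: icst.
  rewrite [X in (_ - X)%E](_ : _ = (2 * l k + l k ^+ 2)%:E * Q A)%E; last exact: integral_cst.
  rewrite (Qw k : Q A = _).
  rewrite (eq_integral (fun z => (2 * l k)%:E * (fine (L z))%:E)%E)//.
  rewrite integralZl//.
  have -> : (\int[Q]_(z in A) (fine (L z))%:E = P A)%E.
    rewrite (eq_integral L) => [|z _]; last by rewrite -LE.
    by rewrite -Radon_Nikodym_integral.
  by rewrite (Pw k : P A = _) -!EFinM -EFinB; congr EFin; ring.
rewrite -linE.
apply: le_integral => //; last first.
  move=> z _; rewrite -EFinB lee_fin /u.
  have := sqr_ge0 (fine (L z) - 1 - l k); nra.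
apply: (integrableS measurableT) => //; apply/integrableP; split.
  exact/measurable_EFinP.
rewrite (eq_integral (fun z => (u z ^+ 2)%:E)) -/X// => z _.
by rewrite /= ger0_norm// sqr_ge0.
Qed.

Import HBNNSimple.

(** Monotone simple approximations [f] of the derivative satisfy
    [P f >= Q (f ^+ 2)] and [Q f <= 1], so the hypothesis bounds [Q (f ^+ 2)]. *)
Lemma chi2_divergence_lty (K : R) : 0 <= K ->
  (forall (I : finType) (c : T -> I) (v : I -> R), quantizer c ->
    (forall k, 0 <= v k) ->
    (\sum_k v k * (fine (P (c @^-1` [set k])) - fine (Q (c @^-1` [set k])))) ^+ 2 <=
    K * \sum_k v k ^+ 2 * fine (Q (c @^-1` [set k]))) ->
  (chi2_divergence P Q < +oo)%E.
Proof.
move=> K0 HK.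
have PQ : P `<< Q.
  apply/null_content_dominatesP => A mA QA0.
  have := HK _ _ (fun b : bool => b%:R) (quantizer_indicator mA) (fun b => ler0n _ b).
  rewrite !big_bool /=.
  have -> : (fun x => x \in A) @^-1` [set true] = A.
    by apply/seteqP; split => x /= => [/set_mem|/mem_set].
  rewrite QA0 /= subr0 mul1r expr0n /= !mul0r ?mulr0 !addr0 ?mulr0 => P0.
  have : fine (P A) ^+ 2 == 0 by rewrite eq_le P0 sqr_ge0.
  by rewrite sqrf_eq0 fine_eq0 ?fin_num_measure// => /eqP.
rewrite /chi2_divergence; case: asboolP => // _.
pose g := Radon_Nikodym_SigmaFinite.f P Q.
have g0 z : (0 <= g z)%E by exact: Radon_Nikodym_SigmaFinite.f_ge0.
have gfin z : g z \is a fin_num by exact: Radon_Nikodym_SigmaFinite.f_fin_num.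
have ig : Q.-integrable setT g by exact: Radon_Nikodym_SigmaFinite.f_integrable.
have mg : measurable_fun setT g by exact: measurable_int ig.
have gE z : (g z = (fine (g z))%:E)%E by rewrite fineK.
have gr0 z : 0 <= fine (g z) by exact: fine_ge0.
have mgr : measurable_fun setT (fun z => fine (g z)).
  apply/measurable_EFinP; rewrite (_ : _ \o _ = g)//.
  by apply/funext => z; rewrite /= -gE.
have mL : measurable_fun setT (Radon_Nikodym (charge_of_finite_measure P) Q).
  by apply: (measurable_int Q); exact: Radon_Nikodym_integrable.
have msqr (h : T -> \bar R) : measurable_fun setT h ->
    measurable_fun setT (fun z => (h z - 1) ^+ 2)%E.
  move=> mh; rewrite (_ : (fun z => _) = (fun z => (h z - 1) * (h z - 1))%E).
    by apply: emeasurable_funM; exact: emeasurable_funB.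
  by apply/funext => z; rewrite expe2.
rewrite (ae_eq_integral (fun z => (g z - 1) ^+ 2)%E)//; last first.
- have := ae_eq_Radon_Nikodym_SigmaFinite PQ (@measurableT _ T).
  by apply: filterS => z /= E Tz; rewrite -E.
- exact: msqr.
- exact: msqr.
rewrite (eq_integral (fun z => ((fine (g z) - 1) ^+ 2)%:E)); last first.
  by move=> z _; rewrite {1}gE -EFinB -EFin_expe.
pose f := nnsfun_approx measurableT mg.
have fcvg z : EFin \o f ^~ z @ \oo --> g z.
  exact: cvg_nnsfun_approx.
have fnd z a b : (a <= b)%N -> f a z <= f b z.
  by move=> ab; exact/lefP/nd_nnsfun_approx.
have fg n z : f n z <= fine (g z).
  rewrite -lee_fin -gE -(cvg_lim _ (fcvg z))//.
  have nd : nondecreasing_seq (EFin \o f ^~ z).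
    by move=> a b ab; rewrite lee_fin fnd.
  rewrite (cvg_lim _ (ereal_nondecreasing_cvgn nd))//.
  by apply: ereal_sup_ubound; exists n.
have f2 n : (\int[Q]_z (f n z ^+ 2)%:E <= (K + 2)%:E)%E.
  have ff : finite_set (range (f n)) by exact: fimfunP.
  have mf : measurable_fun setT (f n) by exact: measurable_funP.
  have [I [c [v [mc fv vf]]]] := simple_function_quantizer mf ff.
  have v0 k : 0 <= v k by have [z ->] := vf k.
  rewrite (eq_integral (fun z => (v (c z) ^+ 2)%:E)) => [|z _]; last by rewrite fv.
  rewrite (integral_quantized mc Q (fun k => v k ^+ 2)).
  pose wP k := fine (P (c @^-1` [set k])).
  pose wQ k := fine (Q (c @^-1` [set k])).
  have wPE k : P (c @^-1` [set k]) = (wP k)%:E by rewrite fineK// fin_num_measure.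
  have wQE k : Q (c @^-1` [set k]) = (wQ k)%:E by rewrite fineK// fin_num_measure.
  rewrite (eq_bigr (fun k => (v k ^+ 2 * wQ k)%:E)) => [|k _]; last first.
    by rewrite [RHS]EFinM; congr (_ * _)%E; exact: wQE.
  rewrite sumEFin lee_fin.
  have wPQ k : v k * wQ k <= wP k.
    rewrite -lee_fin EFinM -wPE.
    have <- : (\int[Q]_(z in c @^-1` [set k]) (cst (v k)%:E) z = (v k)%:E * (wQ k)%:E)%E.
      by rewrite -wQE; exact: (integral_cst Q (mc k) (v k)%:E).
    rewrite (Radon_Nikodym_SigmaFinite.f_integral PQ (mc k)) -/g.
    apply: ge0_le_integral => //.
    - by move=> z _; rewrite lee_fin.
    - exact: measurable_funTS.
    - by move=> z /= <-; rewrite -fv gE lee_fin.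
  have wQ0 k : 0 <= wQ k by rewrite fine_ge0.
  have wP1 : \sum_k wP k = 1.
    apply: EFin_inj; rewrite -sumEFin.
    rewrite (eq_bigr (fun k => P (c @^-1` [set k]))) => [|k _]; last by rewrite wPE.
    rewrite -(measure_finite_preimage P xpredT mc) -(probability_setT P).
    by congr (P _); apply/seteqP.
  have := HK _ _ _ mc v0; rewrite -/(wQ _).
  set B := \sum_k v k ^+ 2 * _; under eq_bigr do rewrite mulrBr.
  rewrite sumrB; set a := \sum_k _; set b := \sum_k _.
  have aB : B <= a.
    by apply: ler_sum => k _; rewrite expr2 -mulrA ler_wpM2l ?wPQ.
  have b1 : b <= 1 by rewrite -wP1; exact: ler_sum.
  have B0 : 0 <= B by apply: sumr_ge0 => k _; rewrite mulr_ge0 ?sqr_ge0 ?wQ0.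
  move=> abK; have [B2|B2] := leP B 2; first lra.
  have : (B - 1) ^+ 2 <= K * B by apply: le_trans abK; rewrite ler_sqr ?nnegrE; lra.
  nra.
have g2 : (\int[Q]_z (fine (g z) ^+ 2)%:E <= (K + 2)%:E)%E.
  rewrite (eq_integral (fun z => limn (fun n => (f n z ^+ 2)%:E))); last first.
    move=> z _; apply/esym/cvg_lim => //.
    have fc : f n z @[n --> \oo] --> fine (g z).
      by apply: (@fine_cvg _ _ _ _ (EFin \o f ^~ z)); rewrite -gE.
    apply: cvg_EFin; first by near=> n.
    by rewrite expr2; under eq_fun do rewrite expr2; exact: cvgM.
  rewrite monotone_convergence//; first last.
  - by move=> z _ a b ab; rewrite lee_fin ler_sqr ?nnegrE ?fnd.
  - by move=> n z _; rewrite lee_fin sqr_ge0.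
  - by move=> n; apply/measurable_EFinP; exact: measurable_funX.
  apply: lime_le; last by near=> n.
  apply: ereal_nondecreasing_is_cvgn => a b ab; apply: ge0_le_integral => //.
  - by move=> z _; rewrite lee_fin sqr_ge0.
  - by apply/measurable_EFinP; exact: measurable_funX.
  - by apply/measurable_EFinP; exact: measurable_funX.
  - by move=> z _; rewrite lee_fin ler_sqr ?nnegrE ?fnd.
apply: (@le_lt_trans _ _ (\int[Q]_z ((fine (g z) ^+ 2)%:E + 1%:E))%E).
  apply: ge0_le_integral => //.
  - by move=> z _; rewrite lee_fin sqr_ge0.
  - by apply/measurable_EFinP; apply: measurable_funX; exact: measurable_funB.
  - by apply: emeasurable_funD => //; apply/measurable_EFinP; exact: measurable_funX.
  - by move=> z _; rewrite -EFinD lee_fin; have := gr0 z; nra.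
rewrite ge0_integralD//; first last.
- by apply/measurable_EFinP; exact: measurable_funX.
- by move=> z _; rewrite lee_fin sqr_ge0.
have int1 : (\int[Q]_(z in setT) (cst 1%E) z = 1)%E.
  transitivity (1 * Q [set: T])%E; first exact: integral_cst.
  by rewrite probability_setT mule1.
rewrite [X in (_ + X)%E]int1.
by apply: (@le_lt_trans _ _ ((K + 2)%:E + 1%:E)%E); [exact: leeD2r|rewrite ltry].
Unshelve. all: by end_near. Qed.

End chi2_divergence.

(** * Chi-square information and product partitions *)

Section rectangles.
Context d1 d2 (T1 : measurableType d1) (T2 : measurableType d2).

Definition rectangle_sets : set (set (T1 * T2)) :=
  [set A | exists (I J : finType) (c : T1 -> I) (d : T2 -> J) (S : I -> J -> bool),
     [/\ quantizer c, quantizer d & A = [set z | S (c z.1) (d z.2)]]].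

Lemma quantizer_rectangle (I J : finType) (c : T1 -> I) (d : T2 -> J) :
  quantizer c -> quantizer d -> quantizer (fun z => (c z.1, d z.2)).
Proof.
move=> mc md [a b].
rewrite (_ : _ @^-1` _ = (c @^-1` [set a]) `*` (d @^-1` [set b])).
  exact: measurableX.
by apply/seteqP; split => -[x y] /= [-> ->].
Qed.

Lemma rectangle_sets0 : rectangle_sets set0.
Proof.
exists unit, unit, (fun=> tt), (fun=> tt), (fun _ _ => false).
by split; [exact: quantizer_cst..|apply/seteqP; split].
Qed.

Lemma rectangle_setsC A : rectangle_sets A -> rectangle_sets (~` A).
Proof.
move=> [I [J [c [d [S [mc md ->]]]]]].
exists I, J, c, d, (fun a b => ~~ S a b); split => //.
by apply/seteqP; split => z /= /negP.
Qed.

Lemma rectangle_setsU A B : rectangle_sets A -> rectangle_sets B ->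
  rectangle_sets (A `|` B).
Proof.
move=> [I [J [c [d [S [mc md ->]]]]]] [I' [J' [c' [d' [S' [mc' md' ->]]]]]].
exists (I * I')%type, (J * J')%type, (fun x => (c x, c' x)), (fun y => (d y, d' y)),
  (fun a b => S a.1 b.1 || S' a.2 b.2).
split; [exact: quantizer_pair..|].
by apply/funext => z; apply/propext; exact: (rwP orP).
Qed.

Lemma measurable_quantized_set dT (X : measurableType dT) (I : finType)
  (c : X -> I) (S : pred I) : quantizer c -> measurable [set x | S (c x)].
Proof.
move=> mc.
rewrite (_ : [set x | _] = \bigcup_(k in [set k | S k]) (c @^-1` [set k])).
  by apply: fin_bigcup_measurable => // k _; exact: mc.
by apply/seteqP; split => x /= => [Sx|[k Sk ->]//]; exists (c x).
Qed.

Lemma rectangle_sets_measurable A : rectangle_sets A -> measurable A.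
Proof.
move=> [I [J [c [d [S [mc md ->]]]]]].
exact: (measurable_quantized_set (fun k => S k.1 k.2) (quantizer_rectangle mc md)).
Qed.

Lemma measurable_generated_rectangles A : measurable A -> <<s rectangle_sets >> A.
Proof.
move=> mA; pose S := g_sigma_algebraType rectangle_sets.
have : measurable_fun [set: S] (id : S -> T1 * T2).
  apply/measurable_fun_pairP; split => _ B mB; rewrite setTI; apply: sub_gen_smallest.
  - exists bool, unit, (fun x => x \in B), (fun=> tt), (fun a _ => a).
    split; [exact: quantizer_indicator|exact: quantizer_cst|].
    by apply/seteqP; split => z /= => [/mem_set|/set_mem].
  - exists unit, bool, (fun=> tt), (fun y => y \in B), (fun _ b => b).
    split; [exact: quantizer_cst|exact: quantizer_indicator|].
    by apply/seteqP; split => z /= => [/mem_set|/set_mem].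
by move=> /(_ measurableT _ mA); rewrite setTI.
Qed.

(** Take the product of all the partitions involved. *)
Lemma rectangle_sets_common (F : eqType) (s : seq F) (C : F -> set (T1 * T2)) :
  (forall k, rectangle_sets (C k)) ->
  exists (I J : finType) (c : T1 -> I) (d : T2 -> J) (S : F -> I -> J -> bool),
    [/\ quantizer c, quantizer d &
        forall k, k \in s -> C k = [set z | S k (c z.1) (d z.2)]].
Proof.
move=> rC; elim: s => [|k0 s [I [J [c [d [S [mc md CS]]]]]]].
  exists unit, unit, (fun=> tt), (fun=> tt), (fun _ _ _ => false).
  by split => //; exact: quantizer_cst.
have [I' [J' [c' [d' [S' [mc' md' CS']]]]]] := rC k0.
exists (I * I')%type, (J * J')%type, (fun x => (c x, c' x)), (fun y => (d y, d' y)),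
  (fun k a b => if k == k0 then S' a.2 b.2 else S k a.1 b.1).
split; [exact: quantizer_pair..|].
move=> k; rewrite inE; case: eqP => [->|_] /=; first by rewrite CS'.
by move=> ks; rewrite CS.
Qed.

End rectangles.

Section chi2_quantized.
Context d1 d2 (T1 : measurableType d1) (T2 : measurableType d2) (R : realType).
Context (P : probability (T1 * T2)%type R).

Definition product_law : probability (T1 * T2)%type R :=
  (marginal1 P \x marginal2 P)%E.

Lemma rectangle_law (I J : finType) (c : T1 -> I) (d : T2 -> J) a b :
  quantizer c -> quantizer d ->
  product_law ((c @^-1` [set a]) `*` (d @^-1` [set b])) =
   (row_law (quantized_law P c d) a * col_law (quantized_law P c d) b)%:E.
Proof.
move=> mc md; rewrite [LHS]product_measure1E//.
by rewrite EFinM; congr (_ * _)%E; [exact: marginal1_cell|exact: marginal2_cell].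
Qed.

Lemma rectangle_fiber (I J : finType) (c : T1 -> I) (d : T2 -> J) a b :
  (fun z : T1 * T2 => (c z.1, d z.2)) @^-1` [set (a, b)] =
  (c @^-1` [set a]) `*` (d @^-1` [set b]).
Proof. by apply/seteqP; split => -[x y] /= [-> ->]. Qed.

(** Quantizing both coordinates is one quantization of the pair. *)
Lemma finite_chi2_bounded : (chi2_information P < +oo)%E ->
  exists2 t : R, 0 <= t & forall (I J : finType) (c : T1 -> I) (d : T2 -> J),
    quantizer c -> quantizer d -> finite_chi2 (quantized_law P c d) <= t.
Proof.
rewrite /chi2_information => /(@quantized_chi2_le _ _ _ P product_law)[t t0 ht].
exists t => // I J c d mc md.
rewrite /finite_chi2 pair_bigA /=.
apply: (ht _ _ (fun k => row_law _ k.1 * col_law _ k.2)%R (fun k => centred_density _ k.1 k.2)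
  (quantizer_rectangle mc md)) => -[a b] /=; rewrite rectangle_fiber.
  exact: rectangle_law.
rewrite density_mul; first exact: quantized_lawE.
exact: quantized_law_ge0.
Qed.

(** The Cauchy-Schwarz inequality gives the hypothesis of [chi2_divergence_lty]
    for step functions on rectangles; for an arbitrary finite partition each cell
    is approximated by a union [C k] of rectangles, the same product partition
    serving for all cells. *)
Lemma chi2_information_lty (K : R) : 0 <= K ->
  (forall (I J : finType) (c : T1 -> I) (d : T2 -> J),
    quantizer c -> quantizer d -> finite_chi2 (quantized_law P c d) <= K) ->
  (chi2_information P < +oo)%E.
Proof.
move=> K0 HK; apply: (@chi2_divergence_lty _ _ _ P product_law K K0).
move=> F s v ms v0.
pose A k := s @^-1` [set k]; pose prP B := fine (P B).
pose prQ B := fine (product_law B).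
rewrite -/(prP _) -/(prQ _).
pose V := \sum_k v k; have V0 : 0 <= V by exact: sumr_ge0.
apply/ler_addgt0Pr => e e0.
(* the first term pays for the change of the left-hand side ([XYsq]), the second
   for that of the right-hand side ([GV]) *)
pose D := 4 * V ^+ 2 + 2 * K * V ^+ 2 + 1.
have D0 : 0 < D by rewrite /D; nra.
pose e' := e / D; have e'0 : 0 < e' by rewrite divr_gt0.
pose mu (b : bool) : {finite_measure set (T1 * T2)%type -> \bar R} :=
  if b then P else product_law.
have /choice[C hC] : forall k, exists C, rectangle_sets C /\
    forall b, (mu b ((A k `\` C) `|` (C `\` A k)) < e'%:E)%E.
  move=> k; have [_ h] := generated_approximable mu
    (@rectangle_sets0 _ _ T1 T2) (@rectangle_setsC _ _ T1 T2)
    (@rectangle_setsU _ _ T1 T2) (@rectangle_sets_measurable _ _ T1 T2)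
    (measurable_generated_rectangles (ms k)).
  by have [C rC muC] := h _ e'0; exists C.
have mA k : measurable (A k) by exact: ms.
have mC k : measurable (C k) by exact: rectangle_sets_measurable (hC k).1.
have [I [J [c [d [S [mc md CS]]]]]] :=
  rectangle_sets_common (enum F) (fun k => (hC k).1).
pose L := quantized_law P c d.
have L0 : forall a b, 0 <= L a b by exact: quantized_law_ge0.
have mcd := quantizer_rectangle mc md.
have sumP (Z : I -> J -> bool) :
    prP [set z | Z (c z.1) (d z.2)] = \sum_a \sum_b L a b * (Z a b)%:R.
  rewrite pair_bigA /=; apply: EFin_inj; rewrite fineK ?fin_num_measure//; last first.
    exact: (measurable_quantized_set (fun k => Z k.1 k.2) mcd).
  rewrite (measure_finite_preimage P (fun k => Z k.1 k.2) mcd) -sumEFin big_mkcond.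
  apply: eq_bigr => -[a b] _ /=; case: ifP => _; last by rewrite mulr0.
  by rewrite mulr1 rectangle_fiber quantized_lawE.
pose pq a b := row_law L a * col_law L b.
have sumQ (Z : I -> J -> bool) :
    prQ [set z | Z (c z.1) (d z.2)] = \sum_a \sum_b pq a b * (Z a b)%:R.
  rewrite pair_bigA /=; apply: EFin_inj; rewrite fineK ?fin_num_measure//; last first.
    exact: (measurable_quantized_set (fun k => Z k.1 k.2) mcd).
  rewrite (measure_finite_preimage product_law (fun k => Z k.1 k.2) mcd).
  rewrite -sumEFin big_mkcond.
  apply: eq_bigr => -[a b] _ /=; case: ifP => _; last by rewrite mulr0.
  by rewrite mulr1 rectangle_fiber; exact: rectangle_law.
pose g a b := \sum_k v k * (S k a b)%:R.
pose Y := \sum_k v k * (prP (C k) - prQ (C k)).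
have CE k : C k = [set z | S k (c z.1) (d z.2)] by apply: CS; rewrite mem_enum.
have YE : Y = \sum_a \sum_b pq a b * (centred_density L a b * g a b).
  transitivity (\sum_a \sum_b \sum_k v k * ((L a b - pq a b) * (S k a b)%:R)).
    rewrite [RHS](eq_bigr (fun a => \sum_k \sum_b v k * ((L a b - pq a b) * (S k a b)%:R))).
      rewrite exchange_big; apply: eq_bigr => k _ /=.
      rewrite CE sumP sumQ -sumrB mulr_sumr; apply: eq_bigr => a _.
      by rewrite -sumrB mulr_sumr; apply: eq_bigr => b _; rewrite -mulrBl.
    by move=> a _; rewrite exchange_big.
  apply: eq_bigr => a _; apply: eq_bigr => b _.
  rewrite mulrA (centred_densityE L0) /g mulr_sumr; apply: eq_bigr => k _.
  by rewrite mulrCA.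
pose G := \sum_a \sum_b pq a b * g a b ^+ 2.
have GE : G = \sum_k \sum_l v k * v l * prQ (C k `&` C l).
  transitivity (\sum_k \sum_l \sum_a \sum_b v k * v l * (pq a b * (S k a b && S l a b)%:R)).
    rewrite [RHS](eq_bigr (fun k => \sum_a \sum_b \sum_l
      v k * v l * (pq a b * (S k a b && S l a b)%:R))).
      rewrite [RHS]exchange_big; apply: eq_bigr => a _ /=.
      rewrite [RHS]exchange_big; apply: eq_bigr => b _ /=.
      rewrite /g expr2 mulr_suml mulr_sumr; apply: eq_bigr => k _.
      rewrite !mulr_sumr; apply: eq_bigr => l _.
      by rewrite -mulnb natrM; ring.
    move=> k _; rewrite exchange_big; apply: eq_bigr => a _.
    by rewrite exchange_big.
  apply: eq_bigr => k _; apply: eq_bigr => l _.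
  rewrite (_ : C k `&` C l = [set z | S k (c z.1) (d z.2) && S l (c z.1) (d z.2)]).
    rewrite (sumQ (fun a b => S k a b && S l a b)) mulr_sumr.
    by apply: eq_bigr => a _; rewrite mulr_sumr.
  by rewrite !CE; apply/funext => z; apply/propext; exact: (rwP andP).
have YG : Y ^+ 2 <= K * G.
  rewrite YE /G !pair_bigA /=.
  have pq0 (z : I * J) : 0 <= pq z.1 z.2.
    by rewrite mulr_ge0 ?row_law_ge0 ?col_law_ge0.
  apply: le_trans (weighted_cauchy_schwarz _ _ _ pq0) _.
  rewrite ler_wpM2r//; first by apply: sumr_ge0 => z _; rewrite mulr_ge0 ?sqr_ge0.
  by apply: le_trans (HK _ _ _ _ mc md); rewrite /finite_chi2 pair_bigA.
have prQ0 B : 0 <= prQ B by exact: fine_ge0.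
have prQ1 B : measurable B -> prQ B <= 1.
  by move=> mB; rewrite -lee_fin fineK ?fin_num_measure// probability_le1.
have prP0 B : 0 <= prP B by exact: fine_ge0.
have prP1 B : measurable B -> prP B <= 1.
  by move=> mB; rewrite -lee_fin fineK ?fin_num_measure// probability_le1.
have QCC k l : prQ (C k `&` C l) <= (k == l)%:R * prQ (A k) + 2 * e'.
  case: eqP => [<-|kl].
    rewrite setIid mul1r; apply: (@le_trans _ _ (prQ (A k) + e')); last by lra.
    by apply: fine_measure_sdiff => //; rewrite setUC; exact: ((hC k).2 false).
  rewrite mul0r add0r -lee_fin fineK ?fin_num_measure//; last exact: measurableI.
  apply: (@le_trans _ _ (product_law ((C k `\` A k) `|` (C l `\` A l)))).
    apply: le_measure; rewrite ?inE.
    - exact: measurableI.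
    - by apply: measurableU; apply: measurableD.
    - move=> z /= [Ck Cl]; have [Ak|] := pselect (A k z); last by left.
      by right; split=> // Al; apply: kl; rewrite -Ak -Al.
  apply: le_trans (measureU2 _ _ _) _; [exact: measurableD..|].
  have sub x : (product_law (C x `\` A x) <= e'%:E)%E.
    apply: ltW; apply: le_lt_trans ((hC x).2 false); apply: le_measure; rewrite ?inE.
    - exact: measurableD.
    - exact: measurable_sdiff.
    - by move=> z /=; right.
  by rewrite mulr2n mulrDl !mul1r EFinD; exact: leeD (sub k) (sub l).
have dP k : `|prP (A k) - prP (C k)| <= e'.
  rewrite ler_norml; apply/andP; split.
    rewrite lerBrDr addrC -lerBrDr opprK.
    by apply: fine_measure_sdiff => //; rewrite setUC; exact: ((hC k).2 true).
  rewrite lerBlDr addrC.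
  by apply: fine_measure_sdiff => //; exact: ((hC k).2 true).
have dQ k : `|prQ (A k) - prQ (C k)| <= e'.
  rewrite ler_norml; apply/andP; split.
    rewrite lerBrDr addrC -lerBrDr opprK.
    by apply: fine_measure_sdiff => //; rewrite setUC; exact: ((hC k).2 false).
  rewrite lerBlDr addrC.
  by apply: fine_measure_sdiff => //; exact: ((hC k).2 false).
pose X := \sum_k v k * (prP (A k) - prQ (A k)).
change (X ^+ 2 <= K * (\sum_k v k ^+ 2 * prQ (A k)) + e).
have bnd (h : F -> R) M : (forall k, `|h k| <= M) -> `|\sum_k v k * h k| <= V * M.
  move=> hM; apply: le_trans (ler_norm_sum _ _ _) _.
  rewrite mulr_suml; apply: ler_sum => k _.
  by rewrite normrM ger0_norm// ler_wpM2l.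
have XV : `|X| <= V * 1.
  apply: bnd => k; have := prP0 (A k); have := prQ0 (A k).
  by have := prP1 _ (mA k); have := prQ1 _ (mA k); rewrite ler_norml; lra.
have YV : `|Y| <= V * 1.
  apply: bnd => k; have := prP0 (C k); have := prQ0 (C k).
  by have := prP1 _ (mC k); have := prQ1 _ (mC k); rewrite ler_norml; lra.
have XY : `|X - Y| <= V * (2 * e').
  rewrite -sumrB; under eq_bigr do rewrite -mulrBr.
  apply: bnd => k; have := dP k; have := dQ k.
  by rewrite !ler_norml; lra.
have GV : G <= \sum_k v k ^+ 2 * prQ (A k) + 2 * e' * V ^+ 2.
  rewrite GE; apply: (@le_trans _ _ (\sum_k \sum_l v k * v l * ((k == l)%:R * prQ (A k) + 2 * e'))).
    by apply: ler_sum => k _; apply: ler_sum => l _; rewrite ler_wpM2l// mulr_ge0.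
  rewrite (eq_bigr (fun k => v k ^+ 2 * prQ (A k) + v k * V * (2 * e'))) => [|k _].
    by rewrite big_split -!mulr_suml /= -/V lerD2l; lra.
  under eq_bigr do rewrite mulrDr.
  rewrite big_split /= -mulr_suml -mulr_sumr -/V; congr (_ + _).
  rewrite (bigD1 k)//= eqxx big1 ?addr0 => [|l lk]; first by rewrite expr2 mul1r.
  by rewrite eq_sym (negbTE lk) mul0r mulr0.
have eD : e' * D = e by rewrite divfK// gt_eqF.
have XYsq : X ^+ 2 - Y ^+ 2 <= 4 * e' * V ^+ 2.
  rewrite subr_sqr; apply: le_trans (ler_norm _) _; rewrite normrM.
  have -> : 4 * e' * V ^+ 2 = V * (2 * e') * (V * 1 + V * 1) by ring.
  by apply: ler_pM => //; apply: le_trans (ler_normD _ _) _; exact: lerD.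
have KG : K * G <= K * (\sum_k v k ^+ 2 * prQ (A k) + 2 * e' * V ^+ 2) by rewrite ler_wpM2l.
rewrite -eD /D; set Sg := \sum_k v k ^+ 2 * _ in KG *.
by move: XYsq YG KG e'0; clear; lra.
Qed.

End chi2_quantized.

(** * Maximal correlation and step functions *)

Section square_integrable.
Context d (T : measurableType d) (R : realType) (mu : probability T R).
Implicit Types f g : T -> R.

Definition square_integrable f :=
  measurable_fun [set: T] f /\ mu.-integrable [set: T] (fun x => (f x ^+ 2)%:E).

Lemma le_integrable_real f g : measurable_fun [set: T] f ->
  (forall x, `|f x| <= g x) -> mu.-integrable [set: T] (EFin \o g) ->
  mu.-integrable [set: T] (EFin \o f).
Proof.
move=> mf fg ig; apply: le_integrable ig => //; first exact/measurable_EFinP.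
by move=> x _ /=; rewrite lee_fin (le_trans (fg x))// ler_norm.
Qed.

Lemma square_integrableM f g : square_integrable f -> square_integrable g ->
  mu.-integrable [set: T] (EFin \o (fun x => f x * g x)).
Proof.
move=> [mf if2] [mg ig2].
apply: (@le_integrable_real _ (fun x => f x ^+ 2 + g x ^+ 2)).
- exact: measurable_funM.
- by move=> x; rewrite ler_norml; apply/andP; split; have := sqr_ge0 (f x - g x);
    have := sqr_ge0 (f x + g x); have := sqr_ge0 (f x); have := sqr_ge0 (g x); nra.
- exact: (integrableD _ if2 ig2).
Qed.

Lemma square_integrableB f g : square_integrable f -> square_integrable g ->
  square_integrable (fun x => f x - g x).
Proof.
move=> sf sg; have [mf if2] := sf; have [mg ig2] := sg.
split; first exact: measurable_funB.
apply: (@le_integrable_real (fun x => (f x - g x) ^+ 2) (fun x => 2 * f x ^+ 2 + 2 * g x ^+ 2)).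
- by apply: measurable_funX; exact: measurable_funB.
- by move=> x; rewrite ger0_norm ?sqr_ge0//; have := sqr_ge0 (f x + g x); nra.
- exact: (integrableD _ (integrableZl _ 2 if2) (integrableZl _ 2 ig2)).
Qed.

Lemma square_integrable1 f : square_integrable f ->
  mu.-integrable [set: T] (EFin \o f).
Proof.
move=> [mf if2]; apply: (@le_integrable_real _ (fun x => f x ^+ 2 + 1)) => //.
- by move=> x; rewrite ler_norml; have := sqr_ge0 (f x - 1); have := sqr_ge0 (f x + 1);
    have := sqr_ge0 (f x); nra.
- exact: (integrableD _ if2 (finite_measure_integrable_cst mu 1 measurableT)).
Qed.

Lemma square_integrable_quantized (I : finType) (c : T -> I) (u : I -> R) :
  quantizer c -> square_integrable (fun x => u (c x)).
Proof.
move=> mc; split; first exact: quantizer_measurable.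
pose M := \sum_k u k ^+ 2.
apply: (@le_integrable_real (fun x => u (c x) ^+ 2) (cst M)).
- exact: (quantizer_measurable mc (fun k => u k ^+ 2)).
- move=> x; rewrite ger0_norm ?sqr_ge0// /M (bigD1 (c x))//= lerDl.
  by apply: sumr_ge0 => k _; exact: sqr_ge0.
- exact: finite_measure_integrable_cst.
Qed.

Lemma Rintegral_quantized (I : finType) (c : T -> I) (u : I -> R) : quantizer c ->
  \int[mu]_x u (c x) = \sum_k fine (mu (c @^-1` [set k])) * u k.
Proof.
move=> mc; rewrite /Rintegral (integral_quantized mc mu u) -[RHS]/(fine (_)%:E) -sumEFin.
congr fine; apply: eq_bigr => k _.
by rewrite muleC EFinM fineK// fin_num_measure//; exact: mc.
Qed.

Import HBNNSimple.

(** Simple approximations of the positive and the negative part stay below them,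
    so that the error is dominated by the function itself. *)
Lemma square_integrable_approx f (e : R) : square_integrable f -> 0 < e ->
  exists (I : finType) (c : T -> I) (u : I -> R), quantizer c /\
    \int[mu]_x (f x - u (c x)) ^+ 2 <= e.
Proof.
move=> [mf if2] e0.
pose fp x := Num.max (f x) 0; pose fn x := Num.max (- f x) 0.
have mfp : measurable_fun setT (EFin \o fp).
  by apply/measurable_EFinP; exact: measurable_maxr.
have mfn : measurable_fun setT (EFin \o fn).
  by apply/measurable_EFinP; apply: measurable_maxr => //; exact: measurableT_comp.
pose a := nnsfun_approx measurableT mfp; pose b := nnsfun_approx measurableT mfn.
have fp0 x : 0 <= fp x by rewrite le_max lexx orbT.
have fn0 x : 0 <= fn x by rewrite le_max lexx orbT.
have below (h : T -> R) (mh : measurable_fun setT (EFin \o h)) n x : (forall x, 0 <= h x) ->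
    nnsfun_approx measurableT mh n x <= h x /\
    (nnsfun_approx measurableT mh k x @[k --> \oo] --> h x).
  move=> h0; have cv : EFin \o nnsfun_approx measurableT mh ^~ x @ \oo --> (h x)%:E.
    by apply: cvg_nnsfun_approx => // y _; rewrite lee_fin.
  split; last exact: fine_cvg cv.
  have nd : nondecreasing_seq (EFin \o nnsfun_approx measurableT mh ^~ x).
    by move=> i j ij; rewrite lee_fin; exact/lefP/nd_nnsfun_approx.
  rewrite -lee_fin -(cvg_lim _ cv)// (cvg_lim _ (ereal_nondecreasing_cvgn nd))//.
  by apply: ereal_sup_ubound; exists n.
have fE x : f x = fp x - fn x.
  by rewrite /fp /fn; case: (leP (f x) 0) => f0; case: (leP (- f x) 0) => f1; lra.
pose E n x := ((f x - (a n x - b n x)) ^+ 2)%:E.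
have mE n : measurable_fun setT (E n).
  apply/measurable_EFinP; apply: measurable_funX; apply: measurable_funB => //.
  by apply: measurable_funB.
have : (\int[mu]_x E n x)%E @[n --> \oo] --> (\int[mu]_x 0)%E.
  have [] := @dominated_convergence _ _ _ mu setT measurableT E (cst 0%E)
    (fun x => (f x ^+ 2)%:E) mE _ _ if2 _ => //.
  - apply: aeW => x _; apply: cvg_EFin; first by near=> n.
    have -> : (0 : R) = (f x - (fp x - fn x)) * (f x - (fp x - fn x)).
      by rewrite -fE subrr mul0r.
    have cE : f x - (a n x - b n x) @[n --> \oo] --> f x - (fp x - fn x).
      apply: cvgB; first exact: cvg_cst.
      by apply: cvgB; [exact: (below _ mfp 0%N x fp0).2|exact: (below _ mfn 0%N x fn0).2].
    rewrite (_ : fine \o _ = fun n => (f x - (a n x - b n x)) * (f x - (a n x - b n x))).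
      exact: cvgM.
    by apply/funext => n; rewrite /E /= expr2.
  - apply: aeW => x n _; rewrite /E /= lee_fin ger0_norm ?sqr_ge0//.
    have [an _] := below _ mfp n x fp0; have [bn _] := below _ mfn n x fn0.
    have a0 : 0 <= a n x by []; have b0 : 0 <= b n x by [].
    move: a0 b0 an bn; rewrite -/a -/b /fp /fn; set A := a n x; set B := b n x.
    by case: (leP (f x) 0) => f0; case: (leP (- f x) 0) => f1; nra.
rewrite integral0 => cv.
have : \forall n \near \oo, (\int[mu]_x E n x < e%:E)%E.
  by apply: (cv (fun u => (u < _)%E)); apply: open_ereal_lt'; rewrite lte_fin.
move=> [n _ /(_ n (leqnn n)) En].
have ffa : finite_set (range (a n)) by exact: fimfunP.
have mfa : measurable_fun setT (a n) by exact: measurable_funP.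
have ffb : finite_set (range (b n)) by exact: fimfunP.
have mfb : measurable_fun setT (b n) by exact: measurable_funP.
have [I [c [u [mc au _]]]] := simple_function_quantizer mfa ffa.
have [J [c' [u' [mc' bu _]]]] := simple_function_quantizer mfb ffb.
exists (I * J)%type, (fun x => (c x, c' x)), (fun k => u k.1 - u' k.2).
split; first exact: quantizer_pair.
rewrite /Rintegral -lee_fin fineK; last first.
  rewrite ge0_fin_numE.
    apply: le_lt_trans (ltry e); apply: ltW.
    by rewrite (eq_integral (E n))// => x _; rewrite /E au bu.
  by apply: integral_ge0 => x _; rewrite lee_fin sqr_ge0.
by apply: ltW; rewrite (eq_integral (E n))// => x _; rewrite /E au bu.
Unshelve. all: by end_near.
Qed.

End square_integrable.

Section maximal_correlation.
Context d1 d2 (T1 : measurableType d1) (T2 : measurableType d2) (R : realType).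
Context (P : probability (T1 * T2)%type R).

Lemma correlations_le x : correlations P x -> (x <= maximal_correlation P)%E.
Proof.
move=> Px; rewrite /maximal_correlation ifF; first exact: ereal_sup_ubound.
by apply/eqP => P0; move: Px; rewrite P0.
Qed.

Lemma quantized_correlation (I J : finType) (c : T1 -> I) (d : T2 -> J)
    (mc : quantizer c) (md : quantizer d) (u : I -> R) (v : J -> R) :
  \sum_a row_law (quantized_law P c d) a * u a = 0 ->
  \sum_b col_law (quantized_law P c d) b * v b = 0 ->
  \sum_a row_law (quantized_law P c d) a * u a ^+ 2 = 1 ->
  \sum_b col_law (quantized_law P c d) b * v b ^+ 2 = 1 ->
  correlations P (\sum_a \sum_b quantized_law P c d a b * (u a * v b))%:E.
Proof.
move=> u0 v0 u1 v1; set L := quantized_law P c d in u0 v0 u1 v1 *.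
have mg := quantizer_measurable mc u; have mh := quantizer_measurable md v.
pose g : {mfun T1 >-> R} := HB.pack (fun x => u (c x)) (isMeasurableFun.Build _ _ _ _ _ mg).
pose h : {mfun T2 >-> R} := HB.pack (fun x => v (d x)) (isMeasurableFun.Build _ _ _ _ _ mh).
have E1 (w : I -> R) : ('E_(marginal1 P)[fun x => w (c x)] = (\sum_a row_law L a * w a)%:E)%E.
  rewrite expectation.unlock (integral_quantized mc) -sumEFin; apply: eq_bigr => a _.
  by rewrite muleC EFinM; congr (_ * _)%E; exact: marginal1_cell.
have E2 (w : J -> R) : ('E_(marginal2 P)[fun x => w (d x)] = (\sum_b col_law L b * w b)%:E)%E.
  rewrite expectation.unlock (integral_quantized md) -sumEFin; apply: eq_bigr => b _.
  by rewrite muleC EFinM; congr (_ * _)%E; exact: marginal2_cell.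
exists g, h; split.
- by split; rewrite /g /= ?(E1 u) ?(E1 (fun a => u a ^+ 2)) ?u0 ?u1.
- by split; rewrite /h /= ?(E2 v) ?(E2 (fun a => v a ^+ 2)) ?v0 ?v1.
- rewrite expectation.unlock /g /h /=.
  apply/esym; apply: etrans (integral_quantized (quantizer_rectangle mc md) P
    (fun k => u k.1 * v k.2)) _.
  rewrite pair_bigA /= -sumEFin; apply: eq_bigr => -[a b] _ /=.
  by rewrite EFinM muleC rectangle_fiber quantized_lawE.
Qed.

(** Normalise [u] and [v], and use the definition for both [u] and [- u] to bound
    the absolute value. *)
Lemma maximal_correlation_bound (r : R) : 0 <= r ->
  (maximal_correlation P <= r%:E)%E ->
  forall (I J : finType) (c : T1 -> I) (d : T2 -> J),
    quantizer c -> quantizer d -> correlation_bound (quantized_law P c d) (r ^+ 2).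
Proof.
move=> r0 Pr I J c d mc md u v u0 v0; set L := quantized_law P c d in u0 v0 *.
set nu := \sum_a row_law L a * u a ^+ 2; set nv := \sum_b col_law L b * v b ^+ 2.
have L0 : forall a b, 0 <= L a b by exact: quantized_law_ge0.
have nu0 : 0 <= nu by apply: sumr_ge0 => a _; rewrite mulr_ge0 ?sqr_ge0 ?row_law_ge0.
have nv0 : 0 <= nv by apply: sumr_ge0 => b _; rewrite mulr_ge0 ?sqr_ge0 ?col_law_ge0.
have [nuv0|nuvn0] := eqVneq (nu * nv) 0.
  by rewrite -mulrA nuv0 mulr0; have := correlation_bound1 L0 u0 v0; rewrite mul1r -/nu -/nv nuv0.
move: nuvn0; rewrite mulf_eq0 negb_or => /andP[nun0 nvn0].
have su : 0 < Num.sqrt nu by rewrite sqrtr_gt0 lt_neqAle eq_sym nun0.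
have sv : 0 < Num.sqrt nv by rewrite sqrtr_gt0 lt_neqAle eq_sym nvn0.
have nuE : Num.sqrt nu ^+ 2 = nu by rewrite sqr_sqrtr.
have nvE : Num.sqrt nv ^+ 2 = nv by rewrite sqr_sqrtr.
set X := \sum_a \sum_b _.
have key (s : R) : s ^+ 2 = 1 -> s * X <= r * (Num.sqrt nu * Num.sqrt nv).
  move=> s1.
  have := @quantized_correlation _ _ c d mc md (fun a => s * u a / Num.sqrt nu)
    (fun b => v b / Num.sqrt nv).
  rewrite -/L => /(_ _ _ _ _)/correlations_le/le_trans/(_ Pr).
  rewrite lee_fin (_ : \sum_a _ = s * X / (Num.sqrt nu * Num.sqrt nv)); last first.
    rewrite /X mulr_sumr mulr_suml; apply: eq_bigr => a _.
    rewrite mulr_sumr mulr_suml; apply: eq_bigr => b _.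
    by rewrite invfM; ring.
  rewrite ler_pdivrMr ?mulr_gt0//; apply.
  - by under eq_bigr do rewrite mulrA mulrCA; rewrite -mulr_suml -mulr_sumr u0 mulr0 mul0r.
  - by under eq_bigr do rewrite mulrA; rewrite -mulr_suml v0 mul0r.
  - under eq_bigr do rewrite !exprMn s1 mul1r mulrA.
    by rewrite -mulr_suml -/nu exprVn nuE divff.
  - under eq_bigr do rewrite exprMn mulrA.
    by rewrite -mulr_suml -/nv exprVn nvE divff.
have k1 := key 1 (expr1n _ _); have k2 := key (-1) (etrans (sqrrN 1) (expr1n _ _)).
have -> : r ^+ 2 * nu * nv = (r * (Num.sqrt nu * Num.sqrt nv)) ^+ 2.
  by rewrite !exprMn nuE nvE mulrA.
rewrite -[X ^+ 2]real_normK ?num_real// ler_sqr ?nnegrE ?mulr_ge0 ?sqrtr_ge0//.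
by rewrite ler_norml; apply/andP; split; lra.
Qed.

Lemma standardized_square_integrable d (T : measurableType d) (mu : probability T R)
    (g : {mfun T >-> R}) : standardized mu g ->
  [/\ square_integrable mu g, \int[mu]_x g x = 0 & \int[mu]_x g x ^+ 2 = 1].
Proof.
rewrite /standardized !expectation.unlock => -[g0 g1].
have mg : measurable_fun setT g by exact: measurable_funP.
split; last 2 first.
- by rewrite /Rintegral g0.
- by rewrite /Rintegral g1.
split => //; apply/integrableP; split.
  by apply/measurable_EFinP; exact: measurable_funX.
rewrite (eq_integral (fun x => (g x ^+ 2)%:E)) ?g1 ?ltry// => x _.
by rewrite /= ger0_norm ?sqr_ge0.
Qed.

Lemma square_integrable_fst g : square_integrable (marginal1 P) g ->
  square_integrable P (fun z => g z.1).
Proof.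
move=> [mg ig2]; have mG := measurableT_comp mg (@measurable_fst _ _ T1 T2).
split => //.
apply/integrableP; split; first by apply/measurable_EFinP; exact: measurable_funX.
have /integrableP[mg2 ] := ig2; apply: le_lt_trans.
by rewrite (ge0_integral_pushforward (@measurable_fst _ _ T1 T2))//; exact: measurableT_comp.
Qed.

Lemma square_integrable_snd h : square_integrable (marginal2 P) h ->
  square_integrable P (fun z => h z.2).
Proof.
move=> [mh ih2]; have mH := measurableT_comp mh (@measurable_snd _ _ T1 T2).
split => //.
apply/integrableP; split; first by apply/measurable_EFinP; exact: measurable_funX.
have /integrableP[mh2 ] := ih2; apply: le_lt_trans.
by rewrite (ge0_integral_pushforward (@measurable_snd _ _ T1 T2))//; exact: measurableT_comp.
Qed.

Lemma Rintegral_fst f : measurable_fun [set: T1] f ->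
  P.-integrable [set: T1 * T2] (fun z => (f z.1)%:E) ->
  \int[marginal1 P]_x f x = \int[P]_z f z.1.
Proof.
move=> mf If; congr fine.
by apply: (integral_pushforward (@measurable_fst _ _ T1 T2)) => //; exact/measurable_EFinP.
Qed.

Lemma Rintegral_snd f : measurable_fun [set: T2] f ->
  P.-integrable [set: T1 * T2] (fun z => (f z.2)%:E) ->
  \int[marginal2 P]_x f x = \int[P]_z f z.2.
Proof.
move=> mf If; congr fine.
by apply: (integral_pushforward (@measurable_snd _ _ T1 T2)) => //; exact/measurable_EFinP.
Qed.

(** For standardized functions, correlation close to [1] means closeness in [L^2]
    under the joint law. *)
Lemma correlation_distance (g : {mfun T1 >-> R}) (h : {mfun T2 >-> R}) :
  standardized (marginal1 P) g -> standardized (marginal2 P) h ->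
  exists2 r : R, ('E_P[fun z => (g z.1 * h z.2)%R] = r%:E)%E &
    \int[P]_z (g z.1 - h z.2) ^+ 2 = 2 - 2 * r.
Proof.
move=> /standardized_square_integrable[sg _ g1] /standardized_square_integrable[sh _ h1].
have sG := square_integrable_fst sg; have sH := square_integrable_snd sh.
have iGH := square_integrableM sG sH.
exists (\int[P]_z (g z.1 * h z.2)).
  by rewrite expectation.unlock fineK//; exact: integrable_fin_num iGH.
have [mG iG2] := sG; have [mH iH2] := sH.
have [mg _] := sg; have [mh _] := sh.
rewrite (_ : (fun z => _) = (fun z => (g z.1 ^+ 2 + h z.2 ^+ 2) - 2 * (g z.1 * h z.2))); last first.
  by apply/funext => z; ring.
rewrite RintegralB//; first last.
- exact: (integrableZl _ 2 iGH).
- exact: (integrableD _ iG2 iH2).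
rewrite RintegralD// RintegralZl//.
rewrite -(Rintegral_fst (f := fun x => g x ^+ 2))//; last exact: measurable_funX.
rewrite -(Rintegral_snd (f := fun x => h x ^+ 2))//; last exact: measurable_funX.
by rewrite g1 h1.
Qed.

Lemma maximal_correlation_le1 : (maximal_correlation P <= 1)%E.
Proof.
rewrite /maximal_correlation; case: eqP => // _.
apply: ge_ereal_sup => _ [g [h [sg sh ->]]].
have [r -> rE] := correlation_distance sg sh.
have : 0 <= \int[P]_z (g z.1 - h z.2) ^+ 2 by apply: Rintegral_ge0 => z _; exact: sqr_ge0.
by rewrite rE lee_fin; lra.
Qed.

(** Simple functions close in [L^2] to a nearly optimal pair for the maximal
    correlation: they nearly agree under [P] while the first has a variance bounded
    below. *)
Lemma nearly_equal_quantizations (e : R) : maximal_correlation P = 1%E -> 0 < e ->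
  exists (I J : finType) (c : T1 -> I) (d : T2 -> J) (u : I -> R) (v : J -> R),
    let L := quantized_law P c d in
    [/\ quantizer c, quantizer d,
        \sum_a \sum_b L a b * (u a - v b) ^+ 2 <= e &
        4^-1 <= \sum_a row_law L a * u a ^+ 2 - (\sum_a row_law L a * u a) ^+ 2].
Proof.
move=> P1 e0.
have [x Px xe] : exists2 x, correlations P x & ((1 - e / 18)%:E < x)%E.
  move: P1; rewrite /maximal_correlation; case: eqP => [_ /eqP|_ P1].
    by rewrite eqe eq_sym oner_eq0.
  have : ((1 - e / 18)%:E < ereal_sup (correlations P))%E.
    by rewrite P1 lte_fin; lra.
  by move=> /ereal_sup_gt[x Px xe]; exists x.
have [g [h [sg sh xE]]] := Px.
have [r rE distE] := correlation_distance sg sh.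
rewrite xE rE lte_fin in xe.
have [sg1 g0 g1] := standardized_square_integrable sg.
have [sh1 h0 h1] := standardized_square_integrable sh.
(* [u - v] is the sum of three differences, of squared norms at most [e'], [e / 9]
   and [e'], and squaring the sum costs a factor [3]; the variance of [u] is at
   least [1 / 2 - 2 * e'] *)
pose e' := Num.min (e / 9) (8^-1).
have e'0 : 0 < e' by rewrite lt_min; apply/andP; split; lra.
have e'1 : e' <= 8^-1 by rewrite ge_min lexx orbT.
have e'e : e' <= e / 9 by rewrite ge_min lexx.
have [I [c [u [mc gu]]]] := square_integrable_approx sg1 e'0.
have [J [d [v [md hv]]]] := square_integrable_approx sh1 e'0.
exists I, J, c, d, u, v => L.
have su := square_integrable_quantized (marginal1 P) u mc.
have sv := square_integrable_quantized (marginal2 P) v md.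
have rowE (w : I -> R) : \sum_a row_law L a * w a = \int[marginal1 P]_x w (c x).
  rewrite Rintegral_quantized//; apply: eq_bigr => a _; congr (_ * _).
  by apply: EFin_inj; rewrite -(marginal1_cell P mc md) fineK// fin_num_measure//; exact: mc.
split=> //.
- have mcd := quantizer_rectangle mc md.
  have sU := square_integrable_fst su; have sV := square_integrable_snd sv.
  have sG := square_integrable_fst sg1; have sH := square_integrable_snd sh1.
  have -> : \sum_a \sum_b L a b * (u a - v b) ^+ 2 = \int[P]_z (u (c z.1) - v (d z.2)) ^+ 2.
    rewrite pair_bigA /=; apply/esym.
    apply: etrans (Rintegral_quantized P (fun k => (u k.1 - v k.2) ^+ 2) mcd) _.
    by apply: eq_bigr => -[a b] _ /=; rewrite rectangle_fiber quantized_lawE.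
  have sUG := square_integrableB sG sU; have sVH := square_integrableB sH sV.
  have sGH := square_integrableB sG sH; have sUV := square_integrableB sU sV.
  apply: (@le_trans _ _ (\int[P]_z (3 * (g z.1 - u (c z.1)) ^+ 2 +
      (3 * (g z.1 - h z.2) ^+ 2 + 3 * (h z.2 - v (d z.2)) ^+ 2)))).
    apply: le_Rintegral => //; first exact: sUV.2.
      exact: (integrableD _ (integrableZl _ 3 sUG.2)
         (integrableD _ (integrableZl _ 3 sGH.2) (integrableZl _ 3 sVH.2))).
    move=> z _; set A := g z.1; set B := u _; set C := h _; set D := v _.
    have := sqr_ge0 ((A - B) + (A - C)); have := sqr_ge0 ((A - C) - (C - D)).
    have := sqr_ge0 ((A - B) + (C - D)); nra.
  have iUG := integrableZl measurableT 3 sUG.2.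
  have iGH := integrableZl measurableT 3 sGH.2.
  have iVH := integrableZl measurableT 3 sVH.2.
  rewrite RintegralD//; last exact: (integrableD _ iGH iVH).
  rewrite RintegralD//.
  rewrite (RintegralZl 3 measurableT sUG.2) (RintegralZl 3 measurableT sGH.2).
  rewrite (RintegralZl 3 measurableT sVH.2) distE.
  have := square_integrableB sg1 su; have := square_integrableB sh1 sv => -[mhv _] [mgu _].
  rewrite -(Rintegral_fst (f := fun x => (g x - u (c x)) ^+ 2)); first last.
  - exact: sUG.2.
  - exact: measurable_funX.
  rewrite -(Rintegral_snd (f := fun x => (h x - v (d x)) ^+ 2)); first last.
  - exact: sVH.2.
  - exact: measurable_funX.
  lra.
- rewrite (rowE u) (rowE (fun a => u a ^+ 2)); set mu := marginal1 P.
  have sgu := square_integrableB sg1 su.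
  set m := \int[mu]_x u (c x).
  have V1 : 2^-1 - e' <= \int[mu]_x u (c x) ^+ 2.
    have : \int[mu]_x g x ^+ 2 <= \int[mu]_x (2 * (g x - u (c x)) ^+ 2 + 2 * u (c x) ^+ 2).
      apply: le_Rintegral => //; first exact: sg1.2.
        exact: (integrableD _ (integrableZl _ 2 sgu.2) (integrableZl _ 2 su.2)).
      move=> x0 _; have := sqr_ge0 (g x0 - 2 * u (c x0)); nra.
    rewrite RintegralD//; [|exact: (integrableZl _ 2 sgu.2)|exact: (integrableZl _ 2 su.2)].
    rewrite (RintegralZl 2 measurableT sgu.2) (RintegralZl 2 measurableT su.2) g1.
    lra.
  have V2 : m ^+ 2 <= e'.
    have igu := square_integrable1 sgu.
    have gum : \int[mu]_x (g x - u (c x)) = - m.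
      rewrite RintegralB//; last 2 first.
      - exact: square_integrable1.
      - exact: square_integrable1.
      by rewrite g0 sub0r.
    have : 0 <= \int[mu]_x (((g x - u (c x)) ^+ 2 + 2 * m * (g x - u (c x))) + m ^+ 2).
      by apply: Rintegral_ge0 => x0 _; have := sqr_ge0 (g x0 - u (c x0) + m); nra.
    have i1 := integrableZl measurableT (2 * m) igu.
    have i2 := finite_measure_integrable_cst mu (m ^+ 2) measurableT.
    rewrite RintegralD//; last exact: (integrableD _ sgu.2 i1).
    rewrite RintegralD//; last exact: sgu.2.
    have muT : fine (mu setT) = 1 by rewrite (probability_setT mu).
    rewrite RintegralZl// gum (_ : \int[mu]_x m ^+ 2 = m ^+ 2); last first.
      by rewrite Rintegral_cst// -[RHS]mulr1 -muT.
    by move: gu; rewrite -/mu; nra.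
  lra.
Qed.

End maximal_correlation.

(** * Tests *)

Section detection.
Context d1 d2 (T1 : measurableType d1) (T2 : measurableType d2) (R : realType).
Context (P : probability (T1 * T2)%type R).

Lemma measurable_indicator d (T : measurableType d) (A : set T) : measurable A ->
  measurable_fun [set: T] (fun x => x \in A).
Proof.
move=> mA _ Y _; rewrite setTI.
rewrite (_ : _ @^-1` Y = \bigcup_(b in Y) ((fun x => x \in A) @^-1` [set b])).
  apply: fin_bigcup_measurable; first exact: finite_finset.
  by move=> b _; exact: quantizer_indicator.
by apply/seteqP; split => x /= => [Yx|[b Yb ->//]]; exists (x \in A).
Qed.

Lemma cvg_0_ereal (g : nat -> \bar R) : (forall n, (0 <= g n)%E) ->
  (forall e, 0 < e -> \forall n \near \oo, (g n <= e%:E)%E) ->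
  g n @[n --> \oo] --> 0%E.
Proof.
move=> g0 ge; apply/fine_cvgP; split.
  have := ge 1 ltr01; apply: filterS => n gn.
  by rewrite ge0_fin_numE// (le_lt_trans gn)// ltry.
apply/cvgrPdist_le => e e0; have := ge e e0; apply: filterS => n gn /=.
rewrite sub0r normrN ger0_norm ?fine_ge0// -lee_fin fineK//.
by rewrite ge0_fin_numE// (le_lt_trans gn)// ltry.
Qed.

(** The tests may depend on the error level [e], unlike in [strong_detection]. *)
Definition eventually_detectable (m : nat -> nat) : Prop :=
  forall e : R, 0 < e -> \forall n \near \oo,
    exists2 A : set (n.-tuple T1 * (m n).-tuple T2), measurable A &
      fine (null_law P n (m n) A) <= e /\ alt_prob P (~` A) <= e.

(** For each [n] take a test whose total error is within [n.+1^-1] of the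
    infimum: it is eventually as good as any given sequence of tests. *)
Lemma eventually_detectable_strong (m : nat -> nat) : (forall n, (m n <= n)%N) ->
  eventually_detectable m -> strong_detection P m.
Proof.
move=> mn det.
pose err n (A : set (n.-tuple T1 * (m n).-tuple T2)) :=
  fine (null_law P n (m n) A) + alt_prob P (~` A).
have near_best : forall n, exists A : set (n.-tuple T1 * (m n).-tuple T2),
    measurable A /\ forall B, measurable B -> err n A <= err n B + n.+1%:R^-1.
  move=> n; pose E := [set err n B | B in measurable].
  have Ei : has_inf E.
    split; first by exists (err n set0), set0.
    by exists 0 => _ [B mB <-]; rewrite addr_ge0 ?fine_ge0 ?alt_prob_ge0.
  have n0 : 0 < n.+1%:R^-1 :> R by rewrite invr_gt0.
  have [_ [B mB <-] Bn] := inf_adherent n0 Ei.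
  exists B; split=> // B' mB'; apply: le_trans (ltW Bn) _.
  by rewrite lerD2r; apply: ge_inf; [exact: Ei.2|exists B'].
pose A n := sval (cid (near_best n)).
have HA n := svalP (cid (near_best n)); rewrite -/(A _) in HA.
have err0 e : 0 < e -> \forall n \near \oo, err n (A n) <= e.
  move=> e0; have e4 : 0 < e / 4 by rewrite divr_gt0.
  have e2 : 0 < e / 2 by rewrite divr_gt0.
  near=> n.
  have [B mB [nB aB]] : exists2 B : set (n.-tuple T1 * (m n).-tuple T2), measurable B &
      fine (null_law P n (m n) B) <= e / 4 /\ alt_prob P (~` B) <= e / 4.
    by near: n; exact: det.
  have h : err n (A n) <= fine (null_law P n (m n) B) + alt_prob P (~` B) + n.+1%:R^-1.
    exact: (HA n).2.
  have ne : n.+1%:R^-1 <= e / 2.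
    by apply: ltW; near: n; exact: (near_infty_natSinv_lt (PosNum e2)).
  by apply: le_trans h _; apply: le_trans (lerD (lerD nB aB) ne) _; lra.
have fE n : (fun z => z \in A n) @^-1` [set false] = ~` A n.
  apply/seteqP; split => z /=; first by move=> zA Az; rewrite mem_set in zA.
  by move=> zA; rewrite memNset.
have tE n : (fun z => z \in A n) @^-1` [set true] = A n.
  by apply/seteqP; split => z /= => [/set_mem|/mem_set].
have mA n : measurable (A n) by exact: (HA n).1.
exists (fun n z => z \in A n); split => [n||].
- by apply: measurable_indicator; exact: mA.
- apply: cvg_0_ereal => // e e0; have := err0 e e0; apply: filterS => n.
  rewrite tE /err => h.
  rewrite -[leLHS]fineK; last by apply: fin_num_measure; exact: mA.
  rewrite lee_fin.
  by apply: le_trans h; rewrite lerDl alt_prob_ge0.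
- have mAC n : measurable (~` A n) by apply: measurableC; exact: mA.
  apply: cvg_0_ereal => [n|e e0]; first by rewrite fE (alt_lawE P (mAC n)) lee_fin alt_prob_ge0.
  have := err0 e e0; apply: filterS => n.
  rewrite fE (alt_lawE P (mAC n)) lee_fin; apply: le_trans.
  by rewrite /err lerDr fine_ge0.
Unshelve. all: by end_near.
Qed.

Lemma alt_prob_quantized (I J : finType) (c : T1 -> I) (d : T2 -> J) n m
    (Q : pred ({ffun 'I_n -> I} * {ffun 'I_m -> J})) (e : R) :
  quantizer c -> quantizer d -> (m <= n)%N ->
  (forall pi : {ffun 'I_m -> 'I_n}, injective pi ->
    \sum_(z | Q z) planted_weight (quantized_law P c d) pi z.1 z.2 <= e) ->
  alt_prob P [set z | Q (quantize c d z)] <= e.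
Proof.
move=> mc md mn He; rewrite -[leRHS](average_cst e mn) /alt_prob.
rewrite ler_pM2l ?invr_gt0 ?injections_gt0//; apply: ler_sum => pi.
rewrite inE => /injectiveP inj.
by rewrite planted_law_quantized//=; exact: He.
Qed.

Lemma measurable_quantized n m (I J : finType) (c : T1 -> I) (d : T2 -> J)
    (Q : pred ({ffun 'I_n -> I} * {ffun 'I_m -> J})) :
  quantizer c -> quantizer d -> measurable [set z | Q (quantize c d z)].
Proof.
move=> mc md; apply: quantized_sets_measurable.
by exists I, J, c, d, Q.
Qed.

(** Chebyshev's inequality for the kernel statistic of a quantization with large
    chi-square [t], at half the planted mean [m n * t]. *)
Lemma detectable_chi2 (alpha : R) (m : nat -> nat) : 0 < alpha ->
  (forall n, (m n <= n)%N) ->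
  (\forall n \near \oo, alpha * n%:R <= (m n)%:R) ->
  chi2_information P = +oo%E -> eventually_detectable m.
Proof.
move=> a0 mn am Poo e e0.
(* [4 * n * m * t], the contribution of the unmatched entries to the planted
   variance, is at most an eighth of [e * (m * t) ^+ 2] when [K < t] and
   [alpha * n <= m] *)
pose K := 32 / (alpha * e).
have K0 : 0 < K by rewrite divr_gt0// mulr_gt0.
have [I [J [c [d [mc md tK]]]]] : exists (I J : finType) (c : T1 -> I) (d : T2 -> J),
    [/\ quantizer c, quantizer d & K < finite_chi2 (quantized_law P c d)].
  apply: contrapT => no; have : (chi2_information P < +oo)%E.
    apply: (@chi2_information_lty _ _ _ _ _ P K (ltW K0)) => I J c d mc md.
    by rewrite leNgt; apply/negP => tK; apply: no; exists I, J, c, d.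
  by rewrite Poo.
set L := quantized_law P c d in tK.
have L0 : forall a b, 0 <= L a b by exact: quantized_law_ge0.
have L1 : \sum_a \sum_b L a b = 1 by exact: quantized_law_sum.
set t := finite_chi2 L in tK; have t0 : 0 < t by exact: lt_trans tK.
pose D := \sum_a \sum_b L a b * centred_density L a b ^+ 2.
have D0 : 0 <= D by apply: sumr_ge0 => a _; apply: sumr_ge0 => b _; rewrite mulr_ge0 ?sqr_ge0.
near=> n.
have n0 : 0 < n%:R :> R by rewrite ltr0n; near: n; exists 1%N.
have man : alpha * n%:R <= (m n)%:R by near: n; exact: am.
(* the contribution [2 * m * D] of the matched entries to the planted variance is
   of smaller order than [(m * t) ^+ 2] *)
have Dn : 16 * D / (alpha * t ^+ 2 * e) <= n%:R.
  near: n; exact: nbhs_infty_ger.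
have m0 : 0 < (m n)%:R :> R by apply: lt_le_trans man; rewrite mulr_gt0.
pose th := (m n)%:R * t / 2.
have th0 : 0 < th by rewrite divr_gt0// mulr_gt0.
pose Q (z : {ffun 'I_n -> I} * {ffun 'I_(m n) -> J}) := th < kernel_statistic L z.
exists [set z | Q (quantize c d z)]; first exact: measurable_quantized.
have aet : 32 < alpha * e * t by rewrite mulrC -ltr_pdivrMr ?mulr_gt0.
have n4 : 32 * n%:R <= e * (m n)%:R * t.
  rewrite -(ler_pM2l a0); apply: (@le_trans _ _ (32 * (m n)%:R)); first by lra.
  have -> : alpha * (e * (m n)%:R * t) = (alpha * e * t) * (m n)%:R by ring.
  by rewrite ler_wpM2r// ltW.
have mD : 16 * D <= e * (m n)%:R * t ^+ 2.
  have ate0 : 0 < alpha * t ^+ 2 * e by rewrite !mulr_gt0.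
  rewrite ler_pdivrMr// in Dn; apply: le_trans Dn _.
  have -> : n%:R * (alpha * t ^+ 2 * e) = (alpha * n%:R) * (e * t ^+ 2) by ring.
  have -> : e * (m n)%:R * t ^+ 2 = (m n)%:R * (e * t ^+ 2) by ring.
  by rewrite ler_wpM2r// mulr_ge0 ?sqr_ge0// ltW.
have mt0 : 0 < (m n)%:R * t by rewrite mulr_gt0.
have mn4 : 32 * (n%:R * (m n)%:R * t) <= e * ((m n)%:R * t) ^+ 2.
  have -> : 32 * (n%:R * (m n)%:R * t) = (32 * n%:R) * ((m n)%:R * t) by ring.
  have -> : e * ((m n)%:R * t) ^+ 2 = (e * (m n)%:R * t) * ((m n)%:R * t) by ring.
  by rewrite ler_wpM2r// ltW.
have mmD : 16 * ((m n)%:R * D) <= e * ((m n)%:R * t) ^+ 2.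
  have -> : 16 * ((m n)%:R * D) = (m n)%:R * (16 * D) by ring.
  have -> : e * ((m n)%:R * t) ^+ 2 = (m n)%:R * (e * (m n)%:R * t ^+ 2) by ring.
  by rewrite ler_wpM2l.
have th2 : th ^+ 2 = ((m n)%:R * t) ^+ 2 / 4 by rewrite /th; field.
split.
  rewrite null_law_quantized//=.
  apply: (@le_trans _ _ (n%:R * (m n)%:R * t / th ^+ 2)).
    apply: (@chebyshev_sum _ _ _ (kernel_statistic L)) => //.
    - by move=> z; exact: null_weight_ge0.
    - by rewrite kernel_statistic_null// !card_ord.
    - by move=> z Qz; rewrite lerXn2r ?nnegrE ?ltW// (lt_trans th0).
  by rewrite ler_pdivrMr ?exprn_gt0// th2; have := sqr_ge0 ((m n)%:R * t); nra.
rewrite (_ : ~` _ = [set z | predC Q (quantize c d z)]); last first.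
  by apply/seteqP; split => z /= /negP.
apply: alt_prob_quantized => // pi inj.
apply: (@le_trans _ _ ((2 * ((m n)%:R * D) + 4 * (n%:R * (m n)%:R * t)) / th ^+ 2)).
  apply: (@chebyshev_sum _ _ _ (fun z => kernel_statistic L z - (m n)%:R * t)) => //.
  - by move=> z; exact: planted_weight_ge0.
  - by have := kernel_statistic_planted L0 L1 inj; rewrite !card_ord.
  - move=> z; rewrite /Q /= -leNgt => zth.
    have h : th <= (m n)%:R * t - kernel_statistic L z.
      by move: zth; rewrite /th; lra.
    by rewrite -[leRHS]sqrrN opprB lerXn2r ?nnegrE ?(ltW th0)// (le_trans (ltW th0)).
by rewrite ler_pdivrMr ?exprn_gt0// th2; lra.
Unshelve. all: by end_near.
Qed.

End detection.

Section detection_correlation.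
Context d1 d2 (T1 : measurableType d1) (T2 : measurableType d2) (R : realType).
Context (P : probability (T1 * T2)%type R).

(** The event is that the centred difference statistic is below
    [sqrt n / (N * th0)]. The constants are chosen in this order: [b] and [N] make
    the anticoncentration bound small, [th0] fixes the scale, [ep] makes the
    planted variance small at that scale; then [u] and [v] are chosen, and [n] is
    taken large. *)
Lemma detectable_correlation : maximal_correlation P = 1%E ->
  eventually_detectable P id.
Proof.
move=> P1 e e0; have c10 := cos1_gt0 R; set c1 := cos (1 : R) in c10.
have ec0 : 0 < e * c1 / 2 by rewrite divr_gt0// mulr_gt0.
pose b := e * c1 / 2; pose N := (Num.bound (b^-1)).+1.
have NR : 0 < N%:R :> R by rewrite ltr0n.
have Nb : N%:R^-1 <= b.
  rewrite invf_ple ?posrE//; apply: ltW; apply: lt_le_trans (archi_boundP _) _.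
    by rewrite invr_ge0 ltW.
  by rewrite ler_nat.
pose th0 := 2 / (c1 * b); have th00 : 0 < th0 by rewrite divr_gt0// mulr_gt0.
have th0b : c1 ^+ 2 * th0 ^+ 2 * b ^+ 2 = 4.
  by rewrite /th0; field; rewrite !gt_eqF.
pose ep := e / (N%:R * th0) ^+ 2.
have ep0 : 0 < ep by rewrite divr_gt0// exprn_gt0// mulr_gt0.
have [I [J [c [d [u [v [mc md uv Vu]]]]]]] := nearly_equal_quantizations P1 ep0.
set L := quantized_law P c d in uv Vu.
have L0 : forall a b, 0 <= L a b by exact: quantized_law_ge0.
have L1 : \sum_a \sum_b L a b = 1 by exact: quantized_law_sum.
pose B := \sum_a \sum_a' `|u a - u a'|.
have uB a a' : `|u a - u a'| <= B.
  rewrite /B (bigD1 a)//= (bigD1 a')//= -addrA lerDl addr_ge0//.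
    by apply: sumr_ge0 => *; exact: normr_ge0.
  by apply: sumr_ge0 => *; apply: sumr_ge0 => *; exact: normr_ge0.
have B0 : 0 <= B by apply: sumr_ge0 => *; apply: sumr_ge0 => *; exact: normr_ge0.
near=> n.
have n0 : 0 < n%:R :> R by rewrite ltr0n; near: n; exists 1%N.
have nB : (N%:R * th0 * B) ^+ 2 <= n%:R by near: n; exact: nbhs_infty_ger.
have sn0 : 0 < Num.sqrt (n%:R : R) by rewrite sqrtr_gt0.
have sn2 : Num.sqrt (n%:R : R) ^+ 2 = n%:R by rewrite sqr_sqrtr// ltW.
pose th := th0 / Num.sqrt (n%:R : R); have thp : 0 < th by rewrite divr_gt0.
have th2 : th ^+ 2 * n%:R = th0 ^+ 2.
  by rewrite /th expr_div_n sn2 divfK// gt_eqF.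
pose mean := \sum_a \sum_b L a b * (u a - v b).
pose X (z : {ffun 'I_n -> I} * {ffun 'I_n -> J}) :=
  difference_statistic u v z - n%:R * mean.
pose Q z := N%:R * `|th * X z| <= 1.
exists [set z | Q (quantize c d z)]; first exact: measurable_quantized.
split.
  rewrite null_law_quantized//=.
  rewrite (_ : \sum_(z | Q z) _ =
    expect (col_law L) (fun y => \sum_(x | Q (x, y)) \prod_k row_law L (x k))); last first.
    rewrite big_mkcond /=.
    rewrite -(pair_bigA _ (fun x y => if Q (x, y) then null_weight L x y else 0)) /=.
    rewrite exchange_big; apply: eq_bigr => y _ /=.
    rewrite -big_mkcond mulr_sumr; apply: eq_bigr => x _.
    by rewrite /null_weight mulrC.
  rewrite -[leRHS](expect_cst 'I_n (col_law_sum L1)); apply: expect_le => [k|y].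
    exact: col_law_ge0.
  apply: (@le_trans _ _ ((N%:R^-1 + b) / c1)); last first.
    by rewrite ler_pdivrMr//; apply: (@le_trans _ _ (b + b)); rewrite ?lerD2r// /b; lra.
  rewrite (eq_bigl (fun x : {ffun 'I_n -> I} => N%:R *
    `|th * (\sum_k u (x k) - (\sum_i v (y i) + n%:R * mean))| <= 1)) => [|x]; last first.
    by rewrite /Q /X /difference_statistic /= opprD addrA.
  apply: (@sum_anticoncentration _ _ _ _ _ _ _ _ B) => //.
  - exact: row_law_ge0.
  - have NtB0 : 0 <= N%:R * th0 * B by rewrite mulr_ge0// mulr_ge0// ltW.
    rewrite gtr0_norm// /th (_ : _ * _ * B = N%:R * th0 * B / Num.sqrt n%:R); last by ring.
    by rewrite ler_pdivrMr// mul1r -ler_sqr ?nnegrE ?sn2 ?(ltW sn0).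
  - by rewrite card_ord -(mulrA _ (th ^+ 2)) th2 th0b.
rewrite (_ : ~` _ = [set z | predC Q (quantize c d z)]); last first.
  by apply/seteqP; split => z /= /negP.
apply: alt_prob_quantized => // pi inj.
apply: (@le_trans _ _ (n%:R * ep / ((N%:R * th)^-1) ^+ 2)); last first.
  rewrite exprVn invrK /ep [(N%:R * th0) ^+ 2]exprMn [(N%:R * th) ^+ 2]exprMn -th2.
  rewrite le_eqVlt; apply/orP; left; apply/eqP.
  by field; rewrite !gt_eqF.
apply: (@chebyshev_sum _ _ _ X) => //.
- by move=> z; exact: planted_weight_ge0.
- by rewrite invr_gt0 mulr_gt0.
- have := difference_statistic_planted u v L0 L1 (injF_bij inj); rewrite !card_ord => h.
  by apply: le_trans h _; rewrite ler_wpM2l.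
- move=> z; rewrite /Q /= -ltNge normrM (gtr0_norm thp) mulrA => zN.
  have Nth : 0 < N%:R * th by rewrite mulr_gt0.
  have h : (N%:R * th)^-1 <= `|X z|.
    by rewrite -(ler_pM2l Nth) mulfV ?gt_eqF// ltW.
  by rewrite -[X z ^+ 2]real_normK ?num_real// lerXn2r ?nnegrE ?invr_ge0 ?(ltW Nth).
Unshelve. all: by end_near.
Qed.

End detection_correlation.

Theorem theorem2 (R : realType) (d1 d2 : measure_display)
    (T1 : measurableType d1) (T2 : measurableType d2)
    (P : probability (T1 * T2)%type R)
    (alpha : R) (alpha_gt0 : 0 < alpha) (alpha_le1 : alpha <= 1) :
  let detectable := strong_detection P (fun n => Num.truncn (alpha * n%:R)) in
  (alpha = 1 ->
     (detectable <->
      chi2_information P = +oo%E \/ maximal_correlation P = 1%E)) /\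
  (alpha < 1 -> (detectable <-> chi2_information P = +oo%E)).
Proof.
move=> detectable; pose m n := Num.truncn (alpha * n%:R).
have an0 n : 0 <= alpha * n%:R by rewrite mulr_ge0// ltW.
have man n : (m n)%:R <= alpha * n%:R by rewrite Num.Theory.truncn_le.
have mn n : (m n <= n)%N.
  by rewrite -(ler_nat R) (le_trans (man n))// ler_piMl.
have am : \forall n \near \oo, alpha / 2 * n%:R <= (m n)%:R.
  near=> n; have := truncnS_gt (alpha * n%:R); rewrite -/(m n) -natr1.
  have : 2 / alpha <= n%:R by near: n; exact: nbhs_infty_ger.
  by rewrite ler_pdivrMr// => h1 h2; lra.
have chi2_detectable : chi2_information P = +oo%E -> detectable.
  move=> Poo; apply: eventually_detectable_strong => //.
  by apply: (detectable_chi2 _ mn am Poo); rewrite divr_gt0.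
have undetectable (r : R) : 0 <= r -> alpha * r ^+ 2 < 1 ->
    (forall (I J : finType) (c : T1 -> I) (d : T2 -> J),
      quantizer c -> quantizer d -> correlation_bound (quantized_law P c d) (r ^+ 2)) ->
    detectable -> chi2_information P = +oo%E.
  move=> r0 ar rP det; apply: contrapT => Pfin.
  have [t t0 tP] : exists2 t : R, 0 <= t &
      forall (I J : finType) (c : T1 -> I) (d : T2 -> J),
      quantizer c -> quantizer d -> finite_chi2 (quantized_law P c d) <= t.
    by apply: finite_chi2_bounded; rewrite ltey; apply/eqP.
  have [C HC] := level_weight_summable (ltW alpha_gt0) t0 (sqr_ge0 r) ar.
  exact: (no_strong_detection tP rP t0 (sqr_ge0 r) alpha_le1 HC mn man det).
split=> [alpha1|alpha1].
- split=> [det|[Poo|P1]]; last 2 first.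
  + exact: chi2_detectable.
  + rewrite /detectable (_ : (fun n => _) = id).
      by apply: eventually_detectable_strong => //; exact: detectable_correlation.
    by apply/funext => n; rewrite alpha1 mul1r natrK.
  have [rho1|rho1] := eqVneq (maximal_correlation P) 1%E; first by right.
  left.
  have rho_lt : (maximal_correlation P < 1)%E.
    by rewrite lt_neqAle rho1 maximal_correlation_le1.
  pose r := Num.max 0 (fine (maximal_correlation P)).
  have r0 : 0 <= r by rewrite le_max lexx.
  have rhor : (maximal_correlation P <= r%:E)%E.
    have := rho_lt; rewrite /r; case: (maximal_correlation P) => [x|//|] _ /=.
      by rewrite lee_fin le_max lexx orbT.
    exact: leNye.
  have r1 : r < 1.
    rewrite /r gt_max ltr01; have := rho_lt; case: (maximal_correlation P) => [x| |] //=.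
  apply: (undetectable r) => //; last exact: maximal_correlation_bound.
  by rewrite alpha1 mul1r expr_lt1.
- split=> [|/chi2_detectable//]; apply: (undetectable 1) => //.
    by rewrite expr1n mulr1.
  move=> I J c d mc md; rewrite expr1n; apply: correlation_bound1.
  exact: quantized_law_ge0.
Unshelve. all: by end_near.
Qed.
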